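(* Let $H$ be a separable infinite-dimensional complex Hilbert space and let $A$ be a self-adjoint unbounded linear operator in $H$ with $(Au,u)\ge (u,u)$ for all $u\in\mathrm{Dom}\,A$. A Hilbert space $X$ belongs to the extended Hilbert scale generated by $A$ (the extended $A$-scale) if and only if $X=H^{\varphi}_{A}$ up to equivalence of norms for a certain $\varphi\in\mathrm{OR}$.
   Context: Spaces $H^\varphi_A$: here $\mathrm{Spec}\,A\subseteq[1,\infty)$. For a Borel measurable function $\varphi:[1,\infty)\to(0,\infty)$ the self-adjoint operator $\varphi(A)$ in $H$ is defined by the spectral decomposition of $A$, and $H^{\varphi}_{A}$ is the Hilbert space obtained by completing $\mathrm{Dom}\,\varphi(A)$ in the norm $\|u\|_{\varphi}:=\|\varphi(A)u\|_H$. For $s\in\mathbb{R}$, $H^{s}_{A}$ denotes $H^\varphi_A$ with $\varphi(t)\equiv t^{s}$. If $\varphi_0/\varphi_1$ is bounded on $[1,\infty)$, the identity mapping on $\mathrm{Dom}\,\varphi_1(A)$ extends uniquely to a continuous embedding $H^{\varphi_1}_A\hookrightarrow H^{\varphi_0}_A$, by which $H^{\varphi_1}_A$ is regarded as a linear manifold in $H^{\varphi_0}_A$. Class $\mathrm{OR}$: all Borel measurable $\varphi:[1,\infty)\to(0,\infty)$ for which there exist numbers $a>1$ and $c\ge1$ such that $c^{-1}\le\varphi(\lambda t)/\varphi(t)\le c$ for all $t\ge1$ and $\lambda\in[1,a]$. All spaces $H^\varphi_A$ with $\varphi\in\mathrm{OR}$ are regarded as linear manifolds in the single space $H^{\chi}_A$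 with $\chi(t):=e^{-t}$. Interpolation space: let $H_0,H_1$ be Hilbert spaces, $H_1$ being a linear manifold in $H_0$ with continuous embedding $H_1\hookrightarrow H_0$. A Hilbert space $X$ is an interpolation space for the pair $[H_0,H_1]$ if (i) $X$ is a linear manifold in $H_0$ and the embeddings $H_1\hookrightarrow X\hookrightarrow H_0$ are continuous; (ii) for every linear operator $T$ on $H_0$, if the restriction of $T$ to $H_j$ is a bounded operator on $H_j$ for each $j\in\{0,1\}$, then the restriction of $T$ to $X$ is a bounded operator on $X$. Extended $A$-scale: the class of all Hilbert spaces each of which is an interpolation space for some pair $[H^{s_0}_A,H^{s_1}_A]$ with real $s_0<s_1$ (the numbers $s_0,s_1$ may depend on the space). *)

(* Defs.v *)
From HB Require Import structures.
From mathcomp Require Import all_boot all_order all_algebra complex.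
From mathcomp Require Import all_classical all_reals all_analysis.

Set Implicit Arguments.
Unset Strict Implicit.
Unset Printing Implicit Defensive.

Import Order.TTheory GRing.Theory Num.Theory.
Import numFieldNormedType.Exports.

Local Open Scope classical_set_scope.
Local Open Scope ring_scope.
Local Open Scope complex_scope.

(* [{dot H for conjC}] is linear in its first argument and positive definite. *)
HB.mixin Record NormedModule_isHilbert (R : realType) (H : Type)
    of CompleteNormedModule R[i] H := {
  hdot : {dot H for (@Num.conj R[i])} ;
  hdot_norm : forall u : H, hdot u u = `|u| ^+ 2
}.

#[short(type="hilbertType")]
HB.structure Definition Hilbert (R : realType) :=
  { H of NormedModule_isHilbert R H & CompleteNormedModule R[i] H }.

Definition separable_space (T : topologicalType) : Prop :=
  exists2 D : set T, countable D & dense D.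

Definition finite_dimensional (K : pzRingType) (V : lmodType K) : Prop :=
  exists (n : nat) (b : 'I_n -> V), forall v : V,
    exists c : 'I_n -> K, v = \sum_(i < n) c i *: b i.

Definition linear_manifold (K : pzRingType) (V : lmodType K) (D : set V) : Prop :=
  D 0 /\ forall (a : K) (u v : V), D u -> D v -> D (a *: u + v).

Definition linear_on (K : pzRingType) (V W : lmodType K) (D : set V)
    (f : V -> W) : Prop :=
  linear_manifold D /\
  forall (a : K) (u v : V), D u -> D v -> f (a *: u + v) = a *: f u + f v.

(* An operator in [H] with domain [dom]; values of [op] off [dom] are irrelevant. *)
Record operator (R : realType) (H : hilbertType R) := Operator {
  dom : set H ;
  op :> H -> H
}.

Definition linear_operator (R : realType) (H : hilbertType R)
    (A : operator H) : Prop := linear_on (dom A) A.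

(* The second clause says that the graphs of [A^*] and [A] coincide. *)
Definition self_adjoint (R : realType) (H : hilbertType R)
    (A : operator H) : Prop :=
  dense (dom A) /\
  forall v w : H,
    (forall u : H, dom A u -> hdot (A u) v = hdot u w) <-> (dom A v /\ A v = w).

Definition bounded_operator (R : realType) (H : hilbertType R)
    (A : operator H) : Prop :=
  exists c : R[i], forall u : H, dom A u -> `|A u| <= c * `|u|.

(* Projection-valued measures on the Borel sets of the real line. *)
Definition is_pvm (R : realType) (H : hilbertType R)
    (E : set R -> H -> H) : Prop :=
  [/\ (forall B : set R, measurable B -> linear (E B)),
      (forall (B : set R) (u v : H), measurable B ->
         hdot (E B u) v = hdot u (E B v)),
      (forall (B C : set R) (u : H), measurable B -> measurable C ->
         E (B `&` C) u = E B (E C u)),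
      (forall u : H, E setT u = u) &
      (forall (F : (set R) ^nat) (u : H),
         (forall n : nat, measurable (F n)) -> trivIset setT F ->
         (fun n : nat => \sum_(i < n) E (F i) u) @ \oo
           --> E (\bigcup_n F n) u)].

Definition pvm_measure (R : realType) (H : hilbertType R)
    (E : set R -> H -> H) (u : H) (B : set R) : \bar R :=
  (complex.Re (hdot (E B u) u))%:E.

(* The integral of [f] against the complex measure [B |-> (E B u, v)], which
   polarization writes through the finite measures [pvm_measure E w]. *)
Definition pvm_form (R : realType) (H : hilbertType R)
    (E : set R -> H -> H) (f : R -> R) (u v : H) : R[i] :=
  4%:R^-1 * \sum_(k < 4) 'i ^+ k *
    (fine (\int[pvm_measure E (u + 'i ^+ k *: v)%R]_t (f t)%:E)%E)%:C.

(* The operator "integral of [f] dE": it sends [u] to the only [w] such that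
   [(w, v)] is the integral of [f] d(Eu, v) for all [v] in the dense domain. *)
Definition pvm_integral (R : realType) (H : hilbertType R)
    (E : set R -> H -> H) (f : R -> R) : operator H :=
  let D := [set u : H | (\int[pvm_measure E u]_t ((f t) ^+ 2)%:E < +oo)%E] in
  Operator D (fun u => xget 0
    [set w : H | forall v : H, D v -> hdot w v = pvm_form E f u v]).

Definition is_spectral_measure (R : realType) (H : hilbertType R)
    (A : operator H) (E : set R -> H -> H) : Prop :=
  [/\ is_pvm E,
      dom A = dom (pvm_integral E id) &
      (forall u : H, dom A u -> A u = pvm_integral E id u)].

(* For self-adjoint [A] the choice is legitimate by the spectral theorem, and
   the values on Borel sets do not depend on it. *)
Definition spectral_measure (R : realType) (H : hilbertType R)
    (A : operator H) : set R -> H -> H :=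
  xget (fun _ _ => 0) [set E | is_spectral_measure A E].

(* [phi(A)] when Spec A lies in [1, +oo[: only the values of [phi] there
   matter, and [phi] is replaced by 0 elsewhere. *)
Definition op_fun (R : realType) (H : hilbertType R)
    (A : operator H) (phi : R -> R) : operator H :=
  pvm_integral (spectral_measure A) (phi \_ `[1, +oo[).

(* [Y], with [k : Dom T -> Y], is a completion of [Dom T] in [u |-> |T u|]. *)
Definition is_completion (R : realType) (H Y : hilbertType R)
    (T : operator H) (k : H -> Y) : Prop :=
  [/\ linear_on (dom T) k,
      (forall u : H, dom T u -> `|k u| = `|T u|) &
      dense (k @` dom T)].

(* A Hilbert space that is a linear manifold in [V]. *)
Record hilbert_manifold (R : realType) (V : lmodType R[i]) := HilbertManifold {
  hspace :> hilbertType R ;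
  incl : {linear hspace -> V} ;
  incl_inj : injective incl
}.

Definition continuously_embedded (R : realType) (V : lmodType R[i])
    (X Y : hilbert_manifold V) : Prop :=
  exists c : R[i], forall x : X,
    exists2 y : Y, incl Y y = incl X x & `|y| <= c * `|x|.

Definition equal_up_to_norms (R : realType) (V : lmodType R[i])
    (X Y : hilbert_manifold V) : Prop :=
  continuously_embedded X Y /\ continuously_embedded Y X.

(* The restriction of [T] to [X] is a bounded operator on [X], where [X] is
   a linear manifold in [H0]. *)
Definition restricts_bounded (R : realType) (V : lmodType R[i])
    (H0 : hilbert_manifold V) (T : H0 -> H0) (X : hilbert_manifold V) : Prop :=
  exists c : R[i], forall (x : X) (h : H0), incl H0 h = incl X x ->
    exists2 x' : X, incl X x' = incl H0 (T h) & `|x'| <= c * `|x|.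

Definition interpolation_space (R : realType) (V : lmodType R[i])
    (H0 H1 X : hilbert_manifold V) : Prop :=
  [/\ continuously_embedded H1 X,
      continuously_embedded X H0 &
      forall T : {linear H0 -> H0},
        restricts_bounded T H0 -> restricts_bounded T H1 ->
        restricts_bounded T X].

Definition class_OR (R : realType) (phi : R -> R) : Prop :=
  [/\ measurable_fun [set` `[(1 : R), +oo[] phi,
      (forall t : R, 1 <= t -> 0 < phi t) &
      exists a c : R, [/\ 1 < a, 1 <= c &
        forall t lam : R, 1 <= t -> 1 <= lam -> lam <= a ->
          c^-1 <= phi (lam * t) / phi t /\ phi (lam * t) / phi t <= c]].

Definition chi (R : realType) (t : R) : R := expR (- t).

(* [Y] is the space H^phi_A as a linear manifold in [K], where [K], with
   [j : H -> K], is H^chi_A: [Y] is the completion of [Dom phi(A)], embedded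
   in [K] by the continuous extension of the identity of [Dom phi(A)]. *)
Definition is_Hphi_space (R : realType) (H K : hilbertType R)
    (A : operator H) (j : H -> K) (phi : R -> R)
    (Y : hilbert_manifold K) : Prop :=
  continuous (incl Y) /\
  exists2 k : H -> Y, is_completion (op_fun A phi) k &
    forall u : H, dom (op_fun A phi) u -> incl Y (k u) = j u.

Definition extended_scale (R : realType) (H K : hilbertType R)
    (A : operator H) (j : H -> K) (X : hilbert_manifold K) : Prop :=
  exists s0 s1 : R, s0 < s1 /\
  exists H0 H1 : hilbert_manifold K,
    [/\ is_Hphi_space A j (fun t => t `^ s0) H0,
        is_Hphi_space A j (fun t => t `^ s1) H1 &
        interpolation_space H0 H1 X].

(* Main.v *)
From HB Require Import structures.
Require Import Defs.
From mathcomp Require Import all_boot all_order all_algebra complex.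
From mathcomp Require Import all_classical all_reals all_analysis.
From mathcomp Require Import measurable_realfun ring lra zify.
Set Implicit Arguments.
Unset Strict Implicit.
Unset Printing Implicit Defensive.
Import Order.TTheory GRing.Theory Num.Theory.
Import numFieldNormedType.Exports.
Import Defs.
Local Open Scope classical_set_scope.
Local Open Scope ring_scope.
Local Open Scope complex_scope.

(* Only four properties of the spectral measure [E] of [A] are used: each [E B]
   is linear and symmetric, [E (B `&` C) = E B \o E C], and [E] is strongly
   countably additive.  The zero family has them too, so no spectral theorem is
   needed to know that the chosen [E] has them.

   Put [P n = E [2^n, 2^(n+1)[].  A function of the class OR is, up to a constant
   factor, constant on dyadic intervals, so [H^phi_A] is the space of all [x] in
   [H^chi_A] whose components [x_n] in [P n H] satisfy [sum_n (w n |x_n|)^2 < oo],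
   where [w n = phi (2^n)] is a weight with bounded quotients [w (n+1) / w n].

   If [phi] is in OR, take [s0] very negative and [s1] very positive: the blocks
   of an operator bounded on [H^s0] and [H^s1] then decay like [2^-|m - n|]
   relative to [w], and Schur's test applies.

   Conversely let [X] be an interpolation space.  The projections onto sets of
   blocks act on [X], uniformly boundedly by a Baire category argument.  Averaging
   over signs in the Hilbert space [X] gives [|x|_X^2 ~ sum_n |x_n|_X^2], and
   operators of rank one on blocks show that on [P n H] the norm of [X] is
   comparable to [w n] times the norm of [H] for a weight [w] with bounded
   quotients, which is turned into a step function in OR. *)

(** * Real-valued norm and inner product *)

(** The interpolation property is purely qualitative: it bounds each operator on [X], with a
    constant that depends on the operator. Every uniform estimate on [X] has to be extracted from
    that. For projections this is what the Baire argument does; to compare block norms, all rank-one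
    maps are packed into a single operator, with geometric factors that keep it bounded at both
    endpoints.

    The spectrum may have gaps and a block may be zero, so the weight cannot simply be read off from
    a unit vector of block [n]; it has to draw on all blocks at once.

    [phi(A)] is defined weakly, through integrals against polarized measures, and its values are
    picked by [xget]. For a nonnegative function, an expansion into countably many indicators turns
    it into a strong limit of finite positive combinations of spectral projections; its domain, norm
    and quadratic form then follow from monotone convergence.

    [H^chi_A] is an arbitrary completion [K], known only through [j]. Its elements become tangible
    through block coordinates [p n : K -> H], the bounded extensions of [P n]; inclusions between
    spaces are checked on these coordinates. *)

Section Norm.
Variables (R : realType) (V : normedModType R[i]).
Implicit Types (u v : V) (a : R[i]).

(* Norms are complex numbers here; [nr] and [cabs] are their real counterparts. *)
Definition nr u : R := complex.Re `|u|.

Lemma nrE u : `|u| = (nr u)%:C.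
Proof. by rewrite /nr RRe_real // ger0_real. Qed.

Lemma nr_ge0 u : 0 <= nr u.
Proof. by rewrite -ler0c -nrE. Qed.

Lemma nr0 : nr (0 : V) = 0.
Proof. by apply: complexI; rewrite -nrE normr0. Qed.

Lemma nr_eq0 u : nr u = 0 -> u = 0.
Proof. by move=> h; apply: normr0_eq0; rewrite nrE h. Qed.

Lemma nrN u : nr (- u) = nr u.
Proof. by rewrite /nr normrN. Qed.

Lemma nrBC u v : nr (u - v) = nr (v - u).
Proof. by rewrite -nrN opprB. Qed.

Lemma nrD u v : nr (u + v) <= nr u + nr v.
Proof. rewrite -lecR rmorphD /= -!nrE. by rewrite ler_normD. Qed.

Lemma nrB u v : nr (u - v) <= nr u + nr v.
Proof. by rewrite -(nrN v) nrD. Qed.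

Lemma nrDB u v w : nr (u - w) <= nr (u - v) + nr (v - w).
Proof. by apply: le_trans (nrD _ _); rewrite addrA subrK. Qed.

Lemma nr_tri u v : nr u <= nr v + nr (u - v).
Proof. by apply: le_trans (nrD _ _); rewrite addrC subrK. Qed.

Definition cabs a : R := complex.Re `|a|.

Lemma cabsE a : `|a| = (cabs a)%:C.
Proof. by rewrite /cabs RRe_real // ger0_real. Qed.

Lemma cabs_ge0 a : 0 <= cabs a.
Proof. by rewrite -ler0c -cabsE. Qed.

Lemma cabsM a b : cabs (a * b) = cabs a * cabs b.
Proof. by apply: complexI; rewrite rmorphM /= -!cabsE normrM. Qed.

Lemma cabsr (x : R) : cabs x%:C = `|x|.
Proof. by apply: complexI; rewrite -cabsE normc_def /= expr0n /= addr0 sqrtr_sqr. Qed.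

Lemma nrZ a u : nr (a *: u) = cabs a * nr u.
Proof. by apply: complexI; rewrite rmorphM /= -nrE -cabsE -nrE normrZ. Qed.

Lemma nrZr (x : R) u : nr (x%:C *: u) = `|x| * nr u.
Proof. by rewrite nrZ cabsr. Qed.

End Norm.

Lemma ext_bound (R : realType) (V W : normedModType R[i]) (c : R[i]) (x : V) (y : W) :
  `|y| <= c * `|x| -> nr y <= cabs c * nr x.
Proof.
move=> h; rewrite -lecR rmorphM /= -!nrE -cabsE.
have h0 : 0 <= c * `|x| by apply: le_trans h.
by rewrite (le_trans h)// -(ger0_norm h0) normrM normr_id.
Qed.

Lemma bound_ext (R : realType) (V W : normedModType R[i]) (c : R) (x : V) (y : W) :
  nr y <= c * nr x -> `|y| <= c%:C * `|x|.
Proof. by rewrite -lecR rmorphM /= -!nrE. Qed.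

Section Ip.
Variables (R : realType) (H : hilbertType R).
Implicit Types (u v w : H) (a : R[i]).

Lemma rcM (x y : R) : (x * y)%:C = x%:C * y%:C.
Proof. exact: rmorphM. Qed.
Lemma rcD (x y : R) : (x + y)%:C = x%:C + y%:C.
Proof. exact: rmorphD. Qed.
Lemma rcB (x y : R) : (x - y)%:C = x%:C - y%:C.
Proof. exact: rmorphB. Qed.
Lemma rcX (x : R) n : (x ^+ n)%:C = x%:C ^+ n.
Proof. exact: rmorphXn. Qed.

Definition ip u v : R[i] := hdot u v.

Lemma ipDl u v w : ip (u + v) w = ip u w + ip v w.
Proof. exact: linearDl. Qed.
Lemma ipZl a u v : ip (a *: u) v = a * ip u v.
Proof. exact: linearZl_LR. Qed.
Lemma ipC u v : ip u v = ((ip v u)^*)%C.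
Proof. by rewrite /ip hermC expr0 mul1r. Qed.
Lemma ipuu u : ip u u = (nr u ^+ 2)%:C.
Proof. by rewrite /ip hdot_norm nrE rmorphXn. Qed.
Lemma ipDr u v w : ip u (v + w) = ip u v + ip u w.
Proof. by rewrite ipC ipDl rmorphD /= -!ipC. Qed.
Lemma ipZr a u v : ip u (a *: v) = (a^*)%C * ip u v.
Proof. by rewrite ipC ipZl rmorphM /= -!ipC. Qed.
Lemma ip0l u : ip 0 u = 0.
Proof. by rewrite -(scale0r 0) ipZl mul0r. Qed.
Lemma ip0r u : ip u 0 = 0.
Proof. by rewrite ipC ip0l conjc0. Qed.
Lemma ipNl u v : ip (- u) v = - ip u v.
Proof. by rewrite -scaleN1r ipZl mulN1r. Qed.
Lemma ipNr u v : ip u (- v) = - ip u v.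
Proof. by rewrite ipC ipNl rmorphN /= -ipC. Qed.
Lemma ipBl u v w : ip (u - v) w = ip u w - ip v w.
Proof. by rewrite ipDl ipNl. Qed.
Lemma ipBr u v w : ip u (v - w) = ip u v - ip u w.
Proof. by rewrite ipDr ipNr. Qed.
Lemma ip_suml (I : Type) (r : seq I) (P : pred I) (F : I -> H) v :
  ip (\sum_(i <- r | P i) F i) v = \sum_(i <- r | P i) ip (F i) v.
Proof. by apply: (big_morph (fun x => ip x v)) => [x y|]; rewrite ?ipDl ?ip0l. Qed.
Lemma ip_sumr (I : Type) (r : seq I) (P : pred I) (F : I -> H) v :
  ip v (\sum_(i <- r | P i) F i) = \sum_(i <- r | P i) ip v (F i).
Proof. by apply: (big_morph (fun x => ip v x)) => [x y|]; rewrite ?ipDr ?ip0r. Qed.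

Definition rip u v : R := complex.Re (ip u v).

Lemma ReD (x y : R[i]) : complex.Re (x + y) = complex.Re x + complex.Re y.
Proof. by case: x; case: y. Qed.
Lemma ReN (x : R[i]) : complex.Re (- x) = - complex.Re x.
Proof. by case: x. Qed.
Lemma ReC (x : R[i]) : complex.Re (x^*)%C = complex.Re x.
Proof. by case: x. Qed.
Lemma ReMr (r : R) (x : R[i]) : complex.Re (r%:C * x) = r * complex.Re x.
Proof. by case: x => p q /=; rewrite mul0r subr0. Qed.

Lemma rip_uu u : rip u u = nr u ^+ 2.
Proof. by rewrite /rip ipuu. Qed.
Lemma ripC u v : rip u v = rip v u.
Proof. by rewrite /rip ipC ReC. Qed.
Lemma ripDl u v w : rip (u + v) w = rip u w + rip v w.
Proof. by rewrite /rip ipDl ReD. Qed.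
Lemma ripDr u v w : rip u (v + w) = rip u v + rip u w.
Proof. by rewrite /rip ipDr ReD. Qed.
Lemma ripNl u v : rip (- u) v = - rip u v.
Proof. by rewrite /rip ipNl ReN. Qed.
Lemma ripNr u v : rip u (- v) = - rip u v.
Proof. by rewrite /rip ipNr ReN. Qed.
Lemma ripZl (r : R) u v : rip (r%:C *: u) v = r * rip u v.
Proof. by rewrite /rip ipZl ReMr. Qed.
Lemma ripZr (r : R) u v : rip u (r%:C *: v) = r * rip u v.
Proof. by rewrite ripC ripZl ripC. Qed.

Lemma nrD2 u v : nr (u + v) ^+ 2 = nr u ^+ 2 + 2 * rip u v + nr v ^+ 2.
Proof. rewrite -!rip_uu ripDl !ripDr (ripC v u); ring. Qed.
Lemma nrB2 u v : nr (u - v) ^+ 2 = nr u ^+ 2 - 2 * rip u v + nr v ^+ 2.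
Proof. rewrite nrD2 ripNr nrN; ring. Qed.
Lemma parallelogram u v :
  nr (u + v) ^+ 2 + nr (u - v) ^+ 2 = 2 * nr u ^+ 2 + 2 * nr v ^+ 2.
Proof. rewrite nrD2 nrB2; ring. Qed.
Lemma pythagoras u v : ip u v = 0 -> nr (u + v) ^+ 2 = nr u ^+ 2 + nr v ^+ 2.
Proof. by move=> h; rewrite nrD2 /rip h mulr0 addr0. Qed.

Lemma cauchy_schwarz u v : cabs (ip u v) <= nr u * nr v.
Proof.
have [v0|v0] := eqVneq (nr v) 0.
  by rewrite v0 mulr0 (nr_eq0 v0) ip0r /cabs normr0.
have vp : 0 < nr v by rewrite lt_def v0 nr_ge0.
set a := ip u v.
have h := nr_ge0 ((nr v ^+ 2)%:C *: u - a *: v).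
(* The vector is [|v|^2] times the component of [u] orthogonal to [v]. *)
have e : (nr ((nr v ^+ 2)%:C *: u - a *: v)) ^+ 2 =
   nr v ^+ 2 * ((nr u * nr v) ^+ 2 - cabs a ^+ 2).
  apply: complexI; rewrite -(ipuu (_ - _)) ipBl !ipBr !ipZl !ipZr !ipuu conjc_real.
  have aa : a * (a^*)%C = (cabs a ^+ 2)%:C by rewrite rcX -cabsE sqr_normc.
  rewrite [ip v u]ipC -/a [X in _ = X]rcM rcB -aa !rcX rcM; ring.
rewrite -(@ler_pXn2r _ 2) ?nnegrE ?cabs_ge0 ?mulr_ge0 ?nr_ge0//.
by have := sqr_ge0 (nr ((nr v ^+ 2)%:C *: u - a *: v)); rewrite e pmulr_rge0 ?exprn_gt0// subr_ge0.
Qed.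

Lemma Re_le_cabs (x : R[i]) : `|complex.Re x| <= cabs x.
Proof. by rewrite -lecR -cabsE normc_ge_Re. Qed.

Lemma rip_le u v : rip u v <= nr u * nr v.
Proof. by rewrite (le_trans (ler_norm _))// (le_trans (Re_le_cabs _))// cauchy_schwarz. Qed.

End Ip.

(** * Convergence of sequences *)

Section Conv.
Variables (R : realType).

(** Convergence with a real [e]: the filter form over [R[i]] quantifies over complex radii, which
    are awkward for real estimates. *)
Definition cv (V : normedModType R[i]) (u : nat -> V) (l : V) :=
  forall e : R, 0 < e -> exists N : nat, forall n, (N <= n)%N -> nr (u n - l) < e.

Lemma cv_cvg (V : normedModType R[i]) (u : nat -> V) l : u @ \oo --> l -> cv u l.
Proof.
move=> /cvgrPdist_lt h e e0.
have ec : 0 < e%:C by rewrite ltcR.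
have [N _ hN] := h _ ec.
by exists N => n Nn; have := hN n Nn; rewrite /= nrE ltcR nrBC.
Qed.

Lemma pos_complex (e : R[i]) : 0 < e -> exists2 r : R, 0 < r & e = r%:C.
Proof.
move=> e0; exists (complex.Re e); last by rewrite RRe_real// gtr0_real.
by rewrite -ltcR RRe_real// gtr0_real.
Qed.

Lemma cvg_cv (V : normedModType R[i]) (u : nat -> V) l : cv u l -> u @ \oo --> l.
Proof.
move=> h; apply/cvgrPdist_lt => e /pos_complex[r r0 ->].
have [N hN] := h _ r0.
by exists N => // n /= Nn; rewrite nrE ltcR nrBC hN.
Qed.

Lemma cv_complete (V : completeNormedModType R[i]) (u : nat -> V) :
  (forall e : R, 0 < e -> exists N : nat, forall m n, (N <= m)%N -> (m <= n)%N ->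
    nr (u n - u m) < e) -> exists l, cv u l.
Proof.
move=> h; suff /cauchy_cvgP c : cauchy (u @ \oo).
  by exists (lim (u @ \oo)); apply: cv_cvg.
apply/cauchyP => e /pos_complex[r r0 ->].
have [N hN] := h _ r0; exists (u N).
rewrite /= near_simpl.
exists N => // n /= Nn; rewrite -ball_normE /= nrE ltcR nrBC.
by apply: hN.
Qed.

Section One.
Variable V : normedModType R[i].
Implicit Types (u v : nat -> V) (l m : V).

Lemma cv_unique u l m : cv u l -> cv u m -> l = m.
Proof.
move=> hl hm; apply/subr0_eq/nr_eq0/eqP; rewrite eq_le nr_ge0 andbT.
apply/ler_addgt0Pr => e e0; rewrite add0r.
have e2 : 0 < e / 2 by rewrite divr_gt0.
have [N hN] := hl _ e2; have [M hM] := hm _ e2.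
have := hN _ (leq_maxl N M); have := hM _ (leq_maxr N M).
have := nrDB l (u (maxn N M)) m; rewrite (nrBC l (u _)); lra.
Qed.

Lemma cv_cst l : cv (fun=> l) l.
Proof. by move=> e e0; exists 0%N => n _; rewrite subrr nr0. Qed.

Lemma cv_ext u v l : (forall n, u n = v n) -> cv u l -> cv v l.
Proof. by move=> /funext ->. Qed.

Lemma cvD u v l m : cv u l -> cv v m -> cv (fun n => u n + v n) (l + m).
Proof. by move=> /cvg_cv hu /cvg_cv hv; apply: cv_cvg; apply: cvgD. Qed.

Lemma cvN u l : cv u l -> cv (fun n => - u n) (- l).
Proof. by move=> /cvg_cv hu; apply: cv_cvg; apply: cvgN. Qed.

Lemma cvB u v l m : cv u l -> cv v m -> cv (fun n => u n - v n) (l - m).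
Proof. by move=> hu hv; apply: cvD => //; apply: cvN. Qed.

End One.

Lemma cv_lip (V W : normedModType R[i]) (u : nat -> V) l (v : nat -> W) m (c : R) :
  (forall n, nr (v n - m) <= c * nr (u n - l)) -> cv u l -> cv v m.
Proof.
move=> h hu e e0.
have a1 : 0 < `|c| + 1 by have := normr_ge0 c; lra.
have [N hN] := hu _ (divr_gt0 e0 a1); exists N => n /hN.
rewrite ltr_pdivlMr//; have := h n; have := ler_norm c; have := nr_ge0 (u n - l).
have := normr_ge0 c; nra.
Qed.

Lemma cvZ (V : normedModType R[i]) (u : nat -> V) (l : V) (a : R[i]) :
  cv u l -> cv (fun n => a *: u n) (a *: l).
Proof. by apply: (@cv_lip _ _ _ _ _ _ (cabs a)) => n; rewrite -scalerBr nrZ. Qed.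

Lemma cv_nr_le (V : normedModType R[i]) (u : nat -> V) l (c : R) N0 :
  (forall n, (N0 <= n)%N -> nr (u n) <= c) -> cv u l -> nr l <= c.
Proof.
move=> h hu; apply/ler_addgt0Pr => e e0.
have [N hN] := hu _ e0.
have := hN _ (leq_maxr N0 N); have := h _ (leq_maxl N0 N).
have := nr_tri l (u (maxn N0 N)); rewrite (nrBC l (u _)); lra.
Qed.

Lemma cv_shift (V : normedModType R[i]) (u : nat -> V) l (s : nat -> nat) :
  (forall n, (n <= s n)%N) -> cv u l -> cv (u \o s) l.
Proof.
move=> hs h e e0; have [N hN] := h _ e0; exists N => n Nn.
by apply: hN; apply: leq_trans (hs n).
Qed.

Lemma dense_cv (V : normedModType R[i]) (D : set V) (x : V) : dense D ->
  exists u : nat -> V, (forall n, D (u n)) /\ cv u x.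
Proof.
move=> hD.
have h n : exists y, D y /\ nr (y - x) < n.+1%:R^-1.
  have n0 : 0 < (n.+1%:R^-1 : R)%:C by rewrite ltcR invr_gt0 ltr0n.
  have [y [yb Dy]] := hD (ball x (n.+1%:R^-1 : R)%:C)
     (ex_intro _ x (ballxx x n0)) (ball_open x _).
  exists y; split=> //; move: yb; rewrite -ball_normE /= nrE ltcR nrBC//.
have [u hu] := choice h; exists u; split=> [n|]; first by have [] := hu n.
move=> e e0; have [N _ hN] := near_infty_natSinv_lt (PosNum e0).
by exists N => n Nn; apply: lt_trans (hN n Nn); have [] := hu n.
Qed.
End Conv.

(** * Completeness and density in Hilbert spaces *)

Section RealSeq.
Variable R : realType.
Implicit Types (a : nat -> R).

Lemma sup_near (S : set R) (M e : R) : S !=set0 -> (forall x, S x -> x <= M) -> 0 < e ->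
  exists2 x, S x & forall y, S y -> y < x + e.
Proof.
move=> S0 SM e0.
have hs : has_sup S by split=> //; exists M.
have [x Sx hx] := sup_adherent e0 hs.
by exists x => // y Sy; have := ub_le_sup (proj2 hs) Sy; lra.
Qed.

Lemma mono_cauchy a (M e : R) : (forall m n, (m <= n)%N -> a m <= a n) ->
  (forall n, a n <= M) -> 0 < e ->
  exists N : nat, forall m n, (N <= m)%N -> (m <= n)%N -> a n - a m < e.
Proof.
move=> mono bd e0.
have ne : range a !=set0 by exists (a 0%N); exists 0%N.
have ub x : range a x -> x <= M by move=> [y _ <-].
have [x [N _ <-] hN] := sup_near ne ub e0.
exists N => m n Nm mn; have := hN _ (ex_intro2 _ _ n I erefl); have := mono _ _ Nm; lra.
Qed.

Lemma invS_lt (e : R) : 0 < e -> exists N : nat, forall n, (N <= n)%N -> n.+1%:R^-1 < e.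
Proof.
move=> e0; have [N _ hN] := near_infty_natSinv_lt (PosNum e0).
by exists N => n Nn; exact: hN.
Qed.

End RealSeq.

(** * Continuous extension of densely defined linear maps *)

Section Extension.
Variables (R : realType) (U : lmodType R[i]) (Y : normedModType R[i])
  (Z : completeNormedModType R[i]).
Variables (D : set U) (k : U -> Y) (f : U -> Z) (C : R).
Hypotheses (klin : linear_on D k) (flin : linear_on D f) (kd : dense (k @` D))
  (fk : forall u, D u -> nr (f u) <= C * nr (k u)).

Lemma linear_onB (W : lmodType R[i]) (g : U -> W) u v : linear_on D g -> D u -> D v ->
  D (u - v) /\ g (u - v) = g u - g v.
Proof.
move=> [[D0 DD] hg] Du Dv.
have -> : u - v = (-1) *: v + u by rewrite scaleN1r addrC.
by split; [exact: DD|rewrite hg// scaleN1r addrC].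
Qed.

(** The closure of the relation between [k u] and [f u]. A relation avoids choosing preimages under
    [k], which is not assumed injective. *)
Let G y z := exists u : nat -> U,
  [/\ forall n, D (u n), cv (k \o u) y & cv (f \o u) z].

Let G_total y : exists z, G y z.
Proof.
have [x [hx xy]] := dense_cv y kd.
have /choice[u hu] : forall n, exists u, D u /\ k u = x n.
  by move=> n; have [u Du <-] := hx n; exists u.
have ux n : k (u n) = x n by have [] := hu n.
have Du n : D (u n) by have [] := hu n.
suff [z hz] : exists z, cv (f \o u) z.
  by exists z, u; split=> //; apply: cv_ext xy => n /=.
apply: cv_complete => e e0.
(* No sign of [C] is assumed, so [|C| + 1] serves as a positive bound. *)
have C1 : 0 < `|C| + 1 by have := normr_ge0 C; lra.
have [N hN] := xy _ (divr_gt0 (divr_gt0 e0 C1) (ltr0n R 2)).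
exists N => m n Nm mn /=.
have [Dd <-] := linear_onB flin (Du n) (Du m).
have := hN _ Nm; have := hN _ (leq_trans Nm mn).
have [_ e1] := linear_onB klin (Du n) (Du m).
have := fk Dd; rewrite e1 !ux.
have := nrDB (x n) y (x m); rewrite (nrBC y (x m)).
have := ler_norm C; have := nr_ge0 (x n - x m); have := normr_ge0 C.
set q := e / _ / _ => *.
have eq : e = q * 2 * (`|C| + 1) by rewrite /q; field; lra.
rewrite eq; nra.
Qed.

Let G_bound y z : G y z -> nr z <= C * nr y.
Proof.
move=> [u [Du hk hf]].
apply/ler_addgt0Pr => e e0.
have C1 : 0 < `|C| + 1 by have := normr_ge0 C; lra.
have [N hN] := hk _ (divr_gt0 (divr_gt0 e0 C1) (ltr0n R 2)).
have [M hM] := hf _ (divr_gt0 e0 (ltr0n R 2)).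
set n := maxn N M.
have := hN n (leq_maxl _ _); have := hM n (leq_maxr _ _).
have := fk (Du n).
rewrite /=.
have := nr_tri z (f (u n)); rewrite (nrBC z).
have := nr_tri (k (u n)) y; have := nr_tri y (k (u n)); rewrite (nrBC y).
have := ler_norm C; have := ler_norm (- C); rewrite normrN; have := nr_ge0 (k (u n) - y); have := normr_ge0 C.
set q := e / (_ + _) / _ => *.
have eq : e = q * 2 * (`|C| + 1) by rewrite /q; field; lra.
have e2 : e / 2 = q * (`|C| + 1) by rewrite eq; field.
have : C * nr (k (u n)) <= C * nr y + `|C| * q.
  have [C0|C0] := lerP 0 C; nra.
nra.
Qed.

Let G_lin a y z y' z' : G y z -> G y' z' -> G (a *: y + y') (a *: z + z').
Proof.
move=> [u [Du hk hf]] [v [Dv hk' hf']].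
exists (fun n => a *: u n + v n); split=> [n||].
- by have [[_ h] _] := klin; apply: h.
- apply: cv_ext (cvD (cvZ a hk) hk') => n /=.
  by have [_ ->] := klin.
- apply: cv_ext (cvD (cvZ a hf) hf') => n /=.
  by have [_ ->] := flin.
Qed.



(** [G] is a linear relation that obeys the bound of [f]. Two values at one point differ by a value
    at 0, which the bound forces to be 0, so [G] is the graph of a linear map. *)
Lemma extension : exists F : {linear Y -> Z},
  (forall u, D u -> F (k u) = f u) /\ forall y, nr (F y) <= C * nr y.
Proof.
have G_fun y z z' : G y z -> G y z' -> z = z'.
  move=> h h'; have /G_bound := @G_lin (-1) _ _ _ _ h h'.
  rewrite !scaleN1r addNr nr0 mulr0 => hh.
  apply/esym/subr0_eq/nr_eq0/eqP; rewrite eq_le nr_ge0 andbT.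
  by rewrite addrC.
have [F hF] := choice G_total.
have Fl : linear F by move=> a y y'; apply: G_fun (hF _) (G_lin _ (hF _) (hF _)).
pose FL : {linear Y -> Z} := HB.pack F (GRing.isLinear.Build _ _ _ _ F Fl).
exists FL; split=> [u Du|y]; last exact: G_bound.
apply: G_fun (hF _) _; exists (fun=> u); split=> //; exact: cv_cst.
Qed.
End Extension.

Section Hilb.
Variables (R : realType) (H : hilbertType R).

(* Vectors of almost minimal norm in a decreasing sequence of convex sets form
   a Cauchy sequence, by the parallelogram law. *)
Lemma min_norm_cauchy (C : nat -> set H) (M : R) :
  (forall n, C n !=set0) -> (forall m n, (m <= n)%N -> C n `<=` C m) ->
  (forall n x, C n x -> nr x <= M) ->
  (forall n x y, C n x -> C n y -> C n ((2^-1 : R)%:C *: (x + y))) ->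
  exists (p : nat -> H) (l : H), (forall n, C n (p n)) /\ cv p l.
Proof.
move=> C0 Cdec CM Cmid.
have [eps [eps0 eps_mono eps_lt]] : exists eps : nat -> R, [/\ forall n, 0 < eps n,
    forall m n, (m <= n)%N -> eps n <= eps m &
    forall e, 0 < e -> exists N : nat, forall n, (N <= n)%N -> eps n < e].
  exists (fun n => n.+1%:R^-1); split=> [n|m n mn|e e0]; last exact: invS_lt.
    by rewrite invr_gt0.
  by rewrite lef_pV2 ?posrE ?ltr0Sn// ler_nat ltnS.
pose S n := [set x : R | exists2 y, C n y & x = - nr y ^+ 2].
have S0 n : S n !=set0 by have [y Cy] := C0 n; exists (- nr y ^+ 2); exists y.
have Sb n x : S n x -> x <= 0 by move=> [y _ ->]; rewrite oppr_le0 sqr_ge0.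
have hp n : exists y, C n y /\ forall z, C n z -> nr y ^+ 2 < nr z ^+ 2 + eps n.
  have [x [y Cy ->] h] := @sup_near _ (S n) 0 (eps n) (S0 n) (@Sb n)
     (eps0 n).
  exists y; split=> // z Cz; have := h (- nr z ^+ 2) (ex_intro2 _ _ z Cz erefl). lra.
have [p hpp] := choice hp.
have pC n : C n (p n) by have [] := hpp n.
have pm n z : C n z -> nr (p n) ^+ 2 < nr z ^+ 2 + eps n by have [_] := hpp n; apply.
pose a n := inf [set x : R | exists2 y, C n y & x = nr y ^+ 2].
have ainf n : has_inf [set x : R | exists2 y, C n y & x = nr y ^+ 2].
  split; first by have [y Cy] := C0 n; exists (nr y ^+ 2); exists y.
  by exists 0 => _ [y _ ->]; exact: sqr_ge0.
have a_le n z : C n z -> a n <= nr z ^+ 2.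
  by move=> Cz; apply: (ge_inf (proj2 (ainf n))); exists z.
have p_le n : nr (p n) ^+ 2 <= a n + eps n.
  rewrite -lerBlDr; apply: (lb_le_inf (proj1 (ainf _))) => _ [y Cy ->].
  by have := pm _ _ Cy; lra.
have amono m n : (m <= n)%N -> a m <= a n.
  move=> mn; apply: (lb_le_inf (proj1 (ainf _))) => _ [y Cy ->].
  by apply: a_le; apply: Cdec Cy.
have abd n : a n <= M ^+ 2.
  apply: le_trans (a_le _ _ (pC n)) _.
  by have := CM _ _ (pC n); have := nr_ge0 (p n); nra.
(* The midpoint of [p n] and [p m] lies in [C m], so its squared norm is at least [a m]; the
   parallelogram law turns this into a bound on the distance. *)
have dist m n : (m <= n)%N ->
    nr (p n - p m) ^+ 2 <= 2 * (a n - a m) + 4 * eps m.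
  move=> mn.
  have := a_le _ _ (Cmid _ _ _ (Cdec _ _ mn _ (pC n)) (pC m)).
  rewrite nrZr ger0_norm ?invr_ge0// exprMn.
  have := parallelogram (p n) (p m); have := p_le m; have := p_le n.
  have := eps_mono _ _ mn; lra.
have [l hl] : exists l, cv p l.
  apply: cv_complete => e e0.
  have e1 : 0 < e ^+ 2 / 8 by rewrite divr_gt0 ?exprn_gt0.
  have [N1 h1] := mono_cauchy amono abd e1.
  have [N2 h2] := eps_lt _ e1.
  exists (maxn N1 N2) => m n; rewrite geq_max => /andP[m1 m2] mn.
  have := dist _ _ mn; have := h1 _ _ m1 mn; have := h2 _ m2.
  have := nr_ge0 (p n - p m); have := eps0 n.
  nra.
by exists p, l.
Qed.

Lemma greedy_le (x : nat -> H) N : exists s : nat -> bool,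
  nr (\sum_(i < N) (if s i then x i else - x i)) ^+ 2 <= \sum_(i < N) nr (x i) ^+ 2.
Proof.
elim: N => [|N [s hs]]; first by exists xpredT; rewrite !big_ord0 nr0 expr0n.
set S := \sum_(i < N) _ in hs.
have [h|h] := lerP (rip S (x N)) 0.
- exists (fun i => if i == N then true else s i).
  rewrite !big_ord_recr /= eqxx.
  under eq_bigr => i _ do rewrite ltn_eqF ?ltn_ord//.
  by rewrite -/S nrD2; lra.
- exists (fun i => if i == N then false else s i).
  rewrite !big_ord_recr /= eqxx.
  under eq_bigr => i _ do rewrite ltn_eqF ?ltn_ord//.
  by rewrite -/S nrB2; lra.
Qed.

Lemma greedy_ge (x : nat -> H) N : exists s : nat -> bool,
  \sum_(i < N) nr (x i) ^+ 2 <= nr (\sum_(i < N) (if s i then x i else - x i)) ^+ 2.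
Proof.
elim: N => [|N [s hs]]; first by exists xpredT; rewrite !big_ord0 nr0 expr0n.
set S := \sum_(i < N) (if _ then _ else _) in hs.
have [h|h] := lerP 0 (rip S (x N)).
- exists (fun i => if i == N then true else s i).
  rewrite !big_ord_recr /= eqxx.
  under [X in _ <= nr (X + _) ^+ 2]eq_bigr => i _ do rewrite ltn_eqF ?ltn_ord//.
  by rewrite -/S nrD2; lra.
- exists (fun i => if i == N then false else s i).
  rewrite !big_ord_recr /= eqxx.
  under [X in _ <= nr (X + _) ^+ 2]eq_bigr => i _ do rewrite ltn_eqF ?ltn_ord//.
  by rewrite -/S nrB2; lra.
Qed.

Lemma nr_sum_orth (x : nat -> H) N : (forall i j, i != j -> ip (x i) (x j) = 0) ->
  nr (\sum_(i < N) x i) ^+ 2 = \sum_(i < N) nr (x i) ^+ 2.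
Proof.
move=> h; elim: N => [|N IH]; first by rewrite !big_ord0 nr0 expr0n.
rewrite !big_ord_recr /= pythagoras ?IH// ip_suml big1// => i _.
by apply: h; rewrite ltn_eqF.
Qed.

(* Richardson iteration [v <- v + t (g - B v)]. *)
Lemma lax_milgram (B : {linear H -> H}) (c C : R) : 0 < c ->
  (forall v, nr (B v) <= C * nr v) -> (forall v, c * nr v ^+ 2 <= rip (B v) v) ->
  forall g, exists v, B v = g.
Proof.
move=> c0 BC Bc g.
pose C' := Num.max C c.
have cC' : c <= C' by rewrite le_max lexx orbT.
have C'0 : 0 < C' by apply: lt_le_trans cC'.
have BC' v : nr (B v) <= C' * nr v.
  apply: le_trans (BC v) _; apply: ler_wpM2r; first exact: nr_ge0.
  by rewrite le_max lexx.
(* The step [t = c / C'^2] minimizes [1 - 2 t c + t^2 C'^2], with minimum [1 - t c]; enlarging [C]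
   to [C' >= c] keeps this value nonnegative. *)
have [t t0 tE] : exists2 t : R, 0 < t & t * C' ^+ 2 = c.
  by exists (c / C' ^+ 2); rewrite ?divr_gt0 ?exprn_gt0// divfK// gt_eqF// exprn_gt0.
pose q2 : R := 1 - t * c.
have q20 : 0 <= q2.
  rewrite /q2 subr_ge0 -(ler_pM2r (exprn_gt0 2 C'0)) mul1r mulrAC tE.
  by rewrite expr2 ler_pM// ltW.
have q21 : q2 < 1 by rewrite /q2 ltrBlDr ltrDl mulr_gt0.
have contr d : nr (d - t%:C *: B d) ^+ 2 <= q2 * nr d ^+ 2.
  rewrite nrB2 ripZr ripC nrZr ger0_norm ?(ltW t0)// exprMn.
  have h1 := Bc d; have h2 := BC' d; have h3 := nr_ge0 (B d).
  have h4 : nr (B d) ^+ 2 <= (C' * nr d) ^+ 2 by rewrite lerXn2r ?nnegrE// (le_trans h3).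
  have h5 : t ^+ 2 * nr (B d) ^+ 2 <= t * c * nr d ^+ 2.
    rewrite expr2 -!mulrA ler_pM2l// -[X in X * nr d ^+ 2]tE -mulrA -exprMn.
    by rewrite ler_pM2l.
  have : t * (c * nr d ^+ 2) <= t * rip (B d) d by rewrite ler_pM2l.
  rewrite /q2; lra.
pose q := Num.sqrt q2.
have q0 : 0 <= q by rewrite sqrtr_ge0.
have qq : q ^+ 2 = q2 by rewrite sqr_sqrtr.
have q1 : q < 1 by rewrite -(@ltr_pXn2r _ 2)// ?nnegrE// qq expr1n.
have contr' d : nr (d - t%:C *: B d) <= q * nr d.
  rewrite -(@ler_pXn2r _ 2)// ?nnegrE ?mulr_ge0 ?nr_ge0//.
  by rewrite exprMn qq contr.
pose v := fix v n := if n is m.+1 then v m + t%:C *: (g - B (v m)) else 0.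
pose d n := v n.+1 - v n.
have vS n : v n.+1 = v n + t%:C *: (g - B (v n)) by [].
have dE n : d n = t%:C *: (g - B (v n)) by rewrite /d vS addrAC subrr add0r.
have dS n : d n.+1 = d n - t%:C *: B (d n).
  by rewrite dE vS -dE linearD opprD addrA scalerBr -dE.
have dq n : nr (d n) <= q ^+ n * nr (d 0%N).
  elim: n => [|n IH]; first by rewrite expr0 mul1r.
  rewrite dS (le_trans (contr' _))// exprS -mulrA; exact: ler_wpM2l.
have q1' : 0 < 1 - q by lra.
have vdist m n : (m <= n)%N -> nr (v n - v m) <= q ^+ m * (nr (d 0%N) / (1 - q)).
  move=> mn; suff : nr (v n - v m) <= (q ^+ m - q ^+ n) * (nr (d 0%N) / (1 - q)).
    move=> h; apply: le_trans h _; apply: ler_wpM2r; first by rewrite divr_ge0 ?nr_ge0// ltW.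
    by rewrite gerBl exprn_ge0.
  rewrite -(subnK mn); elim: (n - m)%N => [|j IH]; first by rewrite add0n !subrr nr0 mul0r.
  rewrite addSn; apply: le_trans (nrDB _ (v (j + m)%N) _) _.
  have := dq (j + m)%N; rewrite /d -/v => h.
  apply: le_trans (lerD h IH) _.
  have -> : q ^+ (j + m) * nr (d 0%N) = (q ^+ (j + m) - q ^+ (j + m).+1) * (nr (d 0%N) / (1 - q)).
    by rewrite exprS; field; lra.
  by rewrite -mulrDl; apply: ler_wpM2r; [rewrite divr_ge0 ?nr_ge0// ltW|lra].
have [l hl] : exists l, cv v l.
  apply: cv_complete => e e0.
  have e1 : 0 < e / (nr (d 0%N) / (1 - q) + 1).
    by rewrite divr_gt0// ltr_wpDl// divr_ge0 ?nr_ge0// ltW.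
  have /cvgrPdist_lt/(_ _ e1)[N _ hN] : (GRing.exp q @ \oo --> (0 : R)).
    by apply: cvg_expr; rewrite ger0_norm.
  exists N => m n Nm mn; apply: le_lt_trans (vdist _ _ mn) _.
  have := hN m Nm; rewrite /= sub0r normrN ger0_norm ?exprn_ge0//.
  have n0 : 0 <= nr (d 0%N) / (1 - q) by rewrite divr_ge0 ?nr_ge0// ltW.
  rewrite ltr_pdivlMr; last by lra.
  have := exprn_ge0 m q0; nra.
exists l.
have h1 : cv (fun n => t%:C *: (g - B (v n))) (t%:C *: (g - B l)).
  apply: cvZ; apply: cvB; first exact: cv_cst.
  by apply: (@cv_lip _ _ _ _ _ _ _ C) hl => n; rewrite -linearB.
have h2 : cv (fun n => t%:C *: (g - B (v n))) 0.
  have -> : (0 : H) = l - l by rewrite subrr.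
  apply: cv_ext (cvB (cv_shift (s := S) _ hl) hl) => [n|//].
  by rewrite /= [v n + _]addrC addrK.
have h3 := cv_unique h1 h2.
have : nr (t%:C *: (g - B l)) = 0 by rewrite h3 nr0.
rewrite nrZr => /eqP; rewrite mulf_eq0 normr_eq0 gt_eqF//= => /eqP/nr_eq0/subr0_eq.
by [].
Qed.
End Hilb.

(** * Functional calculus of nonnegative functions *)

Section SetFunctionIntegral.
Local Open Scope ereal_scope.
Import HBNNSimple.

(** [pvm_measure E u] is only a set function, since nothing is known about [E] off the Borel sets.
    The integral sees values on measurable sets only, so a genuine measure can be substituted. *)
Lemma eq_setfun_integral d (T : measurableType d) (R : realType)
    (m1 m2 : set T -> \bar R) (f : T -> \bar R) :
  (forall A, measurable A -> m1 A = m2 A) ->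
  \int[m1]_x f x = \int[m2]_x f x.
Proof.
move=> m12.
have sE (h : {nnsfun T >-> R}) : sintegral m1 h = sintegral m2 h.
  by apply: eq_fsbigr => r _; rewrite m12.
by rewrite /integral; congr (ereal_sup _ - ereal_sup _);
  apply: eq_imagel => h _; rewrite sE.
Qed.
End SetFunctionIntegral.

(* [f = sum_k 1_{A_k} / (k + 1)], the sets [A_k] being chosen greedily. *)
Section Greedy.
Variable (R : realType) (f : R -> R).
Hypothesis f0 : forall x, 0 <= f x.

Definition harm (k : nat) : R := k.+1%:R^-1.

Fixpoint greedy_sum (N : nat) (x : R) : R :=
  if N is k.+1 then greedy_sum k x + (if harm k + greedy_sum k x <= f x then harm k else 0) else 0.

Definition greedy_set (k : nat) : set R := [set x | harm k + greedy_sum k x <= f x].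

Lemma harm_gt0 k : 0 < harm k. Proof. by rewrite invr_gt0. Qed.

Lemma greedy_sum_ge0 N x : 0 <= greedy_sum N x.
Proof.
elim: N => //= k IH; rewrite addr_ge0//; case: ifP => // _; exact: ltW (harm_gt0 _).
Qed.

Lemma greedy_sum_le N x : greedy_sum N x <= f x.
Proof. by elim: N => //= k IH; case: ifP => h; rewrite ?addr0// addrC. Qed.

Lemma greedy_sum_mono x m n : (m <= n)%N -> greedy_sum m x <= greedy_sum n x.
Proof.
move=> mn; rewrite -(subnK mn); elim: (n - m)%N => // k IH.
rewrite addSn /=; apply: le_trans IH _; rewrite lerDl.
by case: ifP => // _; exact: ltW (harm_gt0 _).
Qed.

(** The terms tend to 0 while their series diverges, so unbounded [f] can be reached as well. A gap
    between the limit and [f x] would force all late terms to be taken and make the harmonic series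
    converge. *)
Lemma greedy_sum_cvg x : greedy_sum ^~ x @ \oo --> f x.
Proof.
have nd : nondecreasing_seq (greedy_sum ^~ x) by move=> m n; exact: greedy_sum_mono.
have ub : has_ubound (range (greedy_sum ^~ x)) by exists (f x) => _ [n _ <-]; exact: greedy_sum_le.
have cvg_l := nondecreasing_cvgn nd ub.
set l := sup _ in cvg_l.
have lf : l <= f x by apply: ge_sup => [|_ [n _ <-]]; [exists (greedy_sum 0 x), 0%N|exact: greedy_sum_le].
have ls n : greedy_sum n x <= l by apply: ub_le_sup => //; exists n.
suff -> : f x = l by [].
apply/eqP; rewrite eq_le lf andbT leNgt; apply/negP => lt.
have lt' : 0 < f x - l by rewrite subr_gt0.
have [N hN] := invS_lt lt'.
(* beyond [N] every term of the harmonic series is taken *)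
have step n : (N <= n)%N -> greedy_sum n.+1 x = greedy_sum n x + harm n.
  move=> /hN h /=; rewrite ifT//.
  have h' : harm n < f x - l by [].
  have := ls n; lra.
have sE n : greedy_sum (N + n) x = greedy_sum N x + \sum_(N <= k < N + n) harmonic k.
  elim: n => [|n IH]; first by rewrite addn0 big_geq ?addr0.
  by rewrite addnS step ?leq_addr// IH big_nat_recr ?leq_addr//= addrA.
apply: (@dvg_harmonic R).
apply: nondecreasing_is_cvgn.
  apply: nondecreasing_series => n _ _; exact: harmonic_ge0.
exists (l + series harmonic N) => _ [n _ <-].
have [nN|Nn] := leqP n N.
  rewrite -[leLHS]add0r lerD//; first by apply: le_trans (greedy_sum_ge0 0 x) (ls 0%N).
  by apply: nondecreasing_series => // k _ _; exact: harmonic_ge0.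
have := sE (n - N)%N; rewrite subnKC 1?ltnW// => e.
have : series harmonic n = series harmonic N + \sum_(N <= k < n) @harmonic R k.
  by rewrite /series /= -big_cat_nat//= ltnW.
have := ls n; have := greedy_sum_ge0 N x; lra.
Qed.

Lemma greedy_sum_indic N x : greedy_sum N x = \sum_(k < N) harm k * \1_(greedy_set k) x.
Proof.
elim: N => [|N IH]; first by rewrite big_ord0.
rewrite big_ord_recr /= IH indicE; congr (_ + _).
have -> : (x \in greedy_set N) = (harm N + greedy_sum N x <= f x) by apply/idP/idP; rewrite inE.
by rewrite -IH; case: ifP => _; rewrite ?mulr1 ?mulr0.
Qed.

Hypothesis mf : measurable_fun setT f.

Lemma measurable_greedy_sum N : measurable_fun setT (greedy_sum N).
Proof.
elim: N => [|k IH]; first exact: measurable_cst.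
apply: measurable_funD => //; apply: measurable_fun_ifT => //.
by apply: measurable_fun_ler => //; apply: measurable_funD.
Qed.

Lemma measurable_greedy_set k : measurable (greedy_set k).
Proof.
rewrite -[greedy_set k]setTI; apply: measurable_fun_le => //.
by apply: measurable_funD => //; exact: measurable_greedy_sum.
Qed.

End Greedy.

(* The clauses of [is_pvm] other than [E setT u = u]; they also hold for the
   zero family, which is the default value of [spectral_measure]. *)
Definition subpvm (R : realType) (H : hilbertType R) (E : set R -> H -> H) : Prop :=
  [/\ (forall B : set R, measurable B -> linear (E B)),
      (forall (B : set R) (u v : H), measurable B -> ip (E B u) v = ip u (E B v)),
      (forall (B C : set R) (u : H), measurable B -> measurable C ->
         E (B `&` C) u = E B (E C u)) &
      (forall (F : (set R) ^nat) (u : H),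
         (forall n : nat, measurable (F n)) -> trivIset setT F ->
         cv (fun n : nat => \sum_(i < n) E (F i) u) (E (\bigcup_n F n) u))].

Lemma subpvm_pvm (R : realType) (H : hilbertType R) (E : set R -> H -> H) :
  is_pvm E -> subpvm E.
Proof.
by case=> h1 h2 h3 _ h5; split=> // F u mF tF; apply: cv_cvg; exact: h5.
Qed.

Lemma subpvm0 (R : realType) (H : hilbertType R) : subpvm (fun (_ : set R) (_ : H) => 0).
Proof.
split=> [B _ a u v|B u v _|//|F u _ _]; first by rewrite scaler0 addr0.
  by rewrite ip0l ip0r.
by apply: cv_ext (@cv_cst _ _ 0) => n; rewrite big1.
Qed.

Section Pvm.
Variables (R : realType) (H : hilbertType R) (E : set R -> H -> H).
Hypothesis hE : subpvm E.
Implicit Types (B C : set R) (u v : H).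

Lemma E_lin B a u v : measurable B -> E B (a *: u + v) = a *: E B u + E B v.
Proof. by move=> mB; have [h _ _ _] := hE; exact: h. Qed.
Lemma E_sym B u v : measurable B -> ip (E B u) v = ip u (E B v).
Proof. by move=> mB; have [_ h _ _] := hE; exact: h. Qed.
Lemma E_I B C u : measurable B -> measurable C -> E (B `&` C) u = E B (E C u).
Proof. by move=> mB mC; have [_ _ h _] := hE; exact: h. Qed.
Lemma E_sigma (F : (set R) ^nat) u : (forall n, measurable (F n)) -> trivIset setT F ->
  cv (fun n => \sum_(i < n) E (F i) u) (E (\bigcup_n F n) u).
Proof. by move=> mF; have [_ _ _ h] := hE; exact: h. Qed.

Lemma E_zero B : measurable B -> E B 0 = 0.
Proof. by move=> mB; have := E_lin (-1) 0 0 mB; rewrite scaler0 addr0 => ->; rewrite scaleN1r addNr. Qed.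
Lemma E_D B u v : measurable B -> E B (u + v) = E B u + E B v.
Proof. by move=> mB; have := E_lin 1 u v mB; rewrite !scale1r. Qed.
Lemma E_Z B a u : measurable B -> E B (a *: u) = a *: E B u.
Proof. by move=> mB; have := E_lin a u 0 mB; rewrite !addr0 E_zero// addr0. Qed.
Lemma E_N B u : measurable B -> E B (- u) = - E B u.
Proof. by move=> mB; rewrite -scaleN1r E_Z// scaleN1r. Qed.
Lemma E_B B u v : measurable B -> E B (u - v) = E B u - E B v.
Proof. by move=> mB; rewrite E_D// E_N. Qed.
Lemma E_sum B (I : Type) (r : seq I) (F : I -> H) : measurable B ->
  E B (\sum_(i <- r) F i) = \sum_(i <- r) E B (F i).
Proof.
move=> mB; apply: (big_morph (E B)) => [x y|]; [exact: E_D|exact: E_zero].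
Qed.

Lemma E_C B C u : measurable B -> measurable C -> E B (E C u) = E C (E B u).
Proof. by move=> mB mC; rewrite -!E_I// setIC. Qed.
Lemma E_idem B u : measurable B -> E B (E B u) = E B u.
Proof. by move=> mB; rewrite -E_I// setIid. Qed.

Lemma ip_E B C u : measurable B -> measurable C ->
  ip (E B u) (E C u) = (nr (E (B `&` C) u) ^+ 2)%:C.
Proof.
move=> mB mC; have mBC := measurableI _ _ mB mC.
by rewrite -ipuu [RHS]E_sym// E_idem// E_I// [LHS]E_sym.
Qed.

Lemma rip_E B u : measurable B -> rip (E B u) u = nr (E B u) ^+ 2.
Proof. by move=> mB; rewrite -rip_uu /rip (E_sym _ (E B u) mB) E_idem// E_sym. Qed.

Lemma E_le B u : measurable B -> nr (E B u) <= nr u.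
Proof.
move=> mB; have := rip_le (E B u) u; rewrite rip_E//.
have := nr_ge0 (E B u); have := nr_ge0 u.
have [->|] := eqVneq (nr (E B u)) 0; first by [].
by move=> n0 h1 h2; rewrite expr2 ler_pM2l// lt_def n0.
Qed.

Lemma E_set0 u : E set0 u = 0.
Proof.
have t0 : trivIset setT (fun _ : nat => set0 : set R) by move=> i j _ _ [x []].
have h := @E_sigma (fun=> set0) u (fun=> measurable0) t0.
rewrite bigcup0// in h.
have h2 := cvB (cv_shift (s := S) (fun n => leqnSn n) h) h.
rewrite subrr in h2; apply: cv_unique h2.
apply: cv_ext (@cv_cst _ _ (E set0 u)) => n /=.
by rewrite big_ord_recr /= addrAC subrr add0r.
Qed.

Lemma cv_E (x : nat -> H) l B : measurable B -> cv x l -> cv (E B \o x) (E B l).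
Proof.
move=> mB; apply: (@cv_lip _ _ _ _ _ _ _ 1) => n /=.
by rewrite mul1r -E_B// E_le.
Qed.

(** The proof of [subpvm E] is carried as an argument so that the measure structure built from it
    can be inferred from the term. *)
Definition mu_for (_ : subpvm E) u B : \bar R := (nr (E B u) ^+ 2)%:E.
Local Notation spec_mu := (mu_for hE).

Let mu0 u : spec_mu u set0 = 0%E.
Proof. by rewrite /mu_for E_set0 nr0 expr0n. Qed.

Let mu_ge0 u B : (0 <= spec_mu u B)%E.
Proof. by rewrite lee_fin sqr_ge0. Qed.

Lemma cv_rip_left (x : nat -> H) l v : cv x l -> (fun n => rip (x n) v) @ \oo --> rip l v.
Proof.
move=> h; apply/cvgrPdist_lt => e e0.
have n1 : 0 < nr v + 1 by have := nr_ge0 v; lra.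
have [N hN] := h _ (divr_gt0 e0 n1).
exists N => // n /= /hN; rewrite ltr_pdivlMr// => hh.
have -> : rip l v - rip (x n) v = rip (l - x n) v by rewrite ripDl ripNl.
apply: le_lt_trans (le_trans (Re_le_cabs _) (cauchy_schwarz _ _)) _.
by rewrite nrBC; have := nr_ge0 v; have := nr_ge0 (x n - l); nra.
Qed.

Let mu_sigma u : semi_sigma_additive (spec_mu u).
Proof.
move=> F mF tF mUF.
have -> : spec_mu u (\bigcup_n F n) = (rip (E (\bigcup_n F n) u) u)%:E by rewrite rip_E.
have -> : (fun n => \sum_(0 <= i < n) spec_mu u (F i))%E =
    (fun n => (rip (\sum_(i < n) E (F i) u) u)%:E).
  apply/funext => n; rewrite big_mkord sumEFin; congr EFin.
  rewrite /rip ip_suml (big_morph (@complex.Re R) (@ReD R) (erefl : complex.Re 0 = 0)).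
  by apply: eq_bigr => i _; rewrite -[RHS]/(rip _ _) rip_E.
apply: cvg_EFin; first by apply: nearW.
apply: cv_rip_left; exact: E_sigma.
Qed.

HB.instance Definition _ u := isMeasure.Build _ _ _ (spec_mu u) (mu0 u) (mu_ge0 u) (@mu_sigma u).

Lemma int_mu u (f : R -> \bar R) :
  (\int[pvm_measure E u]_t f t = \int[spec_mu u]_t f t)%E.
Proof.
apply: eq_setfun_integral => B mB.
by rewrite /pvm_measure -[hdot _ _]/(ip _ _) -[complex.Re _]/(rip _ _) rip_E.
Qed.

End Pvm.

Lemma int_sum_indic d (T : measurableType d) (R : realType) (mu : {measure set T -> \bar R})
    (I : Type) (r : seq I) (c : I -> R) (B : I -> set T) :
  (forall i, 0 <= c i) -> (forall i, measurable (B i)) ->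
  (\int[mu]_x (\sum_(i <- r) c i * \1_(B i) x)%:E = \sum_(i <- r) (c i)%:E * mu (B i))%E.
Proof.
move=> c0 mB.
under eq_integral do rewrite -sumEFin.
rewrite ge0_integral_sum//.
- apply: eq_bigr => i _; under eq_integral do rewrite EFinM.
  have mI : measurable_fun setT (fun x => (\1_(B i) x)%:E : \bar R).
    exact/measurable_EFinP/measurable_indic.
  have I0 x : [set: T] x -> (0 <= (\1_(B i) x)%:E :> \bar R)%E by rewrite lee_fin.
  by rewrite (ge0_integralZl_EFin mu measurableT I0 mI (c0 i)) integral_indic// setIT.
- move=> i; apply/measurable_EFinP/measurable_funM; first exact: measurable_cst.
  exact: measurable_indic.
- by move=> i x _; rewrite lee_fin mulr_ge0.
Qed.

(** * The operator of a nonnegative function as a strong limit *)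

Section FunCalc.
Variables (R : realType) (H : hilbertType R) (E : set R -> H -> H).
Hypothesis hE : subpvm E.
Variable f : R -> R.
Hypotheses (f0 : forall x, 0 <= f x) (mf : measurable_fun setT f).
Implicit Types (B C : set R) (u v : H).

Let A k : set R := greedy_set f k.
Let mA k : measurable (A k). Proof. exact: measurable_greedy_set. Qed.
Let w k : R := harm R k.
Let w0 k : 0 <= w k. Proof. exact/ltW/harm_gt0. Qed.

Definition calc_step N u : H := \sum_(k < N) (harm R k)%:C *: E (greedy_set f k) u.

Lemma calc_step_lin N a u v : calc_step N (a *: u + v) = a *: calc_step N u + calc_step N v.
Proof.
rewrite /calc_step scaler_sumr -big_split; apply: eq_bigr => k _ /=.
by rewrite (E_lin hE)// scalerDr !scalerA mulrC.
Qed.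

Lemma calc_step_E N B u : measurable B -> E B (calc_step N u) = calc_step N (E B u).
Proof.
move=> mB; rewrite /calc_step (E_sum hE)//; apply: eq_bigr => k _.
by rewrite (E_Z hE)// (E_C hE).
Qed.

Lemma ip_calc_step N u : ip (calc_step N u) u = (\sum_(k < N) w k * nr (E (A k) u) ^+ 2)%:C.
Proof.
rewrite /calc_step ip_suml (big_morph (@real_complex_def R (Phant R)) (@rcD R) (erefl : 0%:C = 0)).
apply: eq_bigr => k _; rewrite ipZl rcM; congr (_ * _).
by rewrite -[in LHS](E_idem hE u (mA k)) (E_sym hE)// -ipuu.
Qed.

Lemma rip_calc_step N u : rip (calc_step N u) u = \sum_(k < N) w k * nr (E (A k) u) ^+ 2.
Proof. by rewrite /rip ip_calc_step. Qed.

Lemma rip_E2 B C u : measurable B -> measurable C ->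
  rip (E B u) (E C u) = nr (E (B `&` C) u) ^+ 2.
Proof. by move=> mB mC; rewrite /rip (ip_E hE). Qed.

Lemma rip_sum_sum (I J : Type) (r : seq I) (s : seq J) (F : I -> H) (G : J -> H) :
  rip (\sum_(i <- r) F i) (\sum_(j <- s) G j) = \sum_(i <- r) \sum_(j <- s) rip (F i) (G j).
Proof.
rewrite /rip ip_suml (big_morph (@complex.Re R) (@ReD R) (erefl : complex.Re 0 = 0)).
apply: eq_bigr => i _; rewrite ip_sumr.
by rewrite (big_morph (@complex.Re R) (@ReD R) (erefl : complex.Re 0 = 0)).
Qed.

Lemma nr_calc_step N u : nr (calc_step N u) ^+ 2 =
  \sum_(i < N) \sum_(j < N) (w i * w j) * nr (E (A i `&` A j) u) ^+ 2.
Proof.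
rewrite -rip_uu /calc_step rip_sum_sum; apply: eq_bigr => i _; apply: eq_bigr => j _.
by rewrite ripZl ripZr rip_E2// mulrA.
Qed.

(** Since [ip (E B u) (E C u) = |E (B]&[C) u|^2], the cross term between a partial sum and a later
    increment is nonnegative. Bounded partial sums are therefore Cauchy, which justifies
    [calc_dom]. *)
Lemma calc_step_incr m n u : (m <= n)%N ->
  nr (calc_step n u - calc_step m u) ^+ 2 <= nr (calc_step n u) ^+ 2 - nr (calc_step m u) ^+ 2.
Proof.
move=> mn.
have e : calc_step n u - calc_step m u = \sum_(m <= k < n) (harm R k)%:C *: E (greedy_set f k) u.
  rewrite /calc_step -!(big_mkord xpredT (fun k => (harm R k)%:C *: E (greedy_set f k) u)).
  by rewrite (big_cat_nat _ (n := m))//= addrAC subrr add0r.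
have pos : 0 <= rip (calc_step m u) (calc_step n u - calc_step m u).
  rewrite e /calc_step rip_sum_sum; apply: sumr_ge0 => i _; apply: sumr_ge0 => j _.
  by rewrite ripZl ripZr rip_E2// !mulr_ge0 ?nr_ge0// ltW// harm_gt0.
have := nrD2 (calc_step m u) (calc_step n u - calc_step m u); rewrite addrC subrK => ->.
lra.
Qed.

Lemma calc_step_nr_mono u m n : (m <= n)%N -> nr (calc_step m u) ^+ 2 <= nr (calc_step n u) ^+ 2.
Proof.
by move=> mn; have := calc_step_incr u mn; have := sqr_ge0 (nr (calc_step n u - calc_step m u)); lra.
Qed.

Definition calc_dom : set H := [set u | exists M, forall N, nr (calc_step N u) <= M].

Lemma calc_dom_manifold : linear_manifold calc_dom.
Proof.
split.
  exists 0 => N; have := calc_step_lin N (-1) 0 0.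
  by rewrite scaler0 addr0 scaleN1r addNr => ->; rewrite nr0.
move=> a u v [M hM] [M' hM']; exists (cabs a * M + M') => N.
rewrite calc_step_lin; apply: le_trans (nrD _ _) _; rewrite nrZ.
by apply: lerD => //; apply: ler_wpM2l (cabs_ge0 _) _ _ _.
Qed.

Definition calc u : H := xget 0 [set l | cv (calc_step ^~ u) l].

Lemma calc_cv u : calc_dom u -> cv (calc_step ^~ u) (calc u).
Proof.
move=> [M hM].
suff [l hl] : exists l, cv (calc_step ^~ u) l.
  exact: (@xgetPex _ 0 [set l | cv (calc_step ^~ u) l] (ex_intro _ l hl)).
apply: cv_complete => e e0.
have bd n : nr (calc_step n u) ^+ 2 <= M ^+ 2.
  by have := hM n; have := nr_ge0 (calc_step n u); nra.
have [N hN] := mono_cauchy (@calc_step_nr_mono u) bd (exprn_gt0 2 e0).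
exists N => m n Nm mn.
rewrite -(@ltr_pXn2r _ 2)// ?nnegrE ?nr_ge0 ?ltW//.
exact: le_lt_trans (calc_step_incr u mn) (hN _ _ Nm mn).
Qed.

Lemma calc_lin a u v : calc_dom u -> calc_dom v -> calc (a *: u + v) = a *: calc u + calc v.
Proof.
move=> hu hv; have [_ hD] := calc_dom_manifold.
apply: cv_unique (calc_cv (hD a _ _ hu hv)) _.
apply: cv_ext (cvD (cvZ a (calc_cv hu)) (calc_cv hv)) => n.
by rewrite calc_step_lin.
Qed.

Lemma calc_linear_on : linear_on calc_dom calc.
Proof. by split; [exact: calc_dom_manifold|exact: calc_lin]. Qed.

Lemma calc_dom_E B u : measurable B -> calc_dom u -> calc_dom (E B u).
Proof.
move=> mB [M hM]; exists M => N; rewrite -calc_step_E//.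
exact: le_trans (E_le hE _ mB) (hM N).
Qed.

Lemma calc_E B u : measurable B -> calc_dom u -> calc (E B u) = E B (calc u).
Proof.
move=> mB hu; apply: cv_unique (calc_cv (calc_dom_E mB hu)) _.
by apply: cv_ext (cv_E hE mB (calc_cv hu)) => n /=; rewrite calc_step_E.
Qed.

Lemma int_greedy_sum N u : (\int[mu_for hE u]_t (greedy_sum f N t)%:E = (rip (calc_step N u) u)%:E)%E.
Proof.
under eq_integral do rewrite greedy_sum_indic.
rewrite (int_sum_indic (mu_for hE u))//.
by rewrite rip_calc_step -sumEFin; apply: eq_bigr.
Qed.

Lemma int_greedy_sum2 N u : (\int[mu_for hE u]_t ((greedy_sum f N t) ^+ 2)%:E = (nr (calc_step N u) ^+ 2)%:E)%E.
Proof.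
pose c (p : 'I_N * 'I_N) : R := w p.1 * w p.2.
pose B (p : 'I_N * 'I_N) := A p.1 `&` A p.2.
have e t : greedy_sum f N t ^+ 2 = \sum_p c p * \1_(B p) t.
  rewrite greedy_sum_indic expr2 big_distrlr /= pair_bigA /=; apply: eq_bigr => p _.
  by rewrite /c /B indicI /= mulrACA.
under eq_integral do rewrite e.
rewrite int_sum_indic//.
- rewrite nr_calc_step pair_bigA /= -sumEFin; apply: eq_bigr => p _ //.
- by move=> p; rewrite mulr_ge0.
- by move=> p; exact: measurableI.
Qed.

Lemma int_cvg (g : R -> R) u : (forall x y, 0 <= x -> x <= y -> g x <= g y) ->
  (forall x, 0 <= x -> 0 <= g x) -> continuous g -> measurable_fun setT g ->
  (fun N => \int[mu_for hE u]_t (g (greedy_sum f N t))%:E)%E @ \oo -->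
  (\int[mu_for hE u]_t (g (f t))%:E)%E.
Proof.
move=> gm g0 gc mg.
have lE t : (g (f t))%:E = lim ((fun N => (g (greedy_sum f N t))%:E) @ \oo).
  apply/esym/cvg_lim => //; apply: cvg_EFin; first exact: nearW.
  by apply: (@cvg_comp _ _ _ (greedy_sum f ^~ t) g); [exact: greedy_sum_cvg|exact: gc].
rewrite (eq_integral (fun t => lim ((fun N => (g (greedy_sum f N t))%:E) @ \oo))) => [|t _]; last exact: lE.
apply: cvg_monotone_convergence => //.
- move=> n; apply/measurable_EFinP.
  by apply: (@measurableT_comp _ _ _ _ _ _ g) => //; exact: measurable_greedy_sum.
- by move=> n x _; rewrite lee_fin g0// greedy_sum_ge0.
- by move=> x _ m n mn; rewrite lee_fin gm ?greedy_sum_ge0// greedy_sum_mono.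
Qed.

Lemma int_f_cvg u : (rip (calc_step N u) u)%:E @[N --> \oo] --> (\int[mu_for hE u]_t (f t)%:E)%E.
Proof.
have -> : (fun N => (rip (calc_step N u) u)%:E) = (fun N => \int[mu_for hE u]_t (greedy_sum f N t)%:E)%E.
  by apply/funext => N; rewrite int_greedy_sum.
by apply: (@int_cvg id) => // x; exact: cvg_id.
Qed.

Lemma int_f2_cvg u :
  (nr (calc_step N u) ^+ 2)%:E @[N --> \oo] --> (\int[mu_for hE u]_t ((f t) ^+ 2)%:E)%E.
Proof.
have -> : (fun N => (nr (calc_step N u) ^+ 2)%:E) = (fun N => \int[mu_for hE u]_t (greedy_sum f N t ^+ 2)%:E)%E.
  by apply/funext => N; rewrite int_greedy_sum2.
apply: (@int_cvg (fun x => x ^+ 2)) => //.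
- by move=> x y x0 xy; rewrite lerXn2r// ?nnegrE// (le_trans x0).
- by move=> x _; exact: sqr_ge0.
- exact: exprn_continuous.
Qed.

Lemma cvg_real_unique (a : nat -> R) (l : R) (L : \bar R) :
  a @ \oo --> l -> (a n)%:E @[n --> \oo] --> L -> L = l%:E.
Proof.
move=> al aL; have : (a n)%:E @[n --> \oo] --> l%:E by apply: cvg_EFin => //; exact: nearW.
by move=> h; exact: (cvg_unique _ aL h).
Qed.

Lemma cvg_nr2 (x : nat -> H) l : cv x l -> (fun n => nr (x n) ^+ 2) @ \oo --> nr l ^+ 2.
Proof.
move=> h.
have hn : (fun n => nr (x n)) @ \oo --> nr l.
  apply/cvgrPdist_lt => e e0; have [N hN] := h _ e0; exists N => // n /= /hN hh.
  rewrite ltr_norml; have := nr_tri (x n) l; have := nr_tri l (x n); rewrite (nrBC l (x n)); lra.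
by rewrite expr2; apply: cvgM.
Qed.

Lemma int_f2 u : calc_dom u -> (\int[mu_for hE u]_t ((f t) ^+ 2)%:E = (nr (calc u) ^+ 2)%:E)%E.
Proof.
move=> hu; apply: (cvg_real_unique _ (@int_f2_cvg u)).
by apply: cvg_nr2; exact: calc_cv.
Qed.

Lemma int_f u : calc_dom u -> (\int[mu_for hE u]_t (f t)%:E = (rip (calc u) u)%:E)%E.
Proof.
move=> hu; apply: (cvg_real_unique _ (@int_f_cvg u)).
by apply: cv_rip_left; exact: calc_cv.
Qed.

Lemma calc_dom_int u : (\int[mu_for hE u]_t ((f t) ^+ 2)%:E < +oo)%E -> calc_dom u.
Proof.
move=> fin; set I := (\int[_]_t _)%E in fin.
have I0 : (0 <= I)%E by apply: integral_ge0 => x _; rewrite lee_fin sqr_ge0.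
have [r Ir] : exists r, I = r%:E by exists (fine I); rewrite fineK// ge0_fin_numE.
have r0 : 0 <= r by rewrite -lee_fin -Ir.
have h N : nr (calc_step N u) ^+ 2 <= r.
  rewrite -lee_fin -Ir -int_greedy_sum2; apply: ge0_le_integral => //.
  - by move=> x _; rewrite lee_fin sqr_ge0.
  - by apply/measurable_EFinP/measurable_funX; exact: measurable_greedy_sum.
  - by apply/measurable_EFinP/measurable_funX.
  - by move=> x _; rewrite lee_fin lerXn2r ?nnegrE ?greedy_sum_ge0// greedy_sum_le.
exists (r + 1) => N; have := h N; have := nr_ge0 (calc_step N u); nra.
Qed.

Lemma calc_domP u : calc_dom u <-> (\int[mu_for hE u]_t ((f t) ^+ 2)%:E < +oo)%E.
Proof. by split=> [hu|]; [rewrite int_f2// ltry|exact: calc_dom_int]. Qed.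

Lemma ip_calc u : calc_dom u -> ip (calc u) u = (rip (calc u) u)%:C.
Proof.
move=> hu; rewrite [LHS]complexE.
suff -> : complex.Im (ip (calc u) u) = 0 by rewrite mulr0 addr0.
(* The imaginary part is rewritten as a real part, to which the convergence of [rip] applies. *)
have -> (z : R[i]) : complex.Im z = complex.Re (- 'i * z).
  by case: z => a b /=; rewrite oppr0 !mul0r sub0r mulN1r opprK.
rewrite -ipZl -[LHS]/(rip _ _).
have h1 : (fun n => rip (- 'i *: calc_step n u) u) @ \oo --> rip (- 'i *: calc u) u.
  by apply: cv_rip_left; apply: cvZ; exact: calc_cv.
have e0 : (fun n => rip (- 'i *: calc_step n u) u) = fun=> 0.
  apply/funext => n; rewrite /rip ipZl ip_calc_step /=.
  by rewrite oppr0 mul0r mulr0 subr0.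
rewrite e0 in h1; have h2 : (fun _ : nat => 0 : R) @ \oo --> (0 : R) by exact: cvg_cst.
exact: (cvg_unique _ h1 h2).
Qed.

End FunCalc.

Section Density.
Variables (R : realType) (H : hilbertType R).

Lemma cv_dense (V : normedModType R[i]) (D : set V) :
  (forall x, exists u : nat -> V, (forall n, D (u n)) /\ cv u x) -> dense D.
Proof.
move=> h O [x Ox] oO; have [u [Du ux]] := h x.
have nO : nbhs x O by move: oO; rewrite openE => /(_ _ Ox).
have [N _ hN] := cvg_cv ux nO.
by exists (u N); split=> //; apply: hN => /=.
Qed.

Lemma ortho_dense (D : set H) x : dense D -> (forall v, D v -> ip x v = 0) -> x = 0.
Proof.
move=> dD h; have [u [Du ux]] := dense_cv x dD.
apply: nr_eq0; apply/eqP; rewrite -sqrf_eq0 -rip_uu; apply/eqP.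
have h1 : (fun n => rip (u n) x) @ \oo --> rip x x by exact: cv_rip_left.
have e0 : (fun n => rip (u n) x) = fun=> 0.
  by apply/funext => n; rewrite ripC /rip h.
rewrite e0 in h1; have h2 : (fun _ : nat => 0 : R) @ \oo --> (0 : R) by exact: cvg_cst.
exact: (cvg_unique _ h1 h2).
Qed.

End Density.

(** * Bounds on spectral subspaces and the weak integral *)

Section FunCalc2.
Variables (R : realType) (H : hilbertType R) (E : set R -> H -> H).
Hypothesis hE : subpvm E.
Variable f : R -> R.
Hypotheses (f0 : forall x, 0 <= f x) (mf : measurable_fun setT f).
Implicit Types (B C : set R) (u v : H).

Lemma int_supp B u (g : R -> R) : measurable B -> E B u = u ->
  (forall t, 0 <= g t) -> measurable_fun setT g ->
  (\int[mu_for hE u]_t (g t)%:E = \int[mu_for hE u]_(t in B) (g t)%:E)%E.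
Proof.
move=> mB uB g0 mg.
rewrite (@ge0_negligible_integral _ _ _ _ setT (~` B)).
- by rewrite setTD setCK.
- exact: measurableC.
- by [].
- exact/measurable_EFinP.
- by move=> t _; rewrite lee_fin.
- rewrite /= /mu_for -uB -(E_I hE) ?setICl ?(E_set0 hE) ?nr0 ?expr0n//; exact: measurableC.
Qed.

Lemma int_supp_le B u (g : R -> R) c : measurable B -> E B u = u ->
  (forall t, 0 <= g t) -> measurable_fun setT g -> (forall t, B t -> g t <= c) ->
  (\int[mu_for hE u]_t (g t)%:E <= (c * nr u ^+ 2)%:E)%E.
Proof.
move=> mB uB g0 mg gc; rewrite (int_supp mB)//.
have e : (\int[mu_for hE u]_(t in B) (cst c%:E t) = (c * nr u ^+ 2)%:E)%E.
  by rewrite integral_cst// /= /mu_for uB EFinM.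
rewrite -e; apply: ge0_le_integral => //.
- by move=> t _; rewrite lee_fin.
- by apply/measurable_EFinP; apply: measurable_funS mg.
Qed.

Lemma int_supp_ge B u (g : R -> R) c : measurable B -> E B u = u -> 0 <= c ->
  (forall t, 0 <= g t) -> measurable_fun setT g -> (forall t, B t -> c <= g t) ->
  ((c * nr u ^+ 2)%:E <= \int[mu_for hE u]_t (g t)%:E)%E.
Proof.
move=> mB uB c0 g0 mg gc; rewrite (int_supp mB)//.
have e : (\int[mu_for hE u]_(t in B) (cst c%:E t) = (c * nr u ^+ 2)%:E)%E.
  by rewrite integral_cst// /= /mu_for uB EFinM.
rewrite -e; apply: ge0_le_integral => //.
- by apply/measurable_EFinP; apply: measurable_funS mg.
Qed.

Lemma calc_dom_supp B u c : measurable B -> E B u = u -> (forall t, B t -> f t <= c) ->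
  calc_dom E f u.
Proof.
move=> mB uB fc; apply: (calc_dom_int (hE := hE) f0 mf).
have mf2 : measurable_fun setT (fun t => f t ^+ 2) by exact: measurable_funX.
have f20 t : 0 <= f t ^+ 2 by exact: sqr_ge0.
have f2c t : B t -> f t ^+ 2 <= c ^+ 2.
  by move=> Bt; have := fc _ Bt; have := f0 t; nra.
exact: le_lt_trans (int_supp_le mB uB f20 mf2 f2c) (ltry _).
Qed.

Lemma calc_supp_le B u c : measurable B -> E B u = u -> 0 <= c -> (forall t, B t -> f t <= c) ->
  nr (calc E f u) <= c * nr u.
Proof.
move=> mB uB c0 fc.
rewrite -(@ler_pXn2r _ 2)// ?nnegrE ?mulr_ge0 ?nr_ge0// exprMn.
rewrite -lee_fin -(int_f2 hE f0 mf (calc_dom_supp mB uB fc)).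
have mf2 : measurable_fun setT (fun t => f t ^+ 2) by exact: measurable_funX.
have f20 t : 0 <= f t ^+ 2 by exact: sqr_ge0.
have f2c t : B t -> f t ^+ 2 <= c ^+ 2.
  by move=> Bt; have := fc _ Bt; have := f0 t; nra.
exact: int_supp_le mB uB f20 mf2 f2c.
Qed.

Lemma calc_supp_ge B u c d : measurable B -> E B u = u -> 0 <= c ->
  (forall t, B t -> c <= f t) -> (forall t, B t -> f t <= d) ->
  c * nr u <= nr (calc E f u).
Proof.
move=> mB uB c0 fc fd.
rewrite -(@ler_pXn2r _ 2)// ?nnegrE ?mulr_ge0 ?nr_ge0// exprMn.
rewrite -lee_fin -(int_f2 hE f0 mf (calc_dom_supp mB uB fd)).
have mf2 : measurable_fun setT (fun t => f t ^+ 2) by exact: measurable_funX.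
have f20 t : 0 <= f t ^+ 2 by exact: sqr_ge0.
have f2c t : B t -> c ^+ 2 <= f t ^+ 2 by move=> Bt; have := fc _ Bt; nra.
exact: int_supp_ge mB uB (sqr_ge0 _) f20 mf2 f2c.
Qed.

Lemma rip_calc_supp_ge B u c d : measurable B -> E B u = u -> 0 <= c ->
  (forall t, B t -> c <= f t) -> (forall t, B t -> f t <= d) ->
  c * nr u ^+ 2 <= rip (calc E f u) u.
Proof.
move=> mB uB c0 fc fd.
rewrite -lee_fin -(int_f hE f0 mf (calc_dom_supp mB uB fd)).
exact: (int_supp_ge mB uB).
Qed.

(** [f] is bounded on each level set [F n], so each [E (F n) v] lies in the domain, and these
    vectors sum to [E setT v]. *)
Lemma calc_dom_dense : dense (calc_dom E f).
Proof.
apply: cv_dense => v.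
pose F (n : nat) := [set t : R | n%:R <= f t] `&` [set t | f t < n.+1%:R].
have mF n : measurable (F n).
  have m (c : R) : measurable [set t : R | c <= f t].
    by rewrite -[X in measurable X]setTI; apply: (@measurable_fun_le _ _ _ _ (cst c) f).
  have -> : F n = [set t : R | n%:R <= f t] `\` [set t : R | n.+1%:R <= f t].
    apply/seteqP; split=> t [/= h1 h2]; split=> //=; last by rewrite ltNge; apply/negP.
    by apply/negP; rewrite -ltNge.
  exact: measurableD.
have tF : trivIset setT F.
  move=> i j _ _ [t [[/= h1 h2] [/= h3 h4]]].
  have := le_lt_trans h1 h4; have := le_lt_trans h3 h2; rewrite !ltr_nat; lia.
have UF : \bigcup_n F n = setT.
  apply/seteqP; split=> // t _; exists (Num.truncn (f t)) => //.
  by have /andP[] := truncn_itv (f0 t).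
have cF := E_sigma hE v mF tF; rewrite UF in cF.
(* [E setT] need not be the identity. The remainder [v - E setT v] is annihilated by every [E B],
   hence by every [calc_step]. *)
have h0 : calc_dom E f (v - E setT v).
  exists 0 => N; rewrite /calc_step big1 ?nr0// => k _.
  have ml := measurable_greedy_set mf k.
  by rewrite (E_B hE)// -(E_I hE)// setIT subrr scaler0.
have hF n : calc_dom E f (E (F n) v).
  by apply: (@calc_dom_supp (F n) _ n.+1%:R) => //; [rewrite (E_idem hE)|move=> t [_ /= /ltW]].
have [D0 DD] := calc_dom_manifold hE mf.
exists (fun N => (v - E setT v) + \sum_(i < N) E (F i) v); split.
  move=> N; elim: N => [|N IH]; first by rewrite big_ord0 addr0.
  by rewrite big_ord_recr /= addrA addrC -[E _ _]scale1r; apply: DD.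
rewrite -[X in cv _ X](subrK (E setT v)).
by apply: cvD cF; exact: cv_cst.
Qed.

(** Polarization: [p], [q], [r], [s] are the four entries of a sesquilinear form on two vectors, and
    the sum singles out the entry [q]. The unit [i] is abstract so that [ring] treats it as an
    atom. *)
Lemma polar4 (i p q r s : R[i]) : i ^+ 2 = -1 -> conjc i = - i ->
  4%:R^-1 * \sum_(k < 4) i ^+ k *
    (p + conjc (i ^+ k) * q + i ^+ k * r + i ^+ k * conjc (i ^+ k) * s) = q.
Proof.
move=> i2 ci.
have cN (z : R[i]) : conjc (- z) = - conjc z by rewrite rmorphN.
have c1 : conjc (1 : R[i]) = 1 by rewrite conjc1.
have c1' : Complex 1 (- 0) = 1 :> R[i] by rewrite oppr0.
rewrite !big_ord_recr big_ord0 /= add0r expr0 expr1 (exprS i 2) i2 mulrN1 !cN ci c1 !c1'.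
have n4 : (4%:R : R[i]) != 0 by rewrite pnatr_eq0.
apply: (mulfI n4); rewrite mulrA divff// mul1r.
transitivity (2%:R * q + 2%:R * r - i ^+ 2 * (2%:R * q - 2%:R * r)).
  by ring.
by rewrite i2; ring.
Qed.

Lemma pvm_formE u v : calc_dom E f u -> calc_dom E f v -> pvm_form E f u v = ip (calc E f u) v.
Proof.
move=> hu hv; rewrite /pvm_form.
have [D0 DD] := calc_dom_manifold hE mf.
have e (a : R[i]) : ((fine (\int[pvm_measure E (u + a *: v)%R]_t (f t)%:E)%E)%:C) =
   ip (calc E f u) u + (a^*)%C * ip (calc E f u) v + a * ip (calc E f v) u
     + a * (a^*)%C * ip (calc E f v) v.
  have hD : calc_dom E f (u + a *: v) by rewrite addrC; apply: DD.
  rewrite (int_mu hE) (int_f hE f0 mf)//= -(ip_calc hE mf)//.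
  rewrite addrC (calc_lin hE mf)// !ipDl !ipDr !ipZl !ipZr; ring.
under eq_bigr do rewrite e.
by apply: polar4; [rewrite sqr_i|apply/eqP; rewrite eq_complex /= oppr0 !eqxx].
Qed.

Lemma pvm_integral_dom : dom (pvm_integral E f) = calc_dom E f.
Proof.
by apply/seteqP; split=> u; rewrite /= (int_mu hE) => /(calc_domP hE f0 mf).
Qed.

(** [calc E f u] satisfies the weak characterization by polarization, and density of the domain
    leaves [xget] no other choice. *)
Lemma pvm_integralE u : calc_dom E f u -> pvm_integral E f u = calc E f u.
Proof.
move=> hu.
rewrite /pvm_integral /=; set S := [set w | _].
have SW : S (calc E f u).
  move=> v hv; have {}hv : calc_dom E f v by rewrite -pvm_integral_dom.
  by rewrite -[LHS]/(ip _ _) pvm_formE.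
have Sx : S (xget 0 S) := @xgetPex _ 0 S (ex_intro _ _ SW).
apply/subr0_eq/(ortho_dense calc_dom_dense) => v hv.
have /Sx e : dom (pvm_integral E f) v by rewrite pvm_integral_dom.
by rewrite ipBl [X in X - _]e pvm_formE// subrr.
Qed.

End FunCalc2.

(** * Dyadic blocks and coordinates *)

Section Blocks.
Variables (R : realType) (H : hilbertType R).

Definition blk (n : nat) : set R := [set` `[2 ^+ n, 2 ^+ n.+1[].

Record blocks (P : nat -> {linear H -> H}) : Prop := Blocks {
  P_sym : forall n u v, ip (P n u) v = ip u (P n v);
  P_idem : forall n u, P n (P n u) = P n u;
  P_orth : forall m n u, m != n -> P m (P n u) = 0;
  P_le : forall n u, nr (P n u) <= nr u
}.

(** What is retained of an operator [phi(A)]: it commutes with the blocks and is bounded above and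
    below on each of them. [T_cv] records that its range has no part outside the blocks, as [phi] is
    cut off below 1. [T_rip] makes Lax-Milgram available on each block. *)
Record diag (P : nat -> {linear H -> H}) (c C : nat -> R) (T : operator H) : Prop := Diag {
  T_lin : linear_on (dom T) T;
  T_dom : forall n u, dom T (P n u);
  T_comm : forall n u, dom T u -> P n (T u) = T (P n u);
  T_cv : forall u, dom T u -> cv (fun N => \sum_(n < N) P n (T u)) (T u);
  T_c0 : forall n, 0 < c n;
  T_ge : forall n u, c n * nr (P n u) <= nr (T (P n u));
  T_le : forall n u, nr (T (P n u)) <= C n * nr (P n u);
  T_rip : forall n u, c n * nr (P n u) ^+ 2 <= rip (T (P n u)) (P n u)
}.

Lemma measurable_blk n : measurable (blk n). Proof. exact: measurable_itv. Qed.

Lemma blk_disj m n : m != n -> blk m `&` blk n = set0.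
Proof.
move=> mn; apply/seteqP; split=> // t [].
rewrite /blk /= !in_itv /= => /andP[h1 h2] /andP[h3 h4].
have := le_lt_trans h1 h4; have := le_lt_trans h3 h2.
by rewrite !ltr_eXn2l ?ltr1n//; lia.
Qed.

Lemma blk_bigcup : \bigcup_n blk n = [set` `[1, +oo[].
Proof.
apply/seteqP; split=> t.
  move=> [n _]; rewrite /blk /= !in_itv /= andbT => /andP[h _].
  by apply: le_trans h; rewrite exprn_ege1// ler1n.
rewrite /= in_itv /= andbT => t1.
have [n hn] : exists n, t < 2 ^+ n.
  have [n hn] := ex_intro (fun n => t < n%:R) _ (truncnS_gt t).
  by exists n; apply: lt_trans hn _; rewrite -natrX ltr_nat ltn_expl.
elim: n hn => [|n IH] hn; first by move: hn; rewrite expr0 ltNge t1.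
have [h|h] := ltP t (2 ^+ n); first exact: IH.
by exists n => //; rewrite /blk /= in_itv /= h.
Qed.

Lemma subpvm_blocks (E : set R -> H -> H) : subpvm E ->
  exists2 P : nat -> {linear H -> H}, blocks P &
  forall (phi : R -> R) (c C : nat -> R), measurable_fun [set` `[(1 : R), +oo[] phi ->
    (forall n, 0 < c n) ->
    (forall n t, blk n t -> c n <= phi t /\ phi t <= C n) ->
    diag P c C (pvm_integral E (phi \_ `[1, +oo[)).
Proof.
move=> hE.
pose P n : {linear H -> H} := HB.pack (E (blk n))
  (GRing.isLinear.Build _ _ _ _ (E (blk n)) (fun a u v => E_lin hE a u v (measurable_blk n))).
have PE n u : P n u = E (blk n) u by [].
exists P.
  split=> [n u v|n u|m n u mn|n u]; rewrite !PE.
  - exact: (E_sym hE _ _ (measurable_blk n)).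
  - exact: (E_idem hE _ (measurable_blk n)).
  - by rewrite -(E_I hE _ (measurable_blk m) (measurable_blk n)) blk_disj// (E_set0 hE).
  - exact: (E_le hE _ (measurable_blk n)).
move=> phi c C mphi c0 hphi.
have ge1 t : t \in (`[1, +oo[ : set R)%classic -> exists n, blk n t.
  by rewrite inE -blk_bigcup => -[n _ h]; exists n.
pose f := phi \_ `[1, +oo[.
have fphi n t : blk n t -> f t = phi t.
  by move=> bt; rewrite /f patchE ifT// inE -blk_bigcup; exists n.
have f0 t : 0 <= f t.
  rewrite /f patchE; case: ifPn => // /ge1[n bt].
  by apply: le_trans (proj1 (hphi _ _ bt)); exact: ltW.
have mf : measurable_fun setT f.
  by apply/(measurable_restrict _ _ _) => //; rewrite setTI.
have fc n t : blk n t -> c n <= f t by move=> bt; rewrite (fphi _ _ bt); have [] := hphi _ _ bt.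
have fC n t : blk n t -> f t <= C n by move=> bt; rewrite (fphi _ _ bt); have [] := hphi _ _ bt.
have Pidem n u : E (blk n) (P n u) = P n u by rewrite PE (E_idem hE)//; exact: measurable_blk.
have Pdom n u : calc_dom E f (P n u).
  exact: (calc_dom_supp hE f0 mf (measurable_blk n) (Pidem n u) (fC n)).
have domE : dom (pvm_integral E f) = calc_dom E f by exact: pvm_integral_dom.
have TE u : calc_dom E f u -> pvm_integral E f u = calc E f u by exact: pvm_integralE.
have Wlin := calc_linear_on hE mf.
split.
- rewrite domE; split; first exact: (proj1 Wlin).
  move=> a u v hu hv; have [[_ DD] hl] := Wlin.
  by rewrite !TE//; [exact: hl|exact: DD].
- by move=> n u; rewrite domE.
- move=> n u; rewrite domE => hu; rewrite !TE// !PE.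
  by rewrite (calc_E hE mf (measurable_blk n)).
- move=> u; rewrite domE => hu; rewrite TE//.
  have tF : trivIset setT blk.
    move=> i j _ _ [t ht]; apply/eqP/negPn/negP => ij.
    by move: ht; rewrite blk_disj.
  have := E_sigma hE (calc E f u) measurable_blk tF; rewrite blk_bigcup.
  (* All greedy sets lie in [[1, +oo[], because [f] vanishes elsewhere and [harm k] is positive; so
     [E [1, +oo[] fixes the range. *)
  suff -> : E [set` `[1, +oo[] (calc E f u) = calc E f u by [].
  have mO : measurable [set` `[(1 : R), +oo[] by exact: measurable_itv.
  apply: cv_unique (cv_E hE mO (calc_cv hE mf hu)) _.
  apply: cv_ext (calc_cv hE mf hu) => N /=.
  rewrite /calc_step (E_sum hE)//; apply: eq_bigr => k _; rewrite (E_Z hE)//.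
  rewrite -(E_I hE _ mO (measurable_greedy_set mf k)); congr (_ *: E _ u).
  apply/esym/setIidPr => t; rewrite /greedy_set /= => ht.
  have : f t != 0.
    by rewrite gt_eqF//; have := harm_gt0 R k; have := greedy_sum_ge0 f k t; lra.
  by rewrite /f patchE; case: ifPn; rewrite ?eqxx// inE.
- exact: c0.
- move=> n u; rewrite TE//.
  exact: (calc_supp_ge hE f0 mf (measurable_blk n) (Pidem n u) (ltW (c0 n)) (fc n) (fC n)).
- move=> n u; rewrite TE//.
  have C0 : 0 <= C n.
    have b2 : blk n (2 ^+ n).
      by rewrite /blk /= in_itv /= lexx exprS; have := exprn_gt0 n (ltr0n R 2); lra.
    by apply: le_trans (f0 _) (fC _ _ b2).
  exact: (calc_supp_le hE f0 mf (measurable_blk n) (Pidem n u) C0 (fC n)).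
- move=> n u; rewrite TE//.
  exact: (rip_calc_supp_ge hE f0 mf (measurable_blk n) (Pidem n u) (ltW (c0 n)) (fc n) (fC n)).
Qed.

End Blocks.

Lemma linear_on0 (K : pzRingType) (V W : lmodType K) (D : set V) (g : V -> W) :
  linear_on D g -> g 0 = 0.
Proof.
by move=> [[D0 _] h]; have := h (-1) 0 0 D0 D0; rewrite scaler0 addr0 scaleN1r addNr.
Qed.

Lemma linear_on_sum (K : pzRingType) (V W : lmodType K) (D : set V) (g : V -> W)
    (x : nat -> V) N : linear_on D g -> (forall n, D (x n)) ->
  D (\sum_(n < N) x n) /\ g (\sum_(n < N) x n) = \sum_(n < N) g (x n).
Proof.
move=> hg Dx; elim: N => [|N [IH1 IH2]].
  by rewrite !big_ord0; split; [have [[]] := hg|exact: linear_on0 hg].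
rewrite !big_ord_recr /= -IH2; have [[_ DD] h] := hg.
have := DD 1 _ _ IH1 (Dx N); have := h 1 _ _ IH1 (Dx N).
by rewrite !scale1r.
Qed.

(** A tail becomes an initial sum of a truncated family, so that estimates for initial sums apply to
    tails. *)
Lemma sum_tail (V : zmodType) (F : nat -> V) m n : (m <= n)%N ->
  \sum_(i < n) F i - \sum_(i < m) F i = \sum_(i < n) (if (i < m)%N then 0 else F i).
Proof.
move=> mn; rewrite (big_ord_widen n F mn) [X in _ - X]big_mkcond /= -sumrB.
by apply: eq_bigr => i _; case: ifP => _; rewrite ?subrr ?subr0.
Qed.

(** * Block coordinates on a completion *)

Section Coords.
Variables (R : realType) (H : hilbertType R) (P : nat -> {linear H -> H}).
Hypothesis hP : blocks P.

Lemma P_ip m n u v : m != n -> ip (P m u) (P n v) = 0.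
Proof. by move=> mn; rewrite (P_sym hP) (P_orth hP)// ip0r. Qed.

Lemma Q_nr u N : nr (\sum_(n < N) P n u) ^+ 2 = \sum_(n < N) nr (P n u) ^+ 2.
Proof. by apply: (nr_sum_orth (x := fun n => P n u)) => i j ij; exact: P_ip. Qed.

Lemma rip_P n u : rip (P n u) u = nr (P n u) ^+ 2.
Proof. by rewrite -rip_uu {1}/rip /rip -(P_sym hP) (P_idem hP). Qed.

Lemma rip_suml (I : Type) (r : seq I) (F : I -> H) v :
  rip (\sum_(i <- r) F i) v = \sum_(i <- r) rip (F i) v.
Proof. by rewrite /rip ip_suml (big_morph (@complex.Re R) (@ReD R) (erefl : complex.Re 0 = 0)). Qed.

Lemma Q_le u N : nr (\sum_(n < N) P n u) <= nr u.
Proof.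
set q := \sum_(n < N) _.
have h : rip q u = nr q ^+ 2.
  by rewrite Q_nr rip_suml; apply: eq_bigr => n _; rewrite rip_P.
have := rip_le q u; rewrite h.
have [->|n0] := eqVneq (nr q) 0; first by rewrite nr_ge0.
by rewrite expr2 ler_pM2l// lt_def n0 nr_ge0.
Qed.

Lemma cv_linear (V W : normedModType R[i]) (F : {linear V -> W}) (c : R) x l :
  (forall y, nr (F y) <= c * nr y) -> cv x l -> cv (F \o x) (F l).
Proof.
move=> h; apply: (@cv_lip _ _ _ _ _ _ _ c) => n /=; rewrite -linearB; exact: h.
Qed.

(** The partial sums of the [P n] are contractions, uniformly in their length, so strong convergence
    survives limits. *)
Lemma Q_closed (x : nat -> H) l :
  (forall i, cv (fun N => \sum_(n < N) P n (x i)) (x i)) -> cv x l ->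
  cv (fun N => \sum_(n < N) P n l) l.
Proof.
move=> h xl e e0.
have e3 : 0 < e / 3 by rewrite divr_gt0.
have [M hM] := xl _ e3; have {}hM := hM M (leqnn M).
have [N hN] := h M _ e3; exists N => k /hN hk.
set q := \sum_(n < k) P n l; set q' := \sum_(n < k) P n (x M) in hk.
have d : nr (q - q') <= nr (l - x M).
  have -> : q - q' = \sum_(n < k) P n (l - x M).
    by rewrite /q /q' -sumrB; apply: eq_bigr => n _; rewrite linearB.
  exact: Q_le.
have := nrDB q q' l; have := nrDB q' (x M) l; rewrite (nrBC l (x M)) in d; lra.
Qed.

Definition Tsum (T : H -> H) (h : nat -> H) N : R := \sum_(n < N) nr (T (h n)) ^+ 2.

Lemma Tsum_mono T h m n : (m <= n)%N -> Tsum T h m <= Tsum T h n.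
Proof.
move=> mn; rewrite /Tsum -!(big_mkord xpredT (fun n => nr (T (h n)) ^+ 2)).
rewrite [leRHS](big_cat_nat _ (n := m))//= lerDl; apply: sumr_ge0 => i _; exact: sqr_ge0.
Qed.

Lemma Tsum_ge0 T h n : 0 <= Tsum T h n.
Proof. by apply: sumr_ge0 => i _; exact: sqr_ge0. Qed.

(** The completion seen as an l^2 direct sum of the blocks, block [n] being normed by [|T h|].
    Parseval's identity is split into two inequalities on partial sums, so that no infinite sum
    occurs; [p_synth] is the Riesz-Fischer property. *)
Record coords (T : operator H) (Y : hilbertType R) (k : H -> Y)
    (p : nat -> {linear Y -> H}) : Prop := Coords {
  p_k : forall n u, dom T u -> p n (k u) = P n u;
  p_P : forall n y, P n (p n y) = p n y;
  p_bd : exists b : nat -> R, forall n y, nr (p n y) <= b n * nr y;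
  p_bessel : forall y N, Tsum T (fun n => p n y) N <= nr y ^+ 2;
  p_parseval : forall y B, (forall N, Tsum T (fun n => p n y) N <= B) -> nr y ^+ 2 <= B;
  p_synth : forall (h : nat -> H) B, (forall n, P n (h n) = h n) ->
    (forall N, Tsum T h N <= B) -> exists2 y, forall n, p n y = h n & nr y ^+ 2 <= B
}.

Section Completion.
Variables (c C : nat -> R) (T : operator H).
Hypothesis hT : diag P c C T.

Lemma TP_lin n : linear (fun u => T (P n u)).
Proof.
move=> a u v; rewrite linearP; have [_ h] := T_lin hT.
by apply: h; exact: T_dom hT _ _.
Qed.

Definition TP n : {linear H -> H} :=
  HB.pack (fun u => T (P n u)) (GRing.isLinear.Build _ _ _ _ (fun u => T (P n u)) (@TP_lin n)).

Lemma TP_le n u : nr (TP n u) <= `|C n| * nr u.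
Proof.
apply: le_trans (T_le hT n u) _.
apply: le_trans (ler_wpM2r (nr_ge0 _) (ler_norm (C n))) _.
by apply: ler_wpM2l => //; exact: P_le hP _ _.
Qed.

Lemma P_TP n u : P n (T (P n u)) = T (P n u).
Proof. by rewrite (T_comm hT n (T_dom hT n u)) (P_idem hP). Qed.

Lemma T_inj n u : P n u = u -> T u = 0 -> u = 0.
Proof.
move=> hu Tu; have := T_ge hT n u; rewrite hu Tu nr0 pmulr_rle0 ?(T_c0 hT)//.
by move=> h; apply: nr_eq0; apply/eqP; rewrite eq_le h nr_ge0.
Qed.

Lemma Tsum_vec (h : nat -> H) N : (forall n, P n (h n) = h n) ->
  nr (\sum_(n < N) T (h n)) ^+ 2 = Tsum T h N.
Proof.
move=> hh; apply: (nr_sum_orth (x := fun n => T (h n))) => i j ij.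
by rewrite -(hh i) -(hh j) -(P_TP i) -(P_TP j) P_ip.
Qed.

(* Lax-Milgram for [T] on the range of [P n], extended by the identity. *)
Lemma T_surj n g : P n g = g -> exists2 v, P n v = v & T v = g.
Proof.
move=> hg.
have Bl : linear (fun v => TP n v + (v - P n v)).
  move=> a u v /=; rewrite (TP_lin n a u v) (linearP (P n)) /= opprD.
  by rewrite [a *: u + v + _]addrACA [LHS]addrACA -scalerBr -scalerDr.
pose B : {linear H -> H} := HB.pack (fun v => TP n v + (v - P n v))
  (GRing.isLinear.Build _ _ _ _ (fun v => TP n v + (v - P n v)) Bl).
have BE v : B v = T (P n v) + (v - P n v) by [].
have c0 := T_c0 hT n.
have [//|v|v|v hv] := @lax_milgram _ _ B (Num.min (c n) 1) (`|C n| + 2) _ _ _ g.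
- by rewrite lt_min c0 ltr01.
- rewrite BE; apply: le_trans (nrD _ _) _.
  have h1 := TP_le n v; have h2 := P_le hP n v; have h3 := nrB v (P n v).
  rewrite mulrDl; apply: lerD => //; lra.
- have hv : ip (P n v) (v - P n v) = 0.
    by rewrite ipBr [X in _ - X](P_sym hP) (P_idem hP) -(P_sym hP) subrr.
  have e1 : rip (B v) v = rip (T (P n v)) (P n v) + nr (v - P n v) ^+ 2.
    rewrite BE ripDl; congr (_ + _).
      by rewrite -{1}P_TP /rip (P_sym hP).
    rewrite -{3}[v](subrK (P n v)) ripDr rip_uu [X in _ + X](_ : _ = 0) ?addr0//.
    by rewrite ripC /rip hv.
  have e2 : nr v ^+ 2 = nr (P n v) ^+ 2 + nr (v - P n v) ^+ 2.
    by rewrite -pythagoras// addrC subrK.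
  have h3 := T_rip hT n v.
  have m1 : Num.min (c n) 1 <= c n by rewrite ge_min lexx.
  have m2 : Num.min (c n) 1 <= 1 by rewrite ge_min lexx orbT.
  rewrite e1 e2; have := sqr_ge0 (nr (P n v)); have := sqr_ge0 (nr (v - P n v)); nra.
exists (P n v); first by rewrite (P_idem hP).
have := congr1 (P n) hv; rewrite BE linearD linearB /= (P_idem hP) subrr addr0 P_TP => ->.
exact: hg.
Qed.

Variables (Y : hilbertType R) (k : H -> Y).
Hypothesis hk : is_completion T k.

Let k_lin : linear_on (dom T) k. Proof. by have [] := hk. Qed.
Let k_nr u : dom T u -> nr (k u) = nr (T u).
Proof. by have [_ h _] := hk => hu; rewrite /nr h. Qed.
Let k_dense : dense (k @` dom T). Proof. by have [] := hk. Qed.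

Lemma dense_k y : exists u : nat -> H, (forall n, dom T (u n)) /\ cv (k \o u) y.
Proof.
have [x [hx xy]] := dense_cv y k_dense.
have /choice[u hu] : forall n, exists u, dom T u /\ k u = x n.
  by move=> n; have [u Du <-] := hx n; exists u.
exists u; split=> [n|]; first by have [] := hu n.
by apply: cv_ext xy => n /=; have [] := hu n.
Qed.

Lemma completion_coords : exists p, coords T k p.
Proof.
(* [J] extends [k u |-> T u] and embeds [Y] isometrically into [H]. *)
have [|J [Jk J1]] := @extension _ _ _ _ (dom T) k (T : H -> H) 1 k_lin (T_lin hT) k_dense.
  by move=> u hu; rewrite mul1r k_nr.
have Jcv x l : cv x l -> cv (J \o x) (J l) by apply: cv_linear J1.
have Jnr y : nr (J y) = nr y.
  have [u [Du uy]] := dense_k y.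
  apply/eqP; rewrite eq_le; apply/andP; split; first by have := J1 y; rewrite mul1r.
  apply/ler_addgt0Pr => e e0; have e2 : 0 < e / 2 by rewrite divr_gt0.
  have [N hN] := uy _ e2; have [M hM] := Jcv _ _ uy _ e2.
  have := hN _ (leq_maxl N M); have := hM _ (leq_maxr N M) => /=.
  set m := maxn N M; rewrite Jk//.
  have := nr_tri (T (u m)) (J y); have := nr_tri y (k (u m)); rewrite (nrBC y) [nr (k _)]k_nr//; lra.
have JQ y : cv (fun N => \sum_(n < N) P n (J y)) (J y).
  have [u [Du uy]] := dense_k y.
  apply: Q_closed (Jcv _ _ uy) => i /=; rewrite Jk//; exact: (T_cv hT).
pose b n := (c n)^-1.
(* The bound is [c n |P n u| <= |T (P n u)| = |P n (T u)| <= |k u|]. *)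
have /choice[p hp] : forall n, exists F : {linear Y -> H},
    (forall u, dom T u -> F (k u) = P n u) /\ forall y, nr (F y) <= b n * nr y.
  move=> n; apply: extension => //.
    by split=> [|a u v _ _]; [have [] := k_lin|rewrite linearP].
  move=> u hu; rewrite /b k_nr// ler_pdivlMl ?(T_c0 hT)//.
  by apply: le_trans (T_ge hT n u) _; rewrite -(T_comm hT)//; exact: P_le hP _ _.
have pk n u : dom T u -> p n (k u) = P n u by have [h _] := hp n; exact: h.
have pb n y : nr (p n y) <= b n * nr y by have [_] := hp n; apply.
have pcv n x l : cv x l -> cv (p n \o x) (p n l) by apply: cv_linear (pb n).
have Pcv n x l : cv x l -> cv (P n \o x) (P n l).
  by apply: (@cv_linear _ _ _ 1) => y; rewrite mul1r; exact: P_le hP _ _.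
have pP n y : P n (p n y) = p n y.
  have [u [Du uy]] := dense_k y.
  apply: cv_unique (Pcv n _ _ (pcv n _ _ uy)) _.
  by apply: cv_ext (pcv n _ _ uy) => i /=; rewrite pk// (P_idem hP).
have PJ n y : P n (J y) = T (p n y).
  have [u [Du uy]] := dense_k y.
  apply: cv_unique (Pcv n _ _ (Jcv _ _ uy)) _; rewrite -[p n y]pP.
  apply: cv_ext (cv_linear (TP_le n) (pcv n _ _ uy)) => i /=.
  by rewrite pk// Jk// (P_idem hP) (T_comm hT).
have QJ y N : nr (\sum_(n < N) P n (J y)) ^+ 2 = Tsum T (fun n => p n y) N.
  by rewrite Q_nr /Tsum; apply: eq_bigr => n _; rewrite PJ.
have parseval y B : (forall N, Tsum T (fun n => p n y) N <= B) -> nr y ^+ 2 <= B.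
  move=> hB.
  have B0 : 0 <= B by apply: le_trans (hB 0%N); exact: Tsum_ge0.
  rewrite -Jnr -(sqr_sqrtr B0) lerXn2r ?nnegrE ?nr_ge0 ?sqrtr_ge0//.
  apply: (@cv_nr_le _ _ _ _ _ 0%N) (JQ y) => N _.
  rewrite -(@ler_pXn2r _ 2) ?nnegrE ?nr_ge0 ?sqrtr_ge0// QJ sqr_sqrtr//.
exists p; split=> //.
- by exists b.
- move=> y N; rewrite -QJ -Jnr lerXn2r ?nnegrE ?nr_ge0//; exact: Q_le.
- move=> h B hh hB.
  have Dh n : dom T (h n) by rewrite -hh; exact: T_dom hT _ _.
  pose y N := k (\sum_(n < N) h n).
  have py m N : p m (y N) = if (m < N)%N then h m else 0.
    rewrite /y pk; last by have [] := linear_on_sum N (T_lin hT) Dh.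
    rewrite linear_sum; case: ltnP => mN.
      rewrite (bigD1 (Ordinal mN))//= hh big1 ?addr0// => i im.
      by rewrite -hh (P_orth hP)// eq_sym.
    by rewrite big1// => i _; rewrite -hh (P_orth hP)// gtn_eqF// (leq_trans (ltn_ord i)).
  have dy m n : (m <= n)%N -> nr (y n - y m) ^+ 2 = Tsum T h n - Tsum T h m.
    move=> mn; have [Dn _] := linear_on_sum n (T_lin hT) Dh; have [Dm' _] := linear_on_sum m (T_lin hT) Dh.
    have [Dnm e] := linear_onB k_lin Dn Dm'; rewrite /y -e k_nr//.
    pose h' i := if (i < m)%N then 0 else h i.
    have hh' i : P i (h' i) = h' i by rewrite /h'; case: ifP; rewrite ?linear0.
    have Dh' i : dom T (h' i) by rewrite -hh'; exact: T_dom hT _ _.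
    rewrite sum_tail// -[X in T X]/(\sum_(i < n) h' i).
    have [_ ->] := linear_on_sum n (T_lin hT) Dh'.
    rewrite Tsum_vec// /Tsum (sum_tail (fun n => nr (T (h n)) ^+ 2))//.
    apply: eq_bigr => i _; rewrite /h'; case: ifP => // _.
    by rewrite (linear_on0 (T_lin hT)) nr0 expr0n.
  have [l hl] : exists l, cv y l.
    apply: cv_complete => e e0.
    have [N hN] := mono_cauchy (@Tsum_mono T h) hB (exprn_gt0 2 e0).
    exists N => m n Nm mn.
    by rewrite -(@ltr_pXn2r _ 2)// ?nnegrE ?nr_ge0 ?(ltW e0)// dy// hN.
  have pl n : p n l = h n.
    apply: cv_unique (pcv n _ _ hl) _ => e e0; exists n.+1 => m nm /=.
    by rewrite py nm subrr nr0.
  exists l => //; apply: parseval => N.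
  by rewrite (_ : Tsum _ _ _ = Tsum T h N)//; apply: eq_bigr => n _; rewrite pl.
Qed.

End Completion.
End Coords.

(** * Realizing completions inside the largest space *)

Section Scale.
Variables (R : realType) (H : hilbertType R) (P : nat -> {linear H -> H}).
Hypothesis hP : blocks P.
Variables (c0 C0 : nat -> R) (TK : operator H) (K : hilbertType R) (j : H -> K)
  (p : nat -> {linear K -> H}).
Hypotheses (hTK : diag P c0 C0 TK) (hj : is_completion TK j) (hp : coords P TK j p).

Lemma coords_inj (T : operator H) c C (Y : hilbertType R) (k : H -> Y) q x y :
  diag P c C T -> coords P T k q -> (forall n, q n x = q n y) -> x = y.
Proof.
move=> hT hq e; apply/subr0_eq/nr_eq0/eqP; rewrite -sqrf_eq0 eq_le sqr_ge0 andbT.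
apply: (p_parseval hq) => N; rewrite /Tsum big1// => n _.
by rewrite linearB e subrr (linear_on0 (T_lin hT)) nr0 expr0n.
Qed.

Lemma Tsum_eq (T T' : H -> H) h h' N :
  (forall n, (n < N)%N -> T (h n) = T' (h' n)) -> Tsum T h N = Tsum T' h' N.
Proof. by move=> e; apply: eq_bigr => n _; rewrite e. Qed.

Lemma nr_T_lim (T : operator H) c C u (B : R) : diag P c C T -> dom T u -> (forall N, Tsum T (fun n => P n u) N <= B) ->
  nr (T u) ^+ 2 <= B.
Proof.
move=> hT hu hB; have B0 : 0 <= B by apply: le_trans (hB 0%N); exact: Tsum_ge0.
rewrite -(sqr_sqrtr B0) lerXn2r ?nnegrE ?nr_ge0 ?sqrtr_ge0//.
apply: (@cv_nr_le _ _ _ _ _ 0%N) (T_cv hT hu) => N _.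
rewrite -(@ler_pXn2r _ 2) ?nnegrE ?nr_ge0 ?sqrtr_ge0// sqr_sqrtr// (Q_nr hP).
apply: le_trans (hB N); rewrite le_eqVlt; apply/orP; left; apply/eqP.
by apply: eq_bigr => n _; rewrite (T_comm hT).
Qed.

Lemma T_bessel (T : operator H) c C u N : diag P c C T -> dom T u -> Tsum T (fun n => P n u) N <= nr (T u) ^+ 2.
Proof.
move=> hT hu; have -> : Tsum T (fun n => P n u) N = \sum_(n < N) nr (P n (T u)) ^+ 2.
  by apply: eq_bigr => n _; rewrite (T_comm hT).
by rewrite -(Q_nr hP) lerXn2r ?nnegrE ?nr_ge0//; exact: Q_le.
Qed.

Section Exists.
Variables (c C : nat -> R) (T : operator H) (M : R).
Hypotheses (hT : diag P c C T) (TTK : forall u, dom T u -> dom TK u)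
  (M0 : 0 <= M) (cC : forall n, C0 n <= M * c n).

(* [K] itself will carry H^phi_A: [k u] is the element of [K] whose coordinates
   solve [TK (p n (k u)) = T (P n u)], and the inclusion extends [k u |-> j u]. *)
Lemma carrier_map : exists k : H -> K, forall u, dom T u -> forall n, TK (p n (k u)) = T (P n u).
Proof.
have h u : exists y, dom T u -> forall n, TK (p n y) = T (P n u).
  have [hu|hu] := pselect (dom T u); last by exists 0.
  have /choice[h hh] : forall n, exists v, P n v = v /\ TK v = T (P n u).
    move=> n; have [|v h1 h2] := T_surj hP hTK (n := n) (g := T (P n u)).
      exact: (P_TP hP hT).
    by exists v.
  have [|N|y hy _] := p_synth hp (h := h) (B := nr (T u) ^+ 2).
  - by move=> n; have [] := hh n.
  - rewrite (@Tsum_eq _ T _ (fun n => P n u)); first exact: (T_bessel _ hT).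
    by move=> n _; have [] := hh n.
  - by exists y => _ n; rewrite hy; have [] := hh n.
by have [k hk] := choice h; exists k.
Qed.

Lemma TKB n x y : TK (p n (x - y)) = TK (p n x) - TK (p n y).
Proof.
rewrite -[in LHS](p_P hp) linearB.
by have := TP_lin hTK n (-1) (p n y) (p n x); rewrite !scaleN1r !(p_P hp) ![- _ + _]addrC.
Qed.

Lemma TK_inj x y : (forall n, TK (p n x) = TK (p n y)) -> x = y.
Proof.
move=> e; apply: (coords_inj hTK hp) => n; apply/subr0_eq; rewrite -linearB.
by apply: (T_inj hTK (p_P hp n (x - y))); rewrite TKB e subrr.
Qed.

Lemma hphi_carrier : exists (k : H -> K) (F : {linear K -> K}),
  [/\ is_completion T k, injective F, forall x, nr (F x) <= M * nr x &
      forall u, dom T u -> F (k u) = j u].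
Proof.
have [k hk] := carrier_map.
have TPl n a u v : T (P n (a *: u + v)) = a *: T (P n u) + T (P n v) by exact: (TP_lin hT).
have TKl n a x y : TK (p n (a *: x + y)) = a *: TK (p n x) + TK (p n y).
  have := TP_lin hTK n a (p n x) (p n y).
  by rewrite -linearP !(p_P hp).
have klin : linear_on (dom T) k.
  split=> [|a u v hu hv]; first by have [] := T_lin hT.
  have [[_ DD] _] := T_lin hT.
  by apply: TK_inj => n; rewrite hk ?TKl ?hk ?TPl//; exact: DD.
have ks u N : dom T u -> Tsum TK (fun n => p n (k u)) N = Tsum T (fun n => P n u) N.
  by move=> hu; apply: Tsum_eq => n _; rewrite hk.
have knr u : dom T u -> nr (k u) = nr (T u).
  move=> hu; apply/eqP; rewrite -(@eqrXn2 _ 2) ?nr_ge0// eq_le; apply/andP; split.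
    by apply: (p_parseval hp) => N; rewrite ks//; exact: (T_bessel _ hT).
  by apply: (nr_T_lim hT) => // N; rewrite -ks//; exact: (p_bessel hp).
have kdense : dense (k @` dom T).
  apply: cv_dense => x.
  (* [g n] is the block vector that [T] sends to [TK (p n x)]; finite sums of these lie in [dom T],
     and their images under [k] tend to [x]. *)
  have /choice[g hg] : forall n, exists v, P n v = v /\ T v = TK (p n x).
    move=> n; have [|v h1 h2] := T_surj hP hT (n := n) (g := TK (p n x)).
      by rewrite -{1}(p_P hp) (P_TP hP hTK) (p_P hp).
    by exists v.
  have gP n : P n (g n) = g n by have [] := hg n.
  have gT n : T (g n) = TK (p n x) by have [] := hg n.
  have Dg n : dom T (g n) by rewrite -gP; exact: T_dom hT _ _.
  have Ds N : dom T (\sum_(n < N) g n) by have [] := linear_on_sum N (T_lin hT) Dg.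
  exists (fun N => k (\sum_(n < N) g n)); split; first by move=> N; exists (\sum_(n < N) g n).
  have Pg n N : P n (\sum_(i < N) g i) = if (n < N)%N then g n else 0.
    rewrite linear_sum; case: ltnP => nN.
      rewrite (bigD1 (Ordinal nN))//= gP big1 ?addr0// => i im.
      by rewrite -gP (P_orth hP)// eq_sym.
    by rewrite big1// => i _; rewrite -gP (P_orth hP)// gtn_eqF// (leq_trans (ltn_ord i)).
  have bd N : Tsum TK (fun n => p n x) N <= nr x ^+ 2 by exact: (p_bessel hp).
  move=> e e0; have e2 : 0 < e / 2 by rewrite divr_gt0.
  have [N hN] := mono_cauchy (@Tsum_mono _ _ TK (fun n => p n x)) bd (exprn_gt0 2 e2).
  exists N => m Nm.
  suff h : nr (k (\sum_(n < m) g n) - x) ^+ 2 <= (e / 2) ^+ 2.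
    apply: (@le_lt_trans _ _ (e / 2)); last by lra.
    by rewrite -(@ler_pXn2r _ 2)// ?nnegrE ?nr_ge0// ltW.
  apply: (p_parseval hp) => N'.
  pose M' := maxn N' m; have mM : (m <= M')%N := leq_maxr _ _.
  apply: le_trans (@Tsum_mono _ _ TK _ N' M' (leq_maxl _ _)) _.
  apply: ltW; apply: le_lt_trans (hN m M' Nm mM).
  rewrite /Tsum (sum_tail (fun n => nr (TK (p n x)) ^+ 2))// le_eqVlt; apply/orP; left.
  apply/eqP/eq_bigr => i _; rewrite TKB hk// Pg; case: ifP => _.
    by rewrite gT subrr nr0 expr0n.
  by rewrite (linear_on0 (T_lin hT)) sub0r nrN.
have jk u : dom T u -> nr (j u) <= M * nr (k u).
  move=> hu; have -> : nr (j u) = nr (TK u) by have [_ h _] := hj; rewrite /nr h//; exact: TTK.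
  rewrite knr// -(@ler_pXn2r _ 2)// ?nnegrE ?mulr_ge0 ?nr_ge0// exprMn.
  apply: (nr_T_lim hTK (TTK hu)) => N.
  apply: (@le_trans _ _ (M ^+ 2 * Tsum T (fun n => P n u) N)); last first.
    by apply: ler_wpM2l; [exact: sqr_ge0|exact: (T_bessel _ hT)].
  rewrite /Tsum mulr_sumr; apply: ler_sum => n _; rewrite -exprMn lerXn2r ?nnegrE ?mulr_ge0 ?nr_ge0//.
  apply: le_trans (T_le hTK n u) _; apply: le_trans (ler_wpM2r (nr_ge0 _) (cC n)) _.
  by rewrite -mulrA; apply: ler_wpM2l => //; exact: (T_ge hT).
have jlin : linear_on (dom T) j.
  split=> [|a u v hu hv]; first by have [] := T_lin hT.
  by have [[_ hl] _ _] := hj; apply: hl; exact: TTK.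
have [F [Fk Fb]] := extension klin jlin kdense jk.
exists k, F; split=> //.
  split=> // u hu; by rewrite !nrE knr.
(* On the range of [k] this is the defining property of [k], and both sides are continuous in [x].
   It lets the injectivity of [F] follow from [TK_inj]. *)
have FE n x : T (P n (p n (F x))) = TK (p n x).
  have [y [hy yx]] := dense_cv x kdense.
  have [b pb] := p_bd hp.
  have pcv x' l : cv x' l -> cv (p n \o x') (p n l) by apply: cv_linear (pb n).
  have h1 := cv_linear (TP_le hP hT n) (pcv _ _ (cv_linear Fb yx)).
  have h2 := cv_linear (TP_le hP hTK n) (pcv _ _ yx).
  rewrite -(p_P hp n x); apply: cv_unique h1 _; apply: cv_ext h2 => i /=.
  have [u hu <-] := hy i.
  by rewrite (p_P hp) hk// Fk// (p_k hp)//; [rewrite (P_idem hP)|exact: TTK].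
by move=> x y e; apply: TK_inj => n; rewrite -!FE e.
Qed.

End Exists.

Section Given.
Variables (c C : nat -> R) (T : operator H) (Y : hilbert_manifold K) (k : H -> Y).
Hypotheses (hT : diag P c C T) (TTK : forall u, dom T u -> dom TK u)
  (Yc : continuous (incl Y)) (hk : is_completion T k)
  (ik : forall u, dom T u -> incl Y (k u) = j u).

Lemma cv_incl (x : nat -> Y) l : cv x l -> cv (incl Y \o x) (incl Y l).
Proof. by move=> /cvg_cv h; apply: cv_cvg; apply: cvg_comp h _; exact: Yc. Qed.

Lemma manifold_coords : exists2 q, coords P T k q & forall n y, q n y = p n (incl Y y).
Proof.
have [q hq] := completion_coords hP hT hk; exists q => // n y.
have [u [Du uy]] := dense_k hk y.
have [b pb] := p_bd hp; have [b' qb] := p_bd hq.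
have h1 := cv_linear (qb n) uy.
have h2 := cv_linear (pb n) (cv_incl uy).
apply: cv_unique h1 _; apply: cv_ext h2 => i /=.
by rewrite ik// (p_k hq)// (p_k hp)//; exact: TTK.
Qed.
End Given.
End Scale.

(** * Weights in the class OR *)

Section OR.
Variable R : realType.

(** Iterating the defining inequality until [a ^+ k >= 2] replaces the unknown [a] by 2, the ratio
    of the dyadic blocks. *)
Lemma OR_doubling (phi : R -> R) : class_OR phi -> exists2 M : R, 1 <= M &
  forall t l, 1 <= t -> 1 <= l -> l <= 2 -> phi (l * t) <= M * phi t /\ phi t <= M * phi (l * t).
Proof.
move=> [_ phi0 [a [c [a1 c1 hac]]]].
have base t l : 1 <= t -> 1 <= l -> l <= a -> phi (l * t) <= c * phi t /\ phi t <= c * phi (l * t).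
  move=> t1 l1 la; have [] := hac t l t1 l1 la; have p := phi0 _ t1.
  have c0 : 0 < c by lra.
  by rewrite ler_pdivlMr// ler_pdivrMr// ler_pdivrMl// => h1 h2.
have it k : forall t l, 1 <= t -> 1 <= l -> l <= a ^+ k ->
    phi (l * t) <= c ^+ k * phi t /\ phi t <= c ^+ k * phi (l * t).
  elim: k => [|k IH] t l t1 l1.
    rewrite !expr0 !mul1r => l1'; have -> : l = 1 by apply/eqP; rewrite eq_le l1 l1'.
    by rewrite mul1r.
  move=> lk; have ck : 1 <= c ^+ k by rewrite exprn_ege1.
  have pt := phi0 _ t1; have lt1 : 1 <= l * t by nra.
  have plt := phi0 _ lt1.
  have [la|la] := leP l a.
    have [h1 h2] := base t l t1 l1 la; rewrite exprS.
    have c0 : 0 < c by lra.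
    by split; [apply: le_trans h1 _|apply: le_trans h2 _];
      rewrite -mulrA ler_pM2l// ler_peMl// ltW.
  have a0 : 0 < a by lra.
  have m1 : 1 <= l / a by rewrite ler_pdivlMr// mul1r ltW.
  have mk : l / a <= a ^+ k by rewrite ler_pdivrMr// -exprSr.
  have [h1 h2] := IH t (l / a) t1 m1 mk.
  have mt1 : 1 <= l / a * t by nra.
  have [h3 h4] := base (l / a * t) a mt1 (ltW a1) (lexx a).
  have e : a * (l / a * t) = l * t by field; lra.
  rewrite e in h3 h4; have c0 : 0 < c by lra.
  rewrite exprS; split.
    by apply: le_trans h3 _; rewrite -[c * _ * _]mulrA ler_pM2l.
  apply: le_trans h2 _; rewrite [c * _]mulrC -[_ * c * _]mulrA ler_pM2l//; lra.
have [k hk] : exists k, 2 <= a ^+ k.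
  have e0 : 0 < a - 1 by lra.
  have [k hk] := ex_intro (fun n => (a - 1)^-1 < n%:R) _ (truncnS_gt (a - 1)^-1).
  exists k.
  (* Bernoulli's inequality. *)
  have : 1 + (a - 1) *+ k <= a ^+ k.
    elim: k {hk} => [|k IH]; first by rewrite mulr0n addr0 expr0.
    have : 1 <= a ^+ k by rewrite exprn_ege1 ?ltW.
    by rewrite exprS mulrS; nra.
  move: hk; rewrite -mulr_natr -(ltr_pM2l e0) divff ?gt_eqF//; lra.
exists (c ^+ k); first by rewrite exprn_ege1.
move=> t l t1 l1 l2; apply: it => //; exact: le_trans hk.
Qed.

(** An OR weight decays at most geometrically in the block index, while [chi (2 ^+ n)] decays faster
    than any geometric sequence; this places every [H^phi_A] inside [H^chi_A]. With [r <= 2 ^+ p],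
    the constant [p ^ p] comes from raising [y / p <= expR (y / p)] to the power [p] at
    [y = 2 ^+ n]. *)
Lemma pow_le_exp (r : R) : 1 <= r -> exists2 B : R, 0 < B & forall n, r ^+ n <= B * expR (2 ^+ n).
Proof.
move=> r1.
have [p hp] := ex_intro (fun n => r < n%:R) _ (truncnS_gt r).
have p0 : (0 < p)%N by case: p hp => // /lt_trans; move/(_ 1 ltr01) => h; lra.
have rp : r <= 2 ^+ p by apply/ltW/(lt_trans hp); rewrite -natrX ltr_nat ltn_expl.
have pr0 : 0 < (p%:R : R) by rewrite ltr0n.
exists (p%:R ^+ p); first by rewrite exprn_gt0.
move=> n; apply: (@le_trans _ _ ((2 ^+ n) ^+ p)).
  by rewrite -exprM mulnC exprM lerXn2r ?nnegrE ?exprn_ge0// (le_trans ler01).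
have -> : expR (2 ^+ n) = expR (2 ^+ n / p%:R) ^+ p :> R.
  by rewrite -expRM_natr divfK ?gt_eqF.
rewrite -exprMn lerXn2r ?nnegrE ?exprn_ge0 ?mulr_ge0 ?expR_ge0 ?ler0n//.
rewrite -ler_pdivrMl// mulrC; have := expR_ge1Dx (2 ^+ n / p%:R : R); lra.
Qed.

End OR.

(** * Spaces of class OR as weighted sequence spaces *)

Section Setup.
Variables (R : realType) (H K : hilbertType R).
Variables (P : nat -> {linear H -> H}) (p : nat -> {linear K -> H}).

Definition weighted_sum (w : nat -> R) (h : nat -> H) N : R := \sum_(n < N) (w n * nr (h n)) ^+ 2.

(* [Y] consists of the elements of [K] whose coordinates lie in the weighted
   [l^2] space with weight [w], with an equivalent norm. *)
Definition wspace (w : nat -> R) (Y : hilbert_manifold K) : Prop :=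
  exists B : R, [/\ 0 <= B,
    forall y N, weighted_sum w (fun n => p n (incl Y y)) N <= (B * nr y) ^+ 2 &
    forall h m, 0 <= m -> (forall n, P n (h n) = h n) -> (forall N, weighted_sum w h N <= m ^+ 2) ->
      exists2 y, forall n, p n (incl Y y) = h n & nr y <= B * m].

Definition dyadic (phi : R -> R) (n : nat) : R := phi (2 ^+ n).

Lemma wspace_hphi (TK T : operator H) (j : H -> K) c0 C0 M w (Y : hilbert_manifold K) (k : H -> Y) :
  blocks P -> diag P c0 C0 TK -> coords P TK j p -> is_completion TK j ->
  1 <= M -> diag P (fun n => M^-1 * w n) (fun n => M * w n) T ->
  (forall u, dom T u -> dom TK u) -> continuous (incl Y) -> is_completion T k ->
  (forall u, dom T u -> incl Y (k u) = j u) -> wspace w Y.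
Proof.
move=> hP hTK hp hj M1 hT TTK Yc hk ik.
have [q hq qp] := manifold_coords hP hp hT TTK Yc hk ik.
have M0 : 0 < M by lra.
have w0 n : 0 < w n by have := T_c0 hT n; rewrite pmulr_rgt0// invr_gt0.
exists M; split; first exact: ltW.
- move=> y N; rewrite exprMn.
  apply: (@le_trans _ _ (M ^+ 2 * Tsum T (fun n => q n y) N)); last first.
    by rewrite ler_pM2l ?exprn_gt0//; exact: (p_bessel hq).
  rewrite /weighted_sum /Tsum mulr_sumr; apply: ler_sum => n _; rewrite -exprMn.
  rewrite lerXn2r ?nnegrE ?mulr_ge0 ?nr_ge0 ?(ltW (w0 n)) ?(ltW M0)// -qp.
  by have := T_ge hT n (q n y); rewrite (p_P hq) -mulrA ler_pdivrMl.
- move=> h m m0 hh hm.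
  have [//|N|y hy ym] := p_synth hq (h := h) (B := (M * m) ^+ 2).
    apply: (@le_trans _ _ (M ^+ 2 * weighted_sum w h N)); last first.
      by rewrite exprMn ler_pM2l ?exprn_gt0//.
    rewrite /weighted_sum /Tsum mulr_sumr; apply: ler_sum => n _; rewrite -exprMn.
    rewrite lerXn2r ?nnegrE ?mulr_ge0 ?nr_ge0 ?(ltW (w0 n)) ?(ltW M0)//.
    by have := T_le hT n (h n); rewrite hh -mulrA.
  exists y; first by move=> n; rewrite -qp hy.
  by move: ym; rewrite ler_pXn2r ?nnegrE ?nr_ge0 ?mulr_ge0 ?(ltW M0).
Qed.

End Setup.

Section Setup.
Variables (R : realType) (H K : hilbertType R).

Lemma blk_pow n : @blk R n (2 ^+ n).
Proof. by rewrite /blk /= in_itv /= lexx exprS; have := exprn_gt0 n (ltr0n R 2); lra. Qed.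

Lemma OR_block (phi : R -> R) : class_OR phi -> exists2 M : R, 1 <= M &
  forall n t, @blk R n t -> M^-1 * dyadic phi n <= phi t /\ phi t <= M * dyadic phi n.
Proof.
move=> hphi; have [M M1 hM] := OR_doubling hphi; exists M => // n t.
rewrite /blk /= in_itv /= => /andP[h1 h2].
have p0 : 0 < 2 ^+ n :> R by rewrite exprn_gt0.
have p1 : 1 <= 2 ^+ n :> R by rewrite exprn_ege1// ler1n.
have [||h3 h4] := hM (2 ^+ n) (t / 2 ^+ n) p1.
- by rewrite ler_pdivlMr// mul1r.
- by rewrite ler_pdivrMr// -exprS ltW.
rewrite divfK ?gt_eqF// in h3 h4.
by rewrite ler_pdivrMl//; lra.
Qed.

Lemma OR_ratio (phi : R -> R) : class_OR phi -> exists2 r : R, 1 <= r &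
  forall n, [/\ 0 < dyadic phi n, dyadic phi n.+1 <= r * dyadic phi n &
    dyadic phi n <= r * dyadic phi n.+1].
Proof.
move=> hphi; have [M M1 hM] := OR_doubling hphi; exists M => // n.
have p1 : 1 <= 2 ^+ n :> R by rewrite exprn_ege1// ler1n.
have [_ phi0 _] := hphi.
have [||h1 h2] := hM (2 ^+ n) 2 p1; [lra|exact: lexx|].
by split; rewrite /dyadic ?exprS//; exact: phi0.
Qed.

Variables (A : operator H) (j : H -> K).
Hypothesis hK : is_completion (op_fun A (@chi R)) j.

Lemma spectral_subpvm : subpvm (spectral_measure A).
Proof.
rewrite /spectral_measure; case: xgetP => [E _ [hE _ _]|_]; first exact: subpvm_pvm.
exact: subpvm0.
Qed.

Lemma chi_le1 t : 0 <= t -> chi t <= 1 :> R.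
Proof. by move=> t0; rewrite /chi -expR0 ler_expR oppr_le0. Qed.

Lemma chi_dom u : dom (op_fun A (@chi R)) u.
Proof.
rewrite /op_fun; set f := _ \_ _.
have hE := spectral_subpvm.
have f0 t : 0 <= f t by rewrite /f patchE; case: ifP => // _; exact: expR_ge0.
have f1 t : f t <= 1.
  rewrite /f patchE; case: ifP => // ht; apply: chi_le1.
  by move: ht; rewrite inE /= in_itv /= andbT; lra.
have mchi : measurable_fun setT (@chi R).
  by apply: measurableT_comp; [exact: measurable_expR|exact: oppr_measurable].
have mf : measurable_fun setT f.
  apply/(measurable_restrict _ _ _) => //; rewrite setTI.
  exact: measurable_funS mchi.
rewrite (pvm_integral_dom hE f0 mf); apply: (calc_dom_int (hE := hE) f0 mf).
apply: (@le_lt_trans _ _ (\int[mu_for hE u]_t (cst 1%:E t))%E); last first.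
  by rewrite integral_cst// mul1e /= /mu_for ltry.
apply: ge0_le_integral => //.
- by move=> t _; rewrite lee_fin sqr_ge0.
- by apply/measurable_EFinP/measurable_funX.
- by move=> t _; rewrite lee_fin expr_le1.
Qed.

(** Everything that the two directions of the theorem use about [A], [K] and [j]; the rest of the
    argument concerns sequences of block vectors. *)
Lemma scale_coords : exists (P : nat -> {linear H -> H}) (p : nat -> {linear K -> H}),
  [/\ blocks P, (forall n y, P n (p n y) = p n y),
      (forall x y, (forall n, p n x = p n y) -> x = y),
      (forall (phi : R -> R) (Y : hilbert_manifold K), class_OR phi -> is_Hphi_space A j phi Y ->
         wspace P p (dyadic phi) Y) &
      (forall phi : R -> R, class_OR phi -> exists Y : hilbert_manifold K, is_Hphi_space A j phi Y)].
Proof.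
have [P hP hdiag] := subpvm_blocks spectral_subpvm.
(* Lower and upper bounds of [chi] on block [n]. They are not comparable up to a constant, [chi]
   being outside the class OR, which is why [diag] carries two separate bounds. *)
pose c0 n : R := expR (- 2 ^+ n.+1); pose C0 n : R := expR (- 2 ^+ n).
have hTK : diag P c0 C0 (op_fun A (@chi R)).
  apply: hdiag.
  - have mchi : measurable_fun setT (@chi R).
      by apply: measurableT_comp; [exact: measurable_expR|exact: oppr_measurable].
    exact: measurable_funS mchi.
  - by move=> n; exact: expR_gt0.
  - move=> n t; rewrite /blk /= in_itv /= => /andP[h1 h2].
    by rewrite /chi !ler_expR !lerN2 h1 ltW.
have [p hp] := completion_coords hP hTK hK.
have hT phi : class_OR phi -> exists2 M, 1 <= M &
    diag P (fun n => M^-1 * dyadic phi n) (fun n => M * dyadic phi n) (op_fun A phi).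
  move=> hphi; have [M M1 hM] := OR_block hphi; exists M => //.
  have [mphi phi0 _] := hphi; apply: hdiag => // n.
  have p1 : 1 <= 2 ^+ n :> R by rewrite exprn_ege1// ler1n.
  by rewrite mulr_gt0// ?invr_gt0; [lra|exact: phi0].
exists P, p; split=> //.
- exact: (p_P hp).
- by move=> x y; exact: (coords_inj hTK hp).
- move=> phi Y hphi [Yc [k hk ik]]; have [M M1 hD] := hT phi hphi.
  by apply: (wspace_hphi hP hTK hp hK M1 hD _ Yc hk ik) => u _; exact: chi_dom.
- move=> phi hphi; have [M M1 hD] := hT phi hphi.
  have [r r1 hr] := OR_ratio hphi.
  have [B B0 hB] := pow_le_exp r1.
  have w0 : 0 < dyadic phi 0 by have [] := hr 0%N.
  have rn n : dyadic phi 0 <= r ^+ n * dyadic phi n.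
    elim: n => [|n IH]; first by rewrite expr0 mul1r.
    apply: le_trans IH _; have [_ _ h] := hr n.
    by rewrite exprSr -mulrA; apply: ler_wpM2l => //; rewrite exprn_ge0//; lra.
  (* From [dyadic phi 0 <= r ^+ n * dyadic phi n] and [r ^+ n <= B * expR (2 ^+ n)], the upper bound
     [C0 n] of [chi] is at most [B / dyadic phi 0] times [dyadic phi n]; the factor [M] compensates
     the [M^-1] in the lower bound for [phi(A)]. *)
  pose M' := B / dyadic phi 0 * M.
  have M'0 : 0 <= M' by rewrite !mulr_ge0 ?invr_ge0 ?(ltW w0) ?(ltW B0)//; lra.
  have [||k [F [hk Finj Fb Fk]]] := hphi_carrier hP hTK hK hp hD _ M'0.
  - by move=> u _; exact: chi_dom.
  - move=> n; rewrite /C0 /M' expRN.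
    have e0 : 0 < expR (2 ^+ n) :> R by exact: expR_gt0.
    have wn : 0 < dyadic phi n by have [] := hr n.
    have -> : B / dyadic phi 0 * M * (M^-1 * dyadic phi n) = B * dyadic phi n / dyadic phi 0.
      by field; rewrite gt_eqF//=; lra.
    rewrite ler_pdivlMr// mulrC ler_pdivrMr//.
    apply: le_trans (rn n) _; rewrite mulrAC ler_pM2r//; exact: hB.
  exists (HilbertManifold Finj); split; last by exists k.
  move=> x; apply/(@cvgrPdist_lt _ K) => e /pos_complex[d d0 ->].
  have m1 : 0 < M' + 1 by lra.
  have e1 : 0 < (d / (M' + 1))%:C by rewrite ltcR divr_gt0.
  near=> y.
  rewrite /= nrE ltcR -linearB; apply: le_lt_trans (Fb _) _.
  have : nr (x - y) < d / (M' + 1).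
    rewrite -ltcR -nrE; near: y.
    exact: (@cvgr_dist_lt _ _ _ _ _ id x).
  by rewrite ltr_pdivlMr//; have := nr_ge0 (x - y); nra.
Unshelve. all: by end_near.
Qed.
End Setup.

(** * Schur's test for a geometric kernel *)

Section Schur.
Variable R : realType.

Definition decay (m n : nat) : R := 2^-1 ^+ ((m - n) + (n - m)).

Lemma decay_ge0 m n : 0 <= decay m n.
Proof. by rewrite exprn_ge0// invr_ge0. Qed.

Lemma decay_sym m n : decay m n = decay n m.
Proof. by rewrite /decay addnC. Qed.

Lemma decay_sum m N : \sum_(n < N) decay m n <= 3.
Proof.
(* The limit is [1 + 2 (1/2 + 1/4 + ...) = 3]; the bound is sharpened to depend on [N] so that
   induction goes through. *)
suff h : \sum_(n < N) decay m n <=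
    if (N <= m)%N then 2^-1 ^+ (m - N) else 3 - 2 * 2^-1 ^+ (N - m).
  apply: le_trans h _; case: ifP => _.
    apply: (@le_trans _ _ 1); last by lra.
    by rewrite exprn_ile1 ?invr_ge0// invf_le1 ?ler1n.
  have : 0 <= (2^-1 : R) ^+ (N - m) by rewrite exprn_ge0 ?invr_ge0.
  lra.
elim: N => [|N IH]; first by rewrite big_ord0 leq0n exprn_ge0 ?invr_ge0.
rewrite big_ord_recr /=; have [lt|lt|e] := ltngtP N m.
- have e1 : (m - N)%N = (m - N.+1).+1 by lia.
  have e2 : (N - m)%N = 0%N by lia.
  move: IH; rewrite (ltnW lt) /decay e2 addn0 e1 exprS; lra.
- have e1 : (N.+1 - m)%N = (N - m).+1 by lia.
  have e2 : (m - N)%N = 0%N by lia.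
  move: IH; rewrite leqNgt lt /decay e2 add0n e1 exprS /=; lra.
- move: IH; rewrite e leqnn subnn expr0 => IH.
  by rewrite /decay subnn addn0 expr0 subSnn expr1; lra.
Qed.

(** Weighted Cauchy-Schwarz: after symmetrization, the difference of the two sides is the double sum
    of [k i * k l * (a i - a l) ^+ 2 / 2]. *)
Lemma sum_sqr_le (k a : nat -> R) N : (forall n, 0 <= k n) ->
  (\sum_(n < N) k n * a n) ^+ 2 <= (\sum_(n < N) k n) * (\sum_(n < N) k n * a n ^+ 2).
Proof.
move=> k0; rewrite expr2 !big_distrlr /= -subr_ge0.
have e : \sum_(i < N) \sum_(l < N) k i * (k l * a l ^+ 2) =
   \sum_(i < N) \sum_(l < N) k i * k l * ((a i ^+ 2 + a l ^+ 2) / 2).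
  transitivity (2^-1 * (\sum_(i < N) \sum_(l < N) k i * (k l * a l ^+ 2) +
                        \sum_(i < N) \sum_(l < N) k i * (k l * a l ^+ 2))); first by lra.
  rewrite [X in _ * (_ + X)]exchange_big -big_split mulr_sumr; apply: eq_bigr => i _.
  by rewrite -big_split mulr_sumr; apply: eq_bigr => l _ /=; field.
rewrite e -sumrB; apply: sumr_ge0 => i _; rewrite -sumrB; apply: sumr_ge0 => l _.
rewrite (_ : _ - _ = k i * k l * ((a i - a l) ^+ 2 / 2)); last by field.
apply: mulr_ge0; first exact: mulr_ge0.
by apply: divr_ge0; [exact: sqr_ge0|].
Qed.

Lemma schur (a b : nat -> R) M N : (forall m, 0 <= b m) ->
  (forall m, (m < M)%N -> b m <= \sum_(n < N) decay m n * a n) ->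
  \sum_(m < M) b m ^+ 2 <= 9 * \sum_(n < N) a n ^+ 2.
Proof.
move=> b0 hb.
have h m : (m < M)%N -> b m ^+ 2 <= 3 * \sum_(n < N) decay m n * a n ^+ 2.
  move=> mM; apply: le_trans (_ : (\sum_(n < N) decay m n * a n) ^+ 2 <= _).
    by rewrite lerXn2r ?nnegrE ?(le_trans (b0 m)) ?hb.
  apply: le_trans (sum_sqr_le a N (decay_ge0 m)) _; apply: ler_wpM2r; last exact: decay_sum.
  by apply: sumr_ge0 => n _; rewrite mulr_ge0 ?decay_ge0 ?sqr_ge0.
apply: (@le_trans _ _ (\sum_(m < M) 3 * \sum_(n < N) decay m n * a n ^+ 2)).
  by apply: ler_sum => m _; exact: h.
rewrite -mulr_sumr exchange_big /= (_ : 9 = 3 * 3); last by lra.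
rewrite -mulrA; apply: ler_wpM2l; first by lra.
rewrite mulr_sumr; apply: ler_sum => n _; rewrite -mulr_suml.
apply: ler_wpM2r; first exact: sqr_ge0.
by under eq_bigr do rewrite decay_sym; exact: decay_sum.
Qed.
End Schur.

(** * Embeddings and expansions in weighted sequence spaces *)

Section Spaces.
Variables (R : realType) (H K : hilbertType R).
Variables (P : nat -> {linear H -> H}) (p : nat -> {linear K -> H}).
Hypotheses (pP : forall n y, P n (p n y) = p n y)
  (pinj : forall x y, (forall n, p n x = p n y) -> x = y).
Implicit Types (w : nat -> R) (X Y : hilbert_manifold K).

Definition coord (Y : hilbert_manifold K) (y : Y) n : H := p n (incl Y y).

Lemma emb_real X Y : continuously_embedded X Y -> exists c : R, 0 <= c /\
  forall x : X, exists2 y : Y, incl Y y = incl X x & nr y <= c * nr x.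
Proof.
move=> [c hc]; exists (cabs c); split; first exact: cabs_ge0.
by move=> x; have [y e h] := hc x; exists y => //; exact: ext_bound.
Qed.

Lemma real_emb X Y (c : R) :
  (forall x : X, exists2 y : Y, incl Y y = incl X x & nr y <= c * nr x) ->
  continuously_embedded X Y.
Proof.
by move=> h; exists c%:C => x; have [y e hy] := h x; exists y => //; exact: bound_ext.
Qed.

Lemma weighted_sum_mono w (h : nat -> H) m n : (m <= n)%N -> weighted_sum w h m <= weighted_sum w h n.
Proof.
move=> mn; rewrite /weighted_sum -!(big_mkord xpredT (fun n => (w n * nr (h n)) ^+ 2)).
rewrite [leRHS](big_cat_nat _ (n := m))//= lerDl; apply: sumr_ge0 => i _; exact: sqr_ge0.
Qed.

Lemma weighted_sum_le w w' (h : nat -> H) N (c : R) : 0 <= c -> (forall n, 0 <= w n) -> (forall n, w n <= c * w' n) ->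
  weighted_sum w h N <= c ^+ 2 * weighted_sum w' h N.
Proof.
move=> c0 w0 hc; rewrite /weighted_sum mulr_sumr; apply: ler_sum => n _.
have cw : 0 <= c * w' n by exact: le_trans (w0 n) (hc n).
rewrite -exprMn mulrA lerXn2r ?nnegrE ?(mulr_ge0 _ (nr_ge0 _))//.
by apply: ler_wpM2r; [exact: nr_ge0|exact: hc].
Qed.

Lemma wspace_emb w w' X Y (c : R) : 0 <= c -> (forall n, 0 <= w' n) ->
  (forall n, w' n <= c * w n) ->
  wspace P p w X -> wspace P p w' Y -> continuously_embedded X Y.
Proof.
move=> c0 w0 hw [B [B0 hB _]] [B' [B'0 _ hB']].
apply: (@real_emb _ _ (B' * (c * B))) => x.
have m0 : 0 <= c * (B * nr x) by rewrite !mulr_ge0 ?nr_ge0.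
have [n|N|y hy yB] := hB' (coord x) _ m0.
- exact: pP.
- apply: le_trans (weighted_sum_le (coord x) N c0 w0 hw) _; rewrite exprMn.
  by apply: ler_wpM2l; [exact: sqr_ge0|exact: hB].
exists y; first by apply: pinj => n; rewrite hy.
by rewrite -!mulrA.
Qed.

Lemma wspace_eq w X Y : (forall n, 0 <= w n) -> wspace P p w X -> wspace P p w Y ->
  equal_up_to_norms X Y.
Proof.
move=> w0 hX hY.
by split; apply: (@wspace_emb w w _ _ 1); rewrite ?ler01// => n; rewrite mul1r.
Qed.

Lemma wspace_transfer w X Y : equal_up_to_norms X Y -> wspace P p w Y -> wspace P p w X.
Proof.
move=> [/emb_real[c [c0 hc]] /emb_real[d [d0 hd]]] [B [B0 hB1 hB2]].
exists (Num.max (B * c) (d * B)); split; first by rewrite le_max mulr_ge0.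
- move=> x N; have [y yx yc] := hc x; rewrite -yx; apply: le_trans (hB1 y N) _.
  rewrite lerXn2r ?nnegrE ?mulr_ge0 ?nr_ge0 ?le_max ?mulr_ge0//.
  apply: le_trans (ler_wpM2l B0 yc) _; rewrite mulrA.
  by apply: ler_wpM2r; rewrite ?nr_ge0 ?le_max ?lexx.
- move=> h m m0 hh hm; have [y hy ym] := hB2 h m m0 hh hm.
  have [x xy xd] := hd y; exists x; first by move=> n; rewrite xy.
  apply: le_trans xd _; apply: le_trans (ler_wpM2l d0 ym) _; rewrite mulrA.
  by apply: ler_wpM2r; rewrite ?le_max ?lexx ?orbT.
Qed.

Lemma coord_bound w Y : wspace P p w Y -> exists2 B : R, 0 <= B &
  forall n (y : Y), 0 <= w n -> w n * nr (coord y n) <= B * nr y.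
Proof.
move=> [B [B0 hB _]]; exists B => // n y wn.
rewrite -(@ler_pXn2r _ 2) ?nnegrE ?mulr_ge0 ?nr_ge0//.
apply: le_trans (hB y n.+1); rewrite /weighted_sum big_ord_recr /= lerDr.
by apply: sumr_ge0 => i _; exact: sqr_ge0.
Qed.

Definition single (v : H) (n m : nat) : H := if m == n then v else 0.

Lemma P_single n v : P n v = v -> forall m, P m (single v n m) = single v n m.
Proof. by move=> hv m; rewrite /single; case: eqP => [->|]; rewrite ?linear0. Qed.

Lemma weighted_sum_single w n v N : weighted_sum w (single v n) N <= (w n * nr v) ^+ 2.
Proof.
rewrite /weighted_sum; have [nN|Nn] := ltnP n N.
  rewrite (bigD1 (Ordinal nN))//= /single eqxx big1 ?addr0// => i ni.
  by rewrite ifN ?nr0 ?mulr0 ?expr0n// -(inj_eq val_inj).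
rewrite big1 ?sqr_ge0// => i _; rewrite /single ltn_eqF ?nr0 ?mulr0 ?expr0n//.
exact: leq_trans (ltn_ord i) Nn.
Qed.

Lemma wspace_single w Y : (forall n, 0 <= w n) -> wspace P p w Y -> exists2 B : R, 0 <= B &
  forall n v, P n v = v -> exists2 y : Y, (forall m, coord y m = single v n m) & nr y <= B * (w n * nr v).
Proof.
move=> w0 [B [B0 _ hB]]; exists B => // n v hv.
have m0 : 0 <= w n * nr v by rewrite mulr_ge0 ?nr_ge0.
have [N|y hy yB] := hB (single v n) _ m0 (P_single hv); first exact: weighted_sum_single.
by exists y.
Qed.

Lemma coord_inj Y (x y : Y) : (forall n, coord x n = coord y n) -> x = y.
Proof. by move=> h; apply: (incl_inj (h := Y)); exact: pinj. Qed.

Lemma coordB Y (x y : Y) n : coord (x - y) n = coord x n - coord y n.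
Proof. by rewrite /coord !linearB. Qed.

Lemma coord_sum Y (e : nat -> Y) N n : coord (\sum_(i < N) e i) n = \sum_(i < N) coord (e i) n.
Proof. by rewrite /coord !linear_sum. Qed.

Lemma wspace_cv w Y (y : Y) (e : nat -> Y) : wspace P p w Y ->
  (forall n m, coord (e n) m = single (coord y n) n m) -> cv (fun N => \sum_(n < N) e n) y.
Proof.
move=> [B [B0 hB1 hB2]] he.
have ce N m : coord (\sum_(n < N) e n) m = if (m < N)%N then coord y m else 0.
  rewrite coord_sum; case: ltnP => mN.
    rewrite (bigD1 (Ordinal mN))//= he /single eqxx big1 ?addr0// => i mi.
    by rewrite he /single ifN// eq_sym.
  by rewrite big1// => i _; rewrite he /single gtn_eqF// (leq_trans (ltn_ord i)).
move=> d d0.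
have B1 : 0 < B + 1 by lra.
have d1 : 0 < d / (B + 1) by rewrite divr_gt0.
have [N hN] := mono_cauchy (@weighted_sum_mono w (coord y)) (hB1 y) (exprn_gt0 2 d1).
exists N => n Nn.
have [m|M|z hz zB] := hB2 (coord (y - \sum_(i < n) e i)) _ (ltW d1).
- exact: pP.
- pose M' := maxn n M; have nM : (n <= M')%N := leq_maxl _ _.
  apply: le_trans (weighted_sum_mono _ _ (leq_maxr n M)) _.
  apply: ltW; apply: le_lt_trans (hN n M' Nn nM).
  rewrite /weighted_sum (sum_tail (fun n => (w n * nr (coord y n)) ^+ 2))// le_eqVlt; apply/orP; left.
  apply/eqP/eq_bigr => i _; rewrite coordB ce; case: ifP => _; last by rewrite subr0.
  by rewrite subrr nr0 mulr0 expr0n.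
have zE : z = y - \sum_(i < n) e i by exact: coord_inj.
rewrite nrBC -zE; apply: le_lt_trans zB _; rewrite mulrA ltr_pdivrMr//; nra.
Qed.

End Spaces.

(** * Function classes OR give interpolation spaces *)

Section Sufficiency.
Variables (R : realType) (H K : hilbertType R).
Variables (P : nat -> {linear H -> H}) (p : nat -> {linear K -> H}).
Hypotheses (pP : forall n y, P n (p n y) = p n y)
  (pinj : forall x y, (forall n, p n x = p n y) -> x = y).

Local Notation coord := (coord p).
Local Notation wspace := (wspace P p).

Lemma restricts_real (H0 X : hilbert_manifold K) (T : H0 -> H0) : restricts_bounded T X ->
  exists2 c : R, 0 <= c & forall (x : X) (h : H0), incl H0 h = incl X x ->
    exists2 x' : X, incl X x' = incl H0 (T h) & nr x' <= c * nr x.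
Proof.
move=> [c hc]; exists (cabs c); first exact: cabs_ge0.
by move=> x h e; have [x' e' hx] := hc x h e; exists x' => //; exact: ext_bound.
Qed.

Lemma restricts_self (H0 : hilbert_manifold K) (T : H0 -> H0) : restricts_bounded T H0 ->
  exists2 c : R, 0 <= c & forall h, nr (T h) <= c * nr h.
Proof.
move=> /restricts_real[c c0 hc]; exists c => // h.
by have [h' /(@incl_inj _ _ H0) <-] := hc h h erefl.
Qed.

Lemma real_restricts (H0 X : hilbert_manifold K) (T : H0 -> H0) (c : R) :
  (forall (x : X) (h : H0), incl H0 h = incl X x ->
    exists2 x' : X, incl X x' = incl H0 (T h) & nr x' <= c * nr x) -> restricts_bounded T X.
Proof.
move=> hc; exists c%:C => x h e; have [x' e' hx] := hc x h e; exists x' => //.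
exact: bound_ext.
Qed.

Lemma weighted_sum_lim (w : nat -> R) (g : nat -> nat -> H) (l : nat -> H) (M : nat) (B : R) :
  (forall m, cv (g m) (l m)) ->
  (forall N, (M <= N)%N -> weighted_sum w (fun m => g m N) M <= B) -> weighted_sum w l M <= B.
Proof.
move=> gl gB.
have c : (fun N => weighted_sum w (fun m => g m N) M) @ \oo --> weighted_sum w l M.
  rewrite /weighted_sum; elim: M {gB} => [|M IH].
    rewrite big_ord0 (_ : (fun N => _) = fun=> 0); first exact: cvg_cst.
    by apply/funext => N; rewrite big_ord0.
  rewrite big_ord_recr /=.
  rewrite (_ : (fun N => _) = (fun N => \sum_(n < M) (w n * nr (g n N)) ^+ 2 + w M ^+ 2 * nr (g M N) ^+ 2)); last first.
    by apply/funext => N; rewrite big_ord_recr /= exprMn.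
  rewrite exprMn; apply: cvgD => //; apply: cvgMr; exact: cvg_nr2.
rewrite -(cvg_lim (@Rhausdorff R) c); apply: limr_le; first exact: (cvgP _ c).
by exists M => // N /=; exact: gB.
Qed.

Section Interp.
Variables (w w0 w1 : nat -> R) (H0 H1 X : hilbert_manifold K) (c : R).
Hypotheses (wp : forall n, 0 < w n) (w0p : forall n, 0 < w0 n) (w1p : forall n, 0 < w1 n)
  (hX : wspace w X) (hH0 : wspace w0 H0) (hH1 : wspace w1 H1)
  (c0 : 0 <= c) (ww0 : forall n, w0 n <= c * w n) (ww1 : forall n, w n <= c * w1 n)
  (kern : forall m n, w m * w0 n <= decay R m n * (w n * w0 m) \/
                      w m * w1 n <= decay R m n * (w n * w1 m)).

(** [kern] lets each pair of blocks choose its endpoint: boundedness of [T] on that one space alone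
    already makes the entry of [T] between the two blocks small relative to [w]. *)
Lemma wspace_interpolation : interpolation_space H0 H1 X.
Proof.
split.
- by apply: (wspace_emb pP pinj c0 _ ww1 hH1 hX) => n; exact: ltW.
- by apply: (wspace_emb pP pinj c0 _ ww0 hX hH0) => n; exact: ltW.
move=> T /restricts_self[t0 t00 hT0] /restricts_real[t1 t10 hT1].
have [D0 D00 hD0] := wspace_single (fun n => ltW (w0p n)) hH0.
have [D1 D10 hD1] := wspace_single (fun n => ltW (w1p n)) hH1.
have [B0 B00 hB0] := coord_bound hH0.
have [B1 B10 hB1] := coord_bound hH1.
pose M := B0 * t0 * D0 + B1 * t1 * D1.
have M0 : 0 <= M by rewrite addr_ge0 ?mulr_ge0.
have entry m n v (e : H0) : P n v = v -> (forall i, coord e i = single v n i) ->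
    w m * nr (coord (T e) m) <= M * (decay R m n * (w n * nr v)).
  move=> hv he.
  have k0 := decay_ge0 R m n.
  have nv := nr_ge0 v.
  have [h|h] := kern m n.
  - have [e' ce' ne'] := hD0 n v hv.
    have ee : e' = e by apply: (coord_inj pinj) => i; rewrite ce' he.
    rewrite ee in ne'.
    have h1 := hB0 m (T e) (ltW (w0p m)).
    have h2 : w0 m * nr (coord (T e) m) <= (B0 * t0 * D0) * (w0 n * nr v).
      apply: le_trans h1 _; rewrite -!mulrA; apply: ler_wpM2l => //.
      by apply: le_trans (hT0 e) _; rewrite ler_wpM2l.
    rewrite -(ler_pM2l (w0p m)).
    apply: (@le_trans _ _ ((B0 * t0 * D0) * (w m * w0 n * nr v))).
      by rewrite mulrCA; apply: le_trans (ler_wpM2l (ltW (wp m)) h2) _; lra.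
    apply: (@le_trans _ _ (M * (w m * w0 n * nr v))).
      by apply: ler_wpM2r; rewrite ?lerDl ?mulr_ge0 ?(ltW (wp _)) ?(ltW (w0p _)).
    rewrite [leRHS]mulrCA; apply: ler_wpM2l => //.
    by have := ler_wpM2r nv h; lra.
  - have [e' ce' ne'] := hD1 n v hv.
    have ee : incl H0 e = incl H1 e'.
      by apply: pinj => i; rewrite -[LHS]/(coord e i) he -ce'.
    have [x' ex' nx'] := hT1 e' e ee.
    have cx : coord (T e) m = coord x' m by rewrite /coord ex'.
    rewrite cx.
    have h1 := hB1 m x' (ltW (w1p m)).
    have h2 : w1 m * nr (coord x' m) <= (B1 * t1 * D1) * (w1 n * nr v).
      apply: le_trans h1 _; rewrite -!mulrA; apply: ler_wpM2l => //.
      by apply: le_trans nx' _; rewrite ler_wpM2l.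
    rewrite -(ler_pM2l (w1p m)).
    apply: (@le_trans _ _ ((B1 * t1 * D1) * (w m * w1 n * nr v))).
      by rewrite mulrCA; apply: le_trans (ler_wpM2l (ltW (wp m)) h2) _; lra.
    apply: (@le_trans _ _ (M * (w m * w1 n * nr v))).
      by apply: ler_wpM2r; rewrite ?lerDr ?mulr_ge0 ?(ltW (wp _)) ?(ltW (w1p _)).
    rewrite [leRHS]mulrCA; apply: ler_wpM2l => //.
    by have := ler_wpM2r nv h; lra.
have [BX [BX0 hX1 hX2]] := hX.
apply: (@real_restricts _ _ _ (BX * (3 * M * BX))) => x h hx.
have corh n : coord h n = coord x n by rewrite /coord hx.
have /choice[e he] : forall n, exists e : H0, forall i, coord e i = single (coord h n) n i.
  by move=> n; have [|e ce _] := hD0 n (coord h n); [exact: pP|exists e].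
have cvh := wspace_cv pP pinj hH0 he.
(* The block expansion of [h] is used in [H0], where [T] is continuous; this determines every
   coordinate of [T h]. *)
have cvTm m : cv (fun N => coord (T (\sum_(n < N) e n)) m) (coord (T h) m).
  apply: (@cv_lip _ _ _ _ _ _ _ (B0 / w0 m * t0)) cvh => N.
  rewrite -(coordB p) -linearB; set z := _ - h.
  rewrite (_ : B0 / w0 m * t0 * nr z = B0 * (t0 * nr z) / w0 m); last by ring.
  rewrite ler_pdivlMr// mulrC.
  by apply: le_trans (hB0 m _ (ltW (w0p m))) _; rewrite ler_wpM2l.
have bd M' : weighted_sum w (coord (T h)) M' <= (3 * M * BX * nr x) ^+ 2.
  apply: (weighted_sum_lim cvTm) => N _.
  have hb m : 0 <= w m * nr (coord (T (\sum_(n < N) e n)) m).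
    by rewrite mulr_ge0 ?nr_ge0 ?ltW.
  rewrite /weighted_sum.
  apply: le_trans (schur (a := fun n => M * (w n * nr (coord x n))) (N := N) hb _) _.
    move=> m _; rewrite linear_sum (coord_sum p (fun n => T (e n))).
    apply: le_trans (ler_wpM2l (ltW (wp m)) (_ : _ <= \sum_(n < N) nr (coord (T (e n)) m))) _.
      elim/big_ind2 : _ => // [|? ? ? ? h1 h2]; first by rewrite nr0.
      by apply: le_trans (nrD _ _) _; exact: lerD.
    rewrite mulr_sumr; apply: ler_sum => n _.
    rewrite [leRHS]mulrCA -corh; apply: entry => //; exact: pP.
  under eq_bigr do rewrite exprMn.
  rewrite -mulr_sumr -[\sum_(i < N) _]/(weighted_sum w (coord x) N).
  have := hX1 x N; rewrite -/(coord x) => hh.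
  have : M ^+ 2 * weighted_sum w (coord x) N <= M ^+ 2 * (BX * nr x) ^+ 2.
    by apply: ler_wpM2l => //; exact: sqr_ge0.
  by lra.
have m0 : 0 <= 3 * M * BX * nr x by rewrite !mulr_ge0 ?nr_ge0.
have [n|y hy yB] := hX2 (coord (T h)) _ m0 _ bd; first exact: pP.
exists y; first by apply: pinj => n; rewrite hy.
by rewrite -mulrA.
Qed.
End Interp.
End Sufficiency.

(** * Interpolation spaces are weighted sequence spaces *)

Definition dist (m n : nat) : nat := ((m - n) + (n - m))%N.

Lemma ratio_dist (R : realType) (w : nat -> R) (r : R) : 1 <= r ->
  (forall n, [/\ 0 < w n, w n.+1 <= r * w n & w n <= r * w n.+1]) ->
  forall m n, w m <= r ^+ dist m n * w n.
Proof.
move=> r1 hw.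
have up n d : w (d + n)%N <= r ^+ d * w n.
  elim: d => [|d IH]; first by rewrite expr0 mul1r.
  have [_ h _] := hw (d + n)%N; rewrite addSn; apply: le_trans h _.
  by rewrite exprS -mulrA ler_wpM2l//; lra.
have dn n d : w n <= r ^+ d * w (d + n)%N.
  elim: d => [|d IH]; first by rewrite expr0 mul1r.
  have [_ _ h] := hw (d + n)%N; rewrite addSn; apply: le_trans IH _.
  by rewrite exprSr -mulrA ler_wpM2l// exprn_ge0//; lra.
move=> m n; rewrite /dist; have [mn|nm] := leqP m n.
  have e0 : (m - n)%N = 0%N by lia.
  by have := dn m (n - m)%N; rewrite e0 subnK.
have e0 : (n - m)%N = 0%N by lia.
by have := up n (m - n)%N; rewrite e0 addn0 subnK// ltnW.
Qed.

Lemma near_sup (R : realType) (S : set R) (M : R) : S !=set0 -> (forall x, S x -> 0 < x) ->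
  (forall x, S x -> x <= M) -> exists2 x, S x & forall y, S y -> y <= 2 * x.
Proof.
move=> [y0 Sy0] S0 SM; have y00 := S0 _ Sy0; have e0 : 0 < y0 / 2 by lra.
have [x Sx hx] := sup_near (ex_intro _ y0 Sy0) SM e0.
by exists x => // y Sy; have := hx _ Sy; have := hx _ Sy0; lra.
Qed.

Section Necessity.
Variables (R : realType) (H K : hilbertType R).
Variables (P : nat -> {linear H -> H}) (p : nat -> {linear K -> H}).
Hypotheses (pP : forall n y, P n (p n y) = p n y)
  (pinj : forall x y, (forall n, p n x = p n y) -> x = y).

Local Notation coord := (coord p).
Local Notation wspace := (wspace P p).

Variables (w0 w1 : nat -> R) (rho : R) (H0 H1 X : hilbert_manifold K).
Hypotheses (rho1 : 1 <= rho)
  (w0r : forall n, [/\ 0 < w0 n, w0 n.+1 <= rho * w0 n & w0 n <= rho * w0 n.+1])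
  (w1r : forall n, [/\ 0 < w1 n, w1 n.+1 <= rho * w1 n & w1 n <= rho * w1 n.+1])
  (hH0 : wspace w0 H0) (hH1 : wspace w1 H1) (hX : interpolation_space H0 H1 X).

Let w0p n : 0 < w0 n. Proof. by have [] := w0r n. Qed.
Let w1p n : 0 < w1 n. Proof. by have [] := w1r n. Qed.

(** Operators are described by their action [tau] on coordinate sequences, so that one formula acts
    on [H0], [H1] and [X] consistently. *)
Definition weight_bounded (w : nat -> R) (tau : (nat -> H) -> nat -> H) : Prop :=
  exists2 C : R, 0 <= C & forall h B, 0 <= B -> (forall N, weighted_sum w h N <= B ^+ 2) ->
    forall N, weighted_sum w (tau h) N <= (C * B) ^+ 2.

Definition blockwise_linear (tau : (nat -> H) -> nat -> H) : Prop :=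
  (forall a h h' n, tau (fun n => a *: h n + h' n) n = a *: tau h n + tau h' n) /\
  (forall h n, (forall i, P i (h i) = h i) -> P n (tau h n) = tau h n).

Lemma tau_op (w : nat -> R) (Y : hilbert_manifold K) tau : (forall n, 0 < w n) -> wspace w Y ->
  blockwise_linear tau -> weight_bounded w tau ->
  exists2 c : R, 0 <= c & forall y : Y, exists2 z : Y, (forall m, coord z m = tau (coord y) m) & nr z <= c * nr y.
Proof.
move=> wp [B [B0 hB1 hB2]] [tl tP] [C C0 hC].
exists (B * (C * B)); first by rewrite !mulr_ge0.
move=> y; have m0 : 0 <= B * nr y by rewrite mulr_ge0 ?nr_ge0.
have m1 : 0 <= C * (B * nr y) by rewrite mulr_ge0.
have [n|N|z hz zB] := hB2 (tau (coord y)) _ m1.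
- by apply: tP => i; exact: pP.
- exact: hC m0 (hB1 y) N.
by exists z => //; rewrite -!mulrA.
Qed.

(** The single place where clause (ii) of the interpolation property enters. The resulting constant
    depends on [tau]. *)
Lemma tau_bounded tau : blockwise_linear tau -> weight_bounded w0 tau -> weight_bounded w1 tau ->
  exists2 c : R, 0 <= c & forall x : X, exists2 x' : X, (forall m, coord x' m = tau (coord x) m) & nr x' <= c * nr x.
Proof.
move=> tg t0 t1.
have [c0 c00 /choice[F hF]] : exists2 c : R, 0 <= c & forall y : H0, exists z : H0,
    (forall m, coord z m = tau (coord y) m) /\ nr z <= c * nr y.
  have [c c0 h] := tau_op w0p hH0 tg t0; exists c => // y.
  by have [z h1 h2] := h y; exists z.
have Fc y m : coord (F y) m = tau (coord y) m by have [] := hF y.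
have Fl : linear F.
  move=> a y z; apply: (coord_inj pinj) => n; rewrite Fc.
  have -> : coord (a *: F y + F z) n = a *: coord (F y) n + coord (F z) n by rewrite /coord !linearP.
  rewrite !Fc -(proj1 tg); congr (tau _ n); apply/funext => m.
  by rewrite /coord !linearP.
pose T : {linear H0 -> H0} := HB.pack F (GRing.isLinear.Build _ _ _ _ F Fl).
have [_ _ hI] := hX.
have TB0 : restricts_bounded T H0.
  apply: (real_restricts (c := c0)) => x h /(@incl_inj _ _ H0) ->.
  by exists (T x) => //; have [] := hF x.
have TB1 : restricts_bounded T H1.
  have [c1 _ h1] := tau_op w1p hH1 tg t1.
  apply: (real_restricts (c := c1)) => x h e; have [z hz zc] := h1 x.
  exists z => //; apply: pinj => n; rewrite -[LHS]/(coord z n) -[RHS]/(coord (F h) n) hz Fc.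
  by congr (tau _ n); apply/funext => m; rewrite /coord e.
have [c c0' hc] := restricts_real (hI T TB0 TB1).
exists c => // x; have [_ /emb_real[d [_ hd]] _] := hX.
have [h hx _] := hd x; have [x' ex nx] := hc x h hx.
exists x' => // m; rewrite -[LHS]/(p m (incl X x')) ex -[LHS]/(coord (F h) m) Fc.
by congr (tau _ m); apply/funext => i; rewrite /coord hx.
Qed.

Lemma coord_bdX : exists b : nat -> R, forall n (x : X), nr (coord x n) <= b n * nr x.
Proof.
have [_ /emb_real[d [_ hd]] _] := hX; have [B B0 hB] := coord_bound hH0.
exists (fun n => B * d / w0 n) => n x; have [h hx hn] := hd x.
have := hB n h (ltW (w0p n)); have -> : coord h n = coord x n by rewrite /coord hx.
move=> h1; rewrite mulrAC ler_pdivlMr// mulrC; apply: le_trans h1 _.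
by rewrite -mulrA ler_wpM2l.
Qed.

Lemma coordX_cv n (x : nat -> X) l : cv x l -> cv (fun i => coord (x i) n) (coord l n).
Proof.
have [b hb] := coord_bdX.
by apply: (@cv_lip _ _ _ _ _ _ _ (b n)) => i; rewrite -(coordB p).
Qed.

(* Prescribing more and more coordinates inside a ball of [X] gives a decreasing
   sequence of convex sets, so [min_norm_cauchy] applies. *)
Lemma ball_closed (y : nat -> X) (l : nat -> H) (k : R) : (forall n, nr (y n) <= k) ->
  (forall n m, (m < n)%N -> coord (y n) m = l m) ->
  exists2 x : X, forall m, coord x m = l m & nr x <= k.
Proof.
move=> yk yl.
pose C n : set X := [set x | nr x <= k /\ forall m, (m < n)%N -> coord x m = l m].
have C0 n : C n !=set0 by exists (y n); split=> // m; exact: yl.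
have Cdec m n : (m <= n)%N -> C n `<=` C m.
  by move=> mn x [h1 h2]; split=> // i im; apply: h2; exact: leq_trans mn.
have CM n x : C n x -> nr x <= k by case.
have Cmid n (x z : X) : C n x -> C n z -> C n ((2^-1 : R)%:C *: (x + z)).
  move=> [h1 h2] [h3 h4]; split.
    by rewrite nrZr ger0_norm ?invr_ge0//; have := nrD x z; lra.
  move=> m mn; have -> : coord ((2^-1 : R)%:C *: (x + z)) m = (2^-1 : R)%:C *: (coord x m + coord z m).
    by rewrite /coord linearZ /= linearZ /= !linearD.
  rewrite h2// h4// scalerDr -scalerDl.
  have -> : (2^-1 : R)%:C + (2^-1 : R)%:C = 1.
    by rewrite -rcD -[RHS]/((1 : R)%:C); congr (_%:C); lra.
  by rewrite scale1r.
have [q [x [qC qx]]] := min_norm_cauchy C0 Cdec CM Cmid.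
exists x.
  move=> m; apply: cv_unique (coordX_cv m qx) _ => e e0; exists m.+1 => n mn.
  by have [_ ->] := qC n; rewrite ?subrr ?nr0.
by apply: (@cv_nr_le _ _ q x k 0) qx => n _; have [] := qC n.
Qed.

Definition proj (t : nat -> bool) (h : nat -> H) (n : nat) : H := if t n then h n else 0.

Definition proj_bounded (t : nat -> bool) (C : R) : Prop :=
  forall x : X, exists2 x' : X, (forall m, coord x' m = proj t (coord x) m) & nr x' <= C * nr x.

Lemma proj_bounded_le t C C' : C <= C' -> proj_bounded t C -> proj_bounded t C'.
Proof.
move=> CC h x; have [x' h1 h2] := h x; exists x' => //.
by apply: le_trans h2 _; rewrite ler_wpM2r ?nr_ge0.
Qed.

Lemma proj_good t : blockwise_linear (proj t).
Proof.
split=> [a h h' n|h n hh]; rewrite /proj; case: ifP => // _; first by rewrite scaler0 addr0.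
by rewrite linear0.
Qed.

Lemma proj_bd w t : weight_bounded w (proj t).
Proof.
exists 1 => // h B B0 hB N; rewrite mul1r; apply: le_trans (hB N).
apply: ler_sum => n _; rewrite /proj; case: ifP => // _.
by rewrite nr0 mulr0 expr0n sqr_ge0.
Qed.

Lemma proj_bounded_ex t : exists2 C, 0 <= C & proj_bounded t C.
Proof.
have [c c0 h] := tau_bounded (proj_good t) (proj_bd w0 t) (proj_bd w1 t).
by exists c.
Qed.

Definition agree N (t t' : nat -> bool) := forall m, (m < N)%N -> t m = t' m.

(** Otherwise every initial segment of [t] extends to some [t'] with [proj_bounded t' C]. The images
    of [x] then stay in one ball and agree with [proj t] on ever longer segments, so [ball_closed]
    yields the image under [t] itself. *)
Lemma not_proj_bounded_open t C : ~ proj_bounded t C -> exists N, forall t', agree N t t' -> ~ proj_bounded t' C.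
Proof.
move=> nb; apply: contrapT => hN; apply: nb => x.
have /choice[y hy] : forall N, exists y : X, nr y <= C * nr x /\
    forall m, (m < N)%N -> coord y m = proj t (coord x) m.
  move=> N; have [t' ag bt] : exists2 t', agree N t t' & proj_bounded t' C.
    apply: contrapT => h; apply: hN; exists N => t' ag bt; apply: h; by exists t'.
  have [y h1 h2] := bt x; exists y; split=> // m mN.
  by rewrite h1 /proj ag.
have [|n m mn|z h1 h2] := @ball_closed y (proj t (coord x)) (C * nr x).
- by move=> n; have [] := hy n.
- by have [_ h] := hy n; exact: h.
by exists z.
Qed.

(* Baire category argument in the Cantor space of all [t : nat -> bool]: the sets
   of [t] with [proj_bounded t k] are closed, and their union is everything. *)
Lemma proj_bounded_cylinder : exists N t C, forall t', agree N t t' -> proj_bounded t' C.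
Proof.
apply: contrapT => hno.
have step (s : (nat -> bool) * nat) (k : nat) : exists s' : (nat -> bool) * nat,
    [/\ (s.2 < s'.2)%N, agree s.2 s.1 s'.1 & forall t', agree s'.2 s'.1 t' -> ~ proj_bounded t' k%:R].
  case: s => t N /=.
  have [t' ag nb] : exists2 t', agree N t t' & ~ proj_bounded t' k%:R.
    apply: contrapT => h; apply: hno; exists N, t, k%:R => t' ag.
    by apply: contrapT => nb; apply: h; exists t'.
  have [N' hN'] := not_proj_bounded_open nb.
  exists (t', maxn N.+1 N'); split=> //=; first by rewrite leq_maxl.
  by move=> t'' ag'; apply: hN' => m mN; apply: ag'; rewrite (leq_trans mN) ?leq_maxr.
have /choice[f hf] : forall sk : ((nat -> bool) * nat) * nat, exists s' : (nat -> bool) * nat,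
    [/\ (sk.1.2 < s'.2)%N, agree sk.1.2 sk.1.1 s'.1 & forall t', agree s'.2 s'.1 t' -> ~ proj_bounded t' sk.2%:R].
  by move=> [s k]; exact: step.
have [s sS] : exists s : nat -> (nat -> bool) * nat, forall k,
    [/\ ((s k).2 < (s k.+1).2)%N, agree (s k).2 (s k).1 (s k.+1).1 &
    forall t', agree (s k.+1).2 (s k.+1).1 t' -> ~ proj_bounded t' k%:R].
  exists (fix s k := if k is k'.+1 then f (s k', k') else (xpredT, 0%N)) => k.
  exact: hf (_, k).
have sk k : (k <= (s k).2)%N.
  by elim: k => // k IH; have [h _ _] := sS k; exact: leq_ltn_trans IH h.
have smono k i : ((s k).2 <= (s (i + k)).2)%N.
  by elim: i => // i IH; have [h _ _] := sS (i + k)%N; rewrite addSn (leq_trans IH)// ltnW.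
have sag k i : agree (s k).2 (s k).1 (s (i + k)%N).1.
  elim: i => // i IH m mk; rewrite (IH _ mk) addSn; have [_ h _] := sS (i + k)%N.
  by apply: h; exact: leq_trans (smono k i).
(* The cylinder [s m.+1] fixes at least [m.+1] entries, so entry [m] no longer changes after it. *)
pose t m := (s m.+1).1 m.
have tag k : agree (s k).2 (s k).1 t.
  move=> m mk; rewrite /t; have [km|km] := leqP k m.+1.
    by have := sag k (m.+1 - k)%N m mk; rewrite subnK.
  have := sag m.+1 (k - m.+1)%N m (sk m.+1); rewrite subnK// ltnW//.
have [C C0 hC] := proj_bounded_ex t.
have [k hk] := ex_intro (fun n => C < n%:R) _ (truncnS_gt C).
have [_ _ h] := sS k; apply: (h t (tag k.+1)); apply: proj_bounded_le hC; exact: ltW.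
Qed.

Lemma proj_bounded_finite N : exists2 C, 0 <= C & forall t, (forall m, (N <= m)%N -> t m = false) -> proj_bounded t C.
Proof.
elim: N => [|N [C C0 hC]].
  exists 0 => // t ht x; exists 0; last by rewrite nr0 mul0r.
  by move=> m; rewrite /proj ht// /coord !linear0.
have [D D0 hD] := proj_bounded_ex (fun m => m == N).
exists (C + D); first exact: addr_ge0.
move=> t ht x.
have [|y hy yC] := hC (fun m => t m && (m < N)%N) _ x.
  by move=> m mN; rewrite ltnNge mN andbF.
have [z hz zD] := hD x.
have [tN|tN] := boolP (t N); last first.
  exists y; last by apply: le_trans yC _; rewrite ler_wpM2r ?nr_ge0// lerDl.
  move=> m; rewrite hy /proj; case: (ltngtP m N) => mN.
  - by rewrite andbT.
  - by rewrite andbF ht.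
  - by rewrite mN andbF (negbTE tN).
exists (y + z); last first.
  by apply: le_trans (nrD _ _) _; rewrite mulrDl lerD.
move=> m; have -> : coord (y + z) m = coord y m + coord z m by rewrite /coord !linearD.
rewrite hy hz /proj; case: (ltngtP m N) => mN.
- by rewrite andbT addr0.
- by rewrite andbF ht// addr0.
- by rewrite mN andbF tN add0r.
Qed.

Lemma proj_bounded_uniform : exists2 C, 0 <= C & forall t, proj_bounded t C.
Proof.
have [N [t0 [C hC]]] := proj_bounded_cylinder; have [D D0 hD] := proj_bounded_finite N.
exists (D + 2 * `|C|); first by rewrite addr_ge0// mulr_ge0.
move=> t x.
(* [t] is decomposed as its part below [N], plus [t0] continued by [t], minus [t0] continued by
   zeros; the last two lie in the cylinder. *)
have [|y hy yD] := hD (fun m => t m && (m < N)%N) _ x.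
  by move=> m mN; rewrite ltnNge mN andbF.
have [|z hz zC] := hC (fun m => if (m < N)%N then t0 m else t m) _ x.
  by move=> m mN; rewrite mN.
have [|v hv vC] := hC (fun m => if (m < N)%N then t0 m else false) _ x.
  by move=> m mN; rewrite mN.
exists (y + (z - v)).
  move=> m; have -> : coord (y + (z - v)) m = coord y m + (coord z m - coord v m).
    by rewrite /coord !linearD !linearN.
  rewrite hy hz hv /proj; case: ltnP => mN; first by rewrite andbT subrr addr0.
  by rewrite andbF add0r subr0.
have := nrD y (z - v); have := nrB z v; have := ler_norm C; have := nr_ge0 x.
have : C * nr x <= `|C| * nr x by rewrite ler_wpM2r ?nr_ge0 ?ler_norm.
lra.
Qed.

Lemma block_vector_ex : exists (U L : R) (xi : nat -> H -> X), [/\ 0 <= U, 0 < L,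
  (forall n v, P n v = v -> forall m, coord (xi n v) m = single v n m),
  (forall n v, P n v = v -> nr (xi n v) <= U * (w1 n * nr v)) &
  (forall n (x : X), L * (w0 n * nr (coord x n)) <= nr x)].
Proof.
have [/emb_real[d [d0 hd]] /emb_real[c [c0 hc]] _] := hX.
have [D D0 hD] := wspace_single (fun n => ltW (w1p n)) hH1.
have [B B0 hB] := coord_bound hH0.
have /choice[f hf] : forall nv : nat * H, exists x : X, P nv.1 nv.2 = nv.2 ->
    (forall m, coord x m = single nv.2 nv.1 m) /\ nr x <= d * D * (w1 nv.1 * nr nv.2).
  move=> [n v] /=; have [hv|hv] := pselect (P n v = v); last by exists 0.
  have [e he ne] := hD n v hv; have [x hx nx] := hd e.
  exists x => _; split; first by move=> m; rewrite -he /coord hx.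
  by apply: le_trans nx _; rewrite -mulrA ler_wpM2l.
have BC : 0 < B * c + 1 by have := mulr_ge0 B0 c0; lra.
exists (d * D), (B * c + 1)^-1, (fun n v => f (n, v)); split.
- exact: mulr_ge0.
- by rewrite invr_gt0.
- by move=> n v hv; have [h _] := hf (n, v) hv.
- by move=> n v hv; have [_ h] := hf (n, v) hv.
- move=> n x; rewrite ler_pdivrMl//; have [h hx nh] := hc x.
  have := hB n h (ltW (w0p n)); have -> : coord h n = coord x n by rewrite /coord hx.
  have : B * nr h <= B * (c * nr x) by rewrite ler_wpM2l.
  by have := nr_ge0 x; lra.
Qed.

Lemma sign_bd C (x : X) (s : nat -> bool) : (forall t, proj_bounded t C) ->
  exists2 z : X, (forall m, coord z m = if s m then coord x m else - coord x m) & nr z <= 2 * C * nr x.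
Proof.
move=> hC; have [y hy yC] := hC s x; have [z hz zC] := hC (fun m => ~~ s m) x.
exists (y - z); last by have := nrB y z; lra.
by move=> m; rewrite (coordB p) hy hz /proj; case: (s m); rewrite ?subr0 ?sub0r.
Qed.

Section Xi.
Variables (xi : nat -> H -> X) (C : R).
Hypotheses (hxi : forall n v, P n v = v -> forall m, coord (xi n v) m = single v n m)
  (C0 : 0 <= C) (hC : forall t, proj_bounded t C).

Lemma coord_sum_xi v N m : (forall i, P i (v i) = v i) ->
  coord (\sum_(i < N) xi i (v i)) m = if (m < N)%N then v m else 0.
Proof.
move=> hv; rewrite (coord_sum p (fun i => xi i (v i))); case: ltnP => mN.
  rewrite (bigD1 (Ordinal mN))//= hxi// /single eqxx big1 ?addr0// => i mi.
  by rewrite hxi// /single ifN// eq_sym.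
by rewrite big1// => i _; rewrite hxi// /single gtn_eqF// (leq_trans (ltn_ord i)).
Qed.

Lemma xiN n v : P n v = v -> xi n (- v) = - xi n v.
Proof.
move=> hv; apply: (coord_inj pinj) => m.
have -> : coord (- xi n v) m = - coord (xi n v) m by rewrite /coord !linearN.
by rewrite !hxi ?linearN ?hv// /single; case: ifP; rewrite ?oppr0.
Qed.

(** Some signed sum satisfies the estimate by the greedy choice, and changing signs in [X] costs at
    most [2 * C]. *)
Lemma sum_xi_le v N : (forall i, P i (v i) = v i) ->
  nr (\sum_(i < N) xi i (v i)) ^+ 2 <= (2 * C) ^+ 2 * \sum_(i < N) nr (xi i (v i)) ^+ 2.
Proof.
move=> hv; have [s hs] := greedy_le (fun i => xi i (v i)) N.
pose v' i := if s i then v i else - v i.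
have hv' i : P i (v' i) = v' i by rewrite /v'; case: ifP; rewrite ?linearN hv.
have e1 : \sum_(i < N) (if s i then xi i (v i) else - xi i (v i)) = \sum_(i < N) xi i (v' i).
  by apply: eq_bigr => i _; rewrite /v'; case: ifP => // _; rewrite xiN.
rewrite e1 in hs.
have [z hz nz] := sign_bd (\sum_(i < N) xi i (v' i)) s hC.
have -> : \sum_(i < N) xi i (v i) = z.
  apply: (coord_inj pinj) => m; rewrite hz !coord_sum_xi// /v'.
  by case: (s m); case: (m < N)%N; rewrite ?oppr0 ?opprK.
apply: (@le_trans _ _ ((2 * C) ^+ 2 * nr (\sum_(i < N) xi i (v' i)) ^+ 2)).
  by rewrite -exprMn lerXn2r ?nnegrE ?mulr_ge0 ?nr_ge0.
by apply: ler_wpM2l => //; exact: sqr_ge0.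
Qed.

Lemma sum_xi_ge v N : (forall i, P i (v i) = v i) ->
  \sum_(i < N) nr (xi i (v i)) ^+ 2 <= (2 * C) ^+ 2 * nr (\sum_(i < N) xi i (v i)) ^+ 2.
Proof.
move=> hv; have [s hs] := greedy_ge (fun i => xi i (v i)) N.
apply: le_trans hs _.
have [z hz nz] := sign_bd (\sum_(i < N) xi i (v i)) s hC.
pose v' i := if s i then v i else - v i.
have hv' i : P i (v' i) = v' i by rewrite /v'; case: ifP; rewrite ?linearN hv.
have -> : \sum_(i < N) (if s i then xi i (v i) else - xi i (v i)) = z.
  rewrite (_ : \sum_(i < N) _ = \sum_(i < N) xi i (v' i)); last first.
    by apply: eq_bigr => i _; rewrite /v'; case: ifP => // _; rewrite xiN.
  apply: (coord_inj pinj) => m; rewrite hz !coord_sum_xi// /v'.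
  by case: (s m); case: (m < N)%N; rewrite ?oppr0.
by rewrite -exprMn lerXn2r ?nnegrE ?mulr_ge0 ?nr_ge0.
Qed.

Lemma block_norm_wspace (w : nat -> R) (D : R) : (forall n, 0 < w n) -> 0 <= D ->
  (forall n v, P n v = v -> w n * nr v <= nr (xi n v) /\ nr (xi n v) <= D * (w n * nr v)) ->
  wspace w X.
Proof.
move=> wp D0 hw.
have wb n v : P n v = v -> (w n * nr v) ^+ 2 <= nr (xi n v) ^+ 2.
  by move=> hv; rewrite lerXn2r ?nnegrE ?mulr_ge0 ?nr_ge0 ?(ltW (wp n))//; have [] := hw n v hv.
have wb' n v : P n v = v -> nr (xi n v) ^+ 2 <= D ^+ 2 * (w n * nr v) ^+ 2.
  move=> hv; rewrite -exprMn lerXn2r ?nnegrE ?mulr_ge0 ?nr_ge0 ?(ltW (wp n))//.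
  by have [] := hw n v hv.
have up v N : (forall i, P i (v i) = v i) ->
    nr (\sum_(i < N) xi i (v i)) ^+ 2 <= (2 * C * D) ^+ 2 * weighted_sum w v N.
  move=> hv; apply: le_trans (sum_xi_le N hv) _.
  rewrite (_ : _ * weighted_sum w v N = (2 * C) ^+ 2 * (D ^+ 2 * weighted_sum w v N)); last by ring.
  apply: ler_wpM2l; first exact: sqr_ge0.
  by rewrite /weighted_sum mulr_sumr; apply: ler_sum => i _; exact: wb'.
(* The first constant serves the coordinate bound, where cutting [x] to its first [N] blocks costs
   another [C]; the second serves the synthesis. *)
exists (Num.max (2 * C * C) (2 * C * D)); split; first by rewrite le_max !mulr_ge0.
- move=> x N; have hv i : P i (coord x i) = coord x i by exact: pP.
  have [y hy yC] := hC (fun m => (m < N)%N) x.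
  have yE : y = \sum_(i < N) xi i (coord x i).
    by apply: (coord_inj pinj) => m; rewrite hy coord_sum_xi.
  apply: (@le_trans _ _ ((2 * C * C * nr x) ^+ 2)); last first.
    rewrite lerXn2r ?nnegrE ?mulr_ge0 ?nr_ge0// ?le_max ?mulr_ge0//.
    by rewrite ler_wpM2r ?nr_ge0// le_max lexx.
  apply: (@le_trans _ _ (\sum_(i < N) nr (xi i (coord x i)) ^+ 2)).
    by apply: ler_sum => i _; exact: wb.
  apply: le_trans (sum_xi_ge N hv) _; rewrite -yE -exprMn.
  rewrite lerXn2r ?nnegrE ?mulr_ge0 ?nr_ge0//.
  by rewrite -[leRHS]mulrA ler_wpM2l ?mulr_ge0.
- move=> h m m0 hh hm.
  pose y N := \sum_(i < N) xi i (h i).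
  pose E2 := 2 * C * D; have E0 : 0 <= E2 by rewrite !mulr_ge0.
  have dy a b : (a <= b)%N -> nr (y b - y a) ^+ 2 <= E2 ^+ 2 * (weighted_sum w h b - weighted_sum w h a).
    move=> ab; pose h' i := if (i < a)%N then 0 else h i.
    have hh' i : P i (h' i) = h' i by rewrite /h'; case: ifP; rewrite ?linear0.
    have -> : y b - y a = \sum_(i < b) xi i (h' i).
      apply: (coord_inj pinj) => i; rewrite (coordB p) !coord_sum_xi// /h'.
      case: (ltnP i a) => ia; first by rewrite (leq_trans ia ab) subrr.
      by rewrite subr0.
    apply: le_trans (up _ b hh') _; apply: ler_wpM2l; first exact: sqr_ge0.
    rewrite /weighted_sum (sum_tail (fun n => (w n * nr (h n)) ^+ 2))//; apply: ler_sum => i _.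
    by rewrite /h'; case: ifP => // _; rewrite nr0 mulr0 expr0n.
  have [l hl] : exists l, cv y l.
    apply: cv_complete => e e0; have E1 : 0 < E2 + 1 by lra.
    have [N hN] := mono_cauchy (@weighted_sum_mono _ _ w h) hm (exprn_gt0 2 (divr_gt0 e0 E1)).
    exists N => a b Na ab.
    rewrite -(@ltr_pXn2r _ 2)// ?nnegrE ?nr_ge0 ?(ltW e0)//.
    apply: le_lt_trans (dy _ _ ab) _; have := hN _ _ Na ab.
    rewrite expr_div_n ltr_pdivlMr ?exprn_gt0//.
    have : 0 <= weighted_sum w h b - weighted_sum w h a by rewrite subr_ge0; exact: weighted_sum_mono.
    nra.
  exists l.
    move=> n; apply: cv_unique (coordX_cv n hl) _ => e e0; exists n.+1 => N nN.
    by rewrite coord_sum_xi// nN subrr nr0.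
  apply: (@le_trans _ _ (E2 * m)); last by rewrite ler_wpM2r// le_max lexx orbT.
  apply: (@cv_nr_le _ _ y l _ 0) hl => N _.
  rewrite -(@ler_pXn2r _ 2)// ?nnegrE ?mulr_ge0 ?nr_ge0//.
  apply: le_trans (up _ N hh) _; rewrite [leRHS]exprMn -/E2.
  by rewrite ler_wpM2l ?sqr_ge0.
Qed.

End Xi.

Lemma xi_scale (xi : nat -> H -> X) n (a : R[i]) v :
  (forall n v, P n v = v -> forall m, coord (xi n v) m = single v n m) ->
  P n v = v -> xi n (a *: v) = a *: xi n v.
Proof.
move=> hxi hv; apply: (coord_inj pinj) => m.
have -> : coord (a *: xi n v) m = a *: coord (xi n v) m by rewrite /coord !linearZ.
by rewrite !hxi ?linearZ /= ?hv// /single; case: ifP; rewrite ?scaler0.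
Qed.

Lemma normalize n v : P n v = v -> v != 0 -> exists u : H,
  [/\ P n u = u, nr u = 1 & v = (nr v)%:C *: u].
Proof.
move=> hv v0; have n0 : nr v != 0 by apply: contra_neq v0 => /nr_eq0.
exists ((nr v)^-1%:C *: v); split.
- by rewrite linearZ /= hv.
- by rewrite nrZr ger0_norm ?invr_ge0 ?nr_ge0// mulVf.
- by rewrite scalerA -rcM divff// scale1r.
Qed.

(* The weight is [w m = inf |e|_X r^|m - n|] over all unit vectors [e] of all
   blocks [P n H]; it is automatically log-Lipschitz.  It is attained up to a
   factor 2 at some [e m] in block [nu m], and one operator mapping each [e m] to
   a nearly worst unit vector [f m] of block [m] compares it with the norm of [X]. *)
Lemma interpolation_wspace : exists (w : nat -> R) (r : R), [/\ 1 <= r,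
  forall n, [/\ 0 < w n, w n.+1 <= r * w n & w n <= r * w n.+1] & wspace w X].
Proof.
have [C C0 hC] := proj_bounded_uniform.
have [U [L [xi [U0 L0 hxi xiU xiL]]]] := block_vector_ex.
have xi0 n : xi n 0 = 0.
  have h := @xi_scale xi n 0 0 hxi; rewrite !scale0r in h; apply: h; exact: linear0.
(* If no block contains a unit vector, all blocks are zero and the constant weight will do. *)
have [[n1 [e1 [Pe1 ne1]]]|none] := pselect (exists n e, P n e = e /\ nr e = 1); last first.
  exists (fun=> 1), 1; split=> // [n|]; first by rewrite mulr1.
  apply: (block_norm_wspace hxi C0 hC (D := 0)) => // n v hv.
  have -> : v = 0.
    apply/eqP/negPn/negP => v0; have [u [Pu nu _]] := normalize hv v0.
    by apply: none; exists n, u.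
  by rewrite xi0 !nr0 !mulr0.
(* The factor [rho] absorbs the quotients of [w0] and [w1]; the factor 2 leaves the decay
   [2^-|m - n|] needed for Schur's test. *)
pose r : R := 2 * rho; have r1 : 1 <= r by move: rho1; rewrite /r; lra.
have r0 : 0 < r by lra.
pose g m n e := r ^+ dist m n * nr (xi n e).
pose S m := [set x : R | exists n e, [/\ P n e = e, nr e = 1 & x = g m n e]].
have S0 m : S m !=set0 by exists (g m n1 e1), n1, e1.
have gL m n e : P n e = e -> nr e = 1 -> L * w0 m <= g m n e.
  move=> Pe ne; have h1 := xiL n (xi n e); rewrite hxi// /single eqxx ne mulr1 in h1.
  apply: (@le_trans _ _ (L * (rho ^+ dist m n * w0 n))).
    by rewrite ler_pM2l//; exact: ratio_dist.
  rewrite mulrCA /g; apply: ler_pM => //; rewrite ?exprn_ge0 ?mulr_ge0 ?(ltW L0) ?(ltW (w0p n))//.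
    by move: rho1; lra.
  by rewrite lerXn2r ?nnegrE /r; move: rho1; lra.
pose w m := inf (S m).
have hinf m : has_inf (S m).
  split; first exact: S0.
  by exists (L * w0 m) => _ [n [e [Pe ne ->]]]; exact: gL.
have wL m : L * w0 m <= w m.
  by apply: lb_le_inf (S0 m) _ => _ [n [e [Pe ne ->]]]; exact: gL.
have wp m : 0 < w m by apply: lt_le_trans (wL m); rewrite mulr_gt0.
have wg m n e : P n e = e -> nr e = 1 -> w m <= g m n e.
  by move=> Pe ne; apply: (ge_inf (proj2 (hinf m))); exists n, e.
have gr m m' n e : dist m m' = 1%N -> g m n e <= r * g m' n e.
  move=> d1; rewrite /g mulrA -exprS; apply: ler_wpM2r; first exact: nr_ge0.
  by apply: ler_weXn2l => //; move: d1; rewrite /dist; lia.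
have wr m m' : dist m m' = 1%N -> w m <= r * w m'.
  move=> d1; rewrite -ler_pdivrMl//; apply: lb_le_inf (S0 m') _ => _ [n [e [Pe ne ->]]].
  by rewrite ler_pdivrMl//; apply: le_trans (wg m n e Pe ne) _; exact: gr.
have /choice[ne hne] : forall m, exists ne : nat * H,
    [/\ P ne.1 ne.2 = ne.2, nr ne.2 = 1 & g m ne.1 ne.2 <= 2 * w m].
  move=> m; have [x [n [e [Pe e1' ->]]] hx] := inf_adherent (wp m) (hinf m).
  by exists (n, e); split=> //=; move: hx; rewrite -/(w m); lra.
pose nu m := (ne m).1; pose e m := (ne m).2.
have Pe m : P (nu m) (e m) = e m by have [] := hne m.
have nre m : nr (e m) = 1 by have [] := hne m.
have ge2 m : g m (nu m) (e m) <= 2 * w m by have [] := hne m.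
(* In a zero block [f m = 0]. Otherwise the supremum of the norms of unit vectors is finite, by the
   embedding of [H1] in [X], and nearly attained. *)
have /choice[f hf] : forall m, exists f, [/\ P m f = f, nr f <= 1 &
    forall v, P m v = v -> nr v = 1 -> nr (xi m v) <= 2 * nr (xi m f)].
  move=> m; have [[v [Pv nv]]|no] := pselect (exists v, P m v = v /\ nr v = 1); last first.
    exists 0; split=> [||v Pv nv]; [exact: linear0|by rewrite nr0|].
    by exfalso; apply: no; exists v.
  pose Z := [set x : R | exists v, [/\ P m v = v, nr v = 1 & x = nr (xi m v)]].
  have Z0 x : Z x -> 0 < x.
    move=> [u [Pu nu' ->]]; have := xiL m (xi m u).
    rewrite hxi// /single eqxx nu' mulr1; apply: lt_le_trans; exact: mulr_gt0.
  have ZM x : Z x -> x <= U * w1 m.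
    by move=> [u [Pu nu' ->]]; have := xiU m u Pu; rewrite nu' mulr1.
  have Zne : Z !=set0 by exists (nr (xi m v)), v.
  have [_ [u [Pu nu' ->]] hu] := near_sup Zne Z0 ZM.
  exists u; split=> //; first by rewrite nu'.
  by move=> v' Pv' nv'; apply: hu; exists v'.
have Pf m : P m (f m) = f m by have [] := hf m.
have nf m : nr (f m) <= 1 by have [] := hf m.
pose q m := r^-1 ^+ dist m (nu m).
have q0 m : 0 <= q m by rewrite exprn_ge0// invr_ge0 ltW.
pose tau (h : nat -> H) m : H := ((q m)%:C * ip (h (nu m)) (e m)) *: f m.
have taug : blockwise_linear tau.
  split=> [a h h' n|h n _]; last by rewrite /tau linearZ /= Pf.
  by rewrite /tau ipDl ipZl mulrDr scalerDl scalerA mulrCA.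
(* Each row [m] has a single entry, in column [nu m], but one column may serve many rows; Schur's
   test controls their total. *)
have taub (wi : nat -> R) :
    (forall n, [/\ 0 < wi n, wi n.+1 <= rho * wi n & wi n <= rho * wi n.+1]) -> weight_bounded wi tau.
  move=> hwi; have wip n : 0 < wi n by have [] := hwi n.
  exists 3 => // h B B0 hB N.
  (* The columns [nu m] of the first [N] rows may lie beyond [N]. *)
  pose N' := (\max_(m < N) nu m).+1.
  apply: (@le_trans _ _ (9 * weighted_sum wi h N')); last first.
    by rewrite exprMn (_ : 3 ^+ 2 = 9); [rewrite ler_pM2l|lra].
  apply: (@schur R (fun n => wi n * nr (h n)) (fun m => wi m * nr (tau h m))).
    by move=> m; rewrite mulr_ge0 ?nr_ge0 ?ltW.
  move=> m mN; have nuN : (nu m < N')%N.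
    by rewrite /N' ltnS; exact: (leq_bigmax (Ordinal mN)).
  rewrite (bigD1 (Ordinal nuN))//=.
  have rest : 0 <= \sum_(i < N' | i != Ordinal nuN) decay R m i * (wi i * nr (h i)).
    by apply: sumr_ge0 => i _; rewrite !mulr_ge0 ?decay_ge0 ?nr_ge0 ?ltW.
  apply: (@le_trans _ _ (decay R m (nu m) * (wi (nu m) * nr (h (nu m))))); last by lra.
  have h1 : nr (tau h m) <= q m * nr (h (nu m)).
    rewrite /tau nrZ cabsM cabsr ger0_norm//.
    have c1 := cauchy_schwarz (h (nu m)) (e m); rewrite nre mulr1 in c1.
    apply: (@le_trans _ _ (q m * cabs (ip (h (nu m)) (e m)))).
      by rewrite ler_piMr// ?mulr_ge0 ?cabs_ge0.
    by rewrite ler_wpM2l.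
  have h2 := ratio_dist rho1 hwi m (nu m).
  have h3 : decay R m (nu m) = rho ^+ dist m (nu m) * q m.
    rewrite /decay /q -exprMn -/(dist m (nu m)); congr (_ ^+ _).
    by rewrite /r; field; rewrite gt_eqF//; move: rho1; lra.
  rewrite h3; apply: (@le_trans _ _ ((rho ^+ dist m (nu m) * wi (nu m)) * (q m * nr (h (nu m))))).
    by apply: ler_pM => //; [exact: ltW|exact: nr_ge0].
  by rewrite le_eqVlt; apply/orP; left; apply/eqP; ring.
have [c c0 hc] := tau_bounded taug (taub w0 w0r) (taub w1 w1r).
have key m : nr (xi m (f m)) <= 2 * (C * c) * w m.
  have [x hx nx] := hc (xi (nu m) (e m)).
  (* The image of [e m] may have components in other blocks too; projecting to block [m] leaves
     [q m] times [f m]. *)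
  have [y hy ny] := hC (fun i => i == m) x.
  have yE : y = (q m)%:C *: xi m (f m).
    apply: (coord_inj pinj) => i.
    have -> : coord ((q m)%:C *: xi m (f m)) i = (q m)%:C *: coord (xi m (f m)) i.
      by rewrite /coord !linearZ.
    rewrite hy hxi// /proj /single; case: eqP => [->|_]; last by rewrite scaler0.
    by rewrite hx /tau hxi// /single eqxx ipuu nre expr1n mulr1.
  have qr : r ^+ dist m (nu m) * q m = 1 by rewrite /q -exprMn divff ?gt_eqF// expr1n.
  rewrite yE nrZr ger0_norm// in ny.
  have h1 : q m * nr (xi m (f m)) <= C * c * nr (xi (nu m) (e m)).
    by apply: le_trans ny _; rewrite -mulrA ler_wpM2l.
  have rd : 0 <= r ^+ dist m (nu m) by rewrite exprn_ge0// ltW.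
  have -> : nr (xi m (f m)) = r ^+ dist m (nu m) * (q m * nr (xi m (f m))).
    by rewrite [RHS]mulrA qr mul1r.
  apply: (@le_trans _ _ (r ^+ dist m (nu m) * (C * c * nr (xi (nu m) (e m))))).
    by rewrite ler_wpM2l.
  have := ler_wpM2l (mulr_ge0 C0 c0) (ge2 m); rewrite /g; lra.
exists w, r; split=> //.
  by move=> n; split=> //; apply: wr; rewrite /dist; lia.
(* One factor 2 comes from the near-infimum at [e m], the other from the near-supremum at [f m]. *)
apply: (block_norm_wspace hxi C0 hC (D := 4 * (C * c))) => //; first by rewrite !mulr_ge0.
move=> m v hv; have [->|v0] := eqVneq v 0; first by rewrite xi0 !nr0 !mulr0.
have [u [Pu nu1 ev]] := normalize hv v0.
have -> : nr (xi m v) = nr v * nr (xi m u).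
  by rewrite {1}ev xi_scale// nrZr ger0_norm ?nr_ge0.
have l1 : w m <= nr (xi m u).
  have := wg m m u Pu nu1; rewrite /g (_ : dist m m = 0%N) ?expr0 ?mul1r//.
  by rewrite /dist; lia.
have l2 : nr (xi m u) <= 2 * nr (xi m (f m)) by have [_ _ h] := hf m; exact: h.
split; first by rewrite mulrC ler_wpM2l ?nr_ge0.
rewrite (_ : 4 * (C * c) * (w m * nr v) = nr v * (4 * (C * c) * w m)); last by ring.
apply: ler_wpM2l; first exact: nr_ge0.
by have := key m; lra.
Qed.
End Necessity.

(** * Step functions and powers in the class OR *)

Section Weights.
Variable R : realType.

Lemma blk_unique (t : R) m n : blk m t -> blk n t -> m = n.
Proof.
move=> hm hn; apply/eqP/negPn/negP => mn.
have ht : (blk m `&` blk n) t by split.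
by rewrite (blk_disj _ mn) in ht.
Qed.

Lemma blk_ex (t : R) : 1 <= t -> exists n, blk n t.
Proof.
move=> t1; have : [set` `[(1 : R), +oo[] t by rewrite /= in_itv /= t1.
by rewrite -blk_bigcup => -[n _ h]; exists n.
Qed.

Definition step_fun (w : nat -> R) (t : R) : R := xget 0 [set y | exists2 n, blk n t & y = w n].

Lemma step_funE w n (t : R) : blk n t -> step_fun w t = w n.
Proof.
move=> h; rewrite /step_fun; case: xgetP => [y _ [m hm ->]|/(_ (w n))[]].
  by rewrite (blk_unique hm h).
by exists n.
Qed.

Lemma dyadic_step w : dyadic (step_fun w) = w.
Proof. by apply/funext => n; rewrite /dyadic (step_funE _ (blk_pow R n)). Qed.

(** Multiplying [t] by at most 2 moves it at most one dyadic block up, so a single quotient of [w]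
    is involved. *)
Lemma step_OR w (r : R) : 1 <= r ->
  (forall n, [/\ 0 < w n, w n.+1 <= r * w n & w n <= r * w n.+1]) -> class_OR (step_fun w).
Proof.
move=> r1 hw; split.
- move=> _ Y mY; rewrite -blk_bigcup setI_bigcupl.
  apply: bigcup_measurable => n _.
  have [wY|wY] := pselect (Y (w n)).
    rewrite (_ : _ `&` _ = blk n); first exact: measurable_blk.
    by apply/seteqP; split=> [t []//|t h]; split=> //=; rewrite (step_funE _ h).
  rewrite (_ : _ `&` _ = set0) //.
  by apply/seteqP; split=> // t [h] /=; rewrite (step_funE _ h).
- by move=> t /blk_ex[n h]; rewrite (step_funE _ h); have [] := hw n.
exists 2, r; split=> //; first by lra.
move=> t l t1 l1 l2; have [n hn] := blk_ex t1; rewrite (step_funE _ hn).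
have [wp h1 h2] := hw n; have r0 : 0 < r by lra.
have [m hm lm] : exists2 m, blk m (l * t) & m = n \/ m = n.+1.
  have lt1 : 1 <= l * t by nra.
  move: hn; rewrite /blk /= in_itv /= => /andP[a1 a2].
  have [lt2|lt2] := ltP (l * t) (2 ^+ n.+1).
    by exists n; [rewrite /blk /= in_itv /= lt2 andbT; nra|left].
  exists n.+1; last by right.
  by rewrite /blk /= in_itv /= lt2 (exprS _ n.+1); nra.
rewrite (step_funE _ hm) ler_pdivlMr// ler_pdivrMr// ler_pdivrMl//.
by case: lm => ->; split=> //; rewrite ler_peMl// ltW.
Qed.

Lemma powR_OR (s : R) : class_OR (fun t : R => t `^ s).
Proof.
split.
- exact: measurable_funS (measurable_powR s).
- by move=> t t1; rewrite powR_gt0//; lra.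
exists 2, (2 `^ `|s|); split; first by lra.
  by rewrite -[leLHS](powRr0 2) ler_powR// ler1n.
move=> t l t1 l1 l2.
have t0 : 0 < t by lra.
have l0 : 0 < l by lra.
have ts : 0 < t `^ s by rewrite powR_gt0.
rewrite (powRM _ (ltW l0) (ltW t0)) mulfK ?gt_eqF//.
have h : l `^ `|s| <= 2 `^ `|s| by rewrite ge0_ler_powR ?nnegrE ?(ltW l0).
split; last by apply: le_trans h; rewrite ler_powR// ler_norm.
apply: (@le_trans _ _ (l `^ (- `|s|))); last by rewrite ler_powR// lerNl -normrN ler_norm.
by rewrite powRN lef_pV2 ?posrE ?powR_gt0.
Qed.

Lemma dyadic_powR (q n : nat) : dyadic (fun t : R => t `^ q%:R) n = (2 ^+ q) ^+ n.
Proof. by rewrite /dyadic powR_mulrn ?exprn_ge0// -!exprM mulnC. Qed.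

Lemma dyadic_powRN (q n : nat) : dyadic (fun t : R => t `^ (- q%:R)) n = ((2 ^+ q) ^+ n)^-1.
Proof. by rewrite -dyadic_powR /dyadic powRN. Qed.
End Weights.

(** With [d = |m - n|], the quotient [w m / w n] is at most [r ^+ d <= 2^-1 ^+ d * a ^+ d]. The
    factor [a ^+ d] is supplied by the weight of [H0] if [m <= n] and by that of [H1] otherwise,
    which leaves the decay required by [kern]. *)
Lemma OR_interpolation (R : realType) (H K : hilbertType R)
    (P : nat -> {linear H -> H}) (p : nat -> {linear K -> H})
    (w : nat -> R) (r a : R) (H0 H1 X : hilbert_manifold K) :
  (forall n y, P n (p n y) = p n y) -> (forall x y, (forall n, p n x = p n y) -> x = y) ->
  1 <= r -> (forall n, [/\ 0 < w n, w n.+1 <= r * w n & w n <= r * w n.+1]) ->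
  0 < a -> 2 * r <= a -> wspace P p w X ->
  wspace P p (fun n => (a ^+ n)^-1) H0 -> wspace P p (fun n => a ^+ n) H1 ->
  interpolation_space H0 H1 X.
Proof.
move=> pP pinj r1 hr a0 ra2 wX wH0 wH1.
have wp n : 0 < w n by have [] := hr n.
have wp' n : 0 <= w n by exact: ltW.
have an n : 0 < a ^+ n by rewrite exprn_gt0.
have an' n : 0 <= a ^+ n by exact: ltW.
have rd := ratio_dist r1 hr.
have ra : r <= a by lra.
have rpow d : r ^+ d <= a ^+ d by rewrite lerXn2r ?nnegrE//; lra.
have decay_r d : r ^+ d <= 2^-1 ^+ d * a ^+ d.
  by rewrite -exprMn lerXn2r ?nnegrE//; lra.
pose c := (w 0%N)^-1 + w 0%N.
have iw0 : 0 <= (w 0%N)^-1 by rewrite invr_ge0.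
have c0 : 0 <= c by rewrite addr_ge0.
apply: (wspace_interpolation pP pinj wp _ an wX wH0 wH1 c0).
- by move=> n; rewrite invr_gt0.
- move=> n; have := rd 0%N n; rewrite /dist sub0n subn0 add0n => h.
  apply: (@le_trans _ _ ((w 0%N)^-1 * w n)); last by rewrite ler_wpM2r// lerDl.
  rewrite ler_pdivlMl// ler_pdivrMr//; apply: le_trans h _; rewrite mulrC.
  by rewrite ler_pM2l.
- move=> n; have := rd n 0%N; rewrite /dist sub0n subn0 addn0 => h.
  apply: (@le_trans _ _ (w 0%N * a ^+ n)); last by rewrite ler_wpM2r// lerDr.
  by apply: le_trans h _; rewrite mulrC ler_pM2l.
move=> m n; rewrite /decay; have h := rd m n; rewrite /dist in h.
set d := ((m - n) + (n - m))%N in h *.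
have h' : w m <= 2^-1 ^+ d * a ^+ d * w n by apply: le_trans h _; rewrite ler_wpM2r.
have [mn|nm] := leqP m n; [left|right].
  have -> : a ^+ n = a ^+ d * a ^+ m by rewrite -exprD; congr (_ ^+ _); lia.
  rewrite ler_pdivrMr ?mulr_gt0//.
  rewrite (_ : _ * _ * (_ * _) = 2^-1 ^+ d * a ^+ d * w n)//.
  by field; rewrite gt_eqF.
have -> : a ^+ m = a ^+ d * a ^+ n by rewrite -exprD; congr (_ ^+ _); lia.
rewrite (_ : _ * (_ * _) = 2^-1 ^+ d * a ^+ d * w n * a ^+ n); last by ring.
by rewrite ler_wpM2r.
Qed.

Theorem theorem2p1 (R : realType) (H : hilbertType R)
    (H_separable : separable_space H)
    (H_infinite : ~ finite_dimensional H)
    (A : operator H)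
    (A_linear : linear_operator A)
    (A_self_adjoint : self_adjoint A)
    (A_unbounded : ~ bounded_operator A)
    (A_ge1 : forall u : H, dom A u -> hdot u u <= hdot (A u) u)
    (K : hilbertType R) (j : H -> K)
    (K_chi : is_completion (op_fun A (@chi R)) j)
    (X : hilbert_manifold K) :
  extended_scale A j X <->
  exists phi : R -> R, class_OR phi /\
    exists Y : hilbert_manifold K,
      is_Hphi_space A j phi Y /\ equal_up_to_norms X Y.
Proof.
have [P [p [hP pP pinj spaceE spaceX]]] := scale_coords K_chi.
split.
  move=> [s0 [s1 [_ [H0 [H1 [hH0 hH1 hX]]]]]].
  have [r0 r01 hr0] := OR_ratio (powR_OR s0).
  have [r1 r11 hr1] := OR_ratio (powR_OR s1).
  have ratio (w : nat -> R) (r rho : R) : r <= rho ->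
      (forall n, [/\ 0 < w n, w n.+1 <= r * w n & w n <= r * w n.+1]) ->
      forall n, [/\ 0 < w n, w n.+1 <= rho * w n & w n <= rho * w n.+1].
    move=> rr hw n; have [a b c] := hw n; have [a' _ _] := hw n.+1.
    split=> //; [apply: le_trans b _|apply: le_trans c _]; by rewrite ler_pM2r.
  have m0 : r0 <= Num.max r0 r1 by rewrite le_max lexx.
  have m1 : r1 <= Num.max r0 r1 by rewrite le_max lexx orbT.
  have [w [r [r1' hw wX]]] := interpolation_wspace pP pinj (le_trans r01 m0)
    (ratio _ _ _ m0 hr0) (ratio _ _ _ m1 hr1)
    (spaceE _ _ (powR_OR s0) hH0) (spaceE _ _ (powR_OR s1) hH1) hX.
  have hOR := step_OR r1' hw.
  exists (step_fun w); split=> //.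
  have [Y hY] := spaceX _ hOR; exists Y; split=> //.
  have := spaceE _ _ hOR hY; rewrite dyadic_step => wY.
  by apply: (wspace_eq pP pinj _ wX wY) => n; have [/ltW] := hw n.
move=> [phi [hOR [Y [hY XY]]]].
have wX := wspace_transfer XY (spaceE _ _ hOR hY).
have [r r1 hr] := OR_ratio hOR.
(* The exponents are [-q] and [q]; their dyadic weights are powers of [a = 2 ^+ q], and [2 * r <= a]
   is the requirement of [OR_interpolation]. *)
have [q hq] : exists q : nat, 2 * r <= 2 ^+ q.
  have [q hq] := ex_intro (fun n => 2 * r < n%:R) _ (truncnS_gt (2 * r)).
  by exists q; apply/ltW/(lt_trans hq); rewrite -natrX ltr_nat ltn_expl.
have q0 : (0 < q)%N by case: q hq => //; rewrite expr0; lra.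
exists (- q%:R), q%:R; split.
  have : 0 < (q%:R : R) by rewrite ltr0n.
  lra.
have [H0 hH0] := spaceX _ (powR_OR (- q%:R)).
have [H1 hH1] := spaceX _ (powR_OR q%:R).
exists H0, H1; split=> //.
have [a [a0 ra wH0 wH1]] : exists a : R, [/\ 0 < a, 2 * r <= a,
    wspace P p (fun n => (a ^+ n)^-1) H0 & wspace P p (fun n => a ^+ n) H1].
  exists (2 ^+ q); split; rewrite ?exprn_gt0//.
    rewrite (_ : (fun n => _) = dyadic (fun t : R => t `^ (- q%:R))).
      exact: spaceE (powR_OR _) hH0.
    by apply/funext => n; rewrite dyadic_powRN.
  rewrite (_ : (fun n => _) = dyadic (fun t : R => t `^ q%:R)).
    exact: spaceE (powR_OR _) hH1.
  by apply/funext => n; rewrite dyadic_powR.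
exact: OR_interpolation pP pinj r1 hr a0 ra wX wH0 wH1.
Qed.
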